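(* Let $\Delta=(Q,\Gamma,\delta,\mathit{Prob})$ be a pPDA, $\mathcal{A}=(A,\xi,a_0,\mathit{Acc})$ a $\Delta$-observing automaton, and $pX\in Q\times\Gamma$. Then $\mathcal{P}(\mathit{Run}(pX,\mathit{Acc}))$ is effectively expressible in the first-order theory $(\mathbb{R},+,*,\leq)$. In particular, for every rational $y$ and every ${\sim}\in\{\leq,<,\geq,>,=\}$ there effectively exists a closed formula of $(\mathbb{R},+,*,\leq)$ which holds iff $\mathcal{P}(\mathit{Run}(pX,\mathit{Acc}))\sim y$.
   Context: A pPDA is $\Delta=(Q,\Gamma,\delta,\mathit{Prob})$: finite $Q$, finite $\Gamma$, finite rules $pX\to q\alpha$ ($\alpha\in\Gamma^*$) with probabilities in $(0,1]$ summing to $0$ or $1$ for each $pX$. Configurations $p\alpha\in Q\times\Gamma^*$ (top of stack leftmost); $\mathcal{T}_\Delta$ has $pX\beta\xrightarrow{x}q\alpha\beta$ for each rule $pX\xrightarrow{x}q\alpha$, $\beta\in\Gamma^*$. Runs are maximal paths; $\mathit{Run}(s)$ carries the measure $\mathcal{P}$ with $\mathcal{P}(\mathit{Run}(s_0;\dots;s_m))=\prod_{i<m}\mathit{Prob}(s_i\to s_{i+1})$ on basic cylinders. The head of $qY\alpha$ ($Y\in\Gamma$) is $qY$; $\mathcal{H}(\Delta)=Q\times\Gamma$. In an infinite run $w=p_1\alpha_1;p_2\alpha_2;\dots$ the (occurrence of the) configuration $p_i\alpha_i$ is a minimum if $|\alpha_i|\le|\alpha_j|$ for all $j\ge i$;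 $\min_k(w)$ is the $k$-th minimum in order of occurrence. A $\Delta$-observing automaton is $\mathcal{A}=(A,\xi,a_0,\mathit{Acc})$ with finite $A$, total $\xi:A\times\mathcal{H}(\Delta)\to A$, $a_0\in A$, and $\mathit{Acc}\subseteq2^A$. For an infinite run $w$ and $i\ge1$, $\mathit{Obs}_i(w)$ is the state reached by $\mathcal{A}$ from $a_0$ after reading the heads of all configurations strictly after $\min_i(w)$ up to and including $\min_{i+1}(w)$; $\mathit{Obs}(w)=\mathit{Obs}_1(w)\mathit{Obs}_2(w)\cdots$. An infinite run $w$ is accepting if the set of states occurring infinitely often in $\mathit{Obs}(w)$ belongs to $\mathit{Acc}$. $\mathit{Run}(pX,\mathit{Acc})$ is the set of accepting runs starting in $pX$.
   Formalization: The transition probabilities are assumed to be given in the input by formulas of (R,+,*,<=) expressing them (rationals are a special case); for arbitrary real probabilities the claim fails, e.g. an accepting probability equal to pi/4 is not expressible. *)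

(* Defs.v *)
From HB Require Import structures.
From mathcomp Require Import all_boot all_order all_algebra.
From mathcomp Require Import finmap.
From mathcomp Require Import all_classical all_reals all_analysis.

Set Implicit Arguments.
Unset Strict Implicit.
Unset Printing Implicit Defensive.

Import Order.TTheory GRing.Theory Num.Theory.

Local Open Scope classical_set_scope.
Local Open Scope ring_scope.

(** * First-order theory of (R, +, *, <=) *)

(* The signature has no constants, so formulas are finite objects; 0, 1 and
   all rational numbers are definable. Variables are named by natural numbers
   and a quantifier rebinds the variable it mentions. *)
Inductive fo_term : Type :=
  | TVar of nat
  | TAdd of fo_term & fo_term
  | TMul of fo_term & fo_term.

Inductive fo : Type :=
  | FLe of fo_term & fo_term
  | FEq of fo_term & fo_term
  | FNot of fo
  | FAnd of fo & fo
  | FOr of fo & fo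
  | FImp of fo & fo
  | FAll of nat & fo
  | FEx of nat & fo.

Fixpoint fo_term_fv (t : fo_term) : seq nat :=
  match t with
  | TVar i => [:: i]
  | TAdd t1 t2 | TMul t1 t2 => fo_term_fv t1 ++ fo_term_fv t2
  end.

Fixpoint fo_fv (f : fo) : seq nat :=
  match f with
  | FLe t1 t2 | FEq t1 t2 => fo_term_fv t1 ++ fo_term_fv t2
  | FNot g => fo_fv g
  | FAnd g h | FOr g h | FImp g h => fo_fv g ++ fo_fv h
  | FAll i g | FEx i g => [seq j <- fo_fv g | j != i]
  end.

Definition fo_closed (f : fo) : Prop := fo_fv f = [::].

Section FoSemantics.
Variable R : realType.
Implicit Type e : nat -> R.

Definition env_upd e (i : nat) (x : R) : nat -> R :=
  fun j => if j == i then x else e j.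

Fixpoint fo_eval e (t : fo_term) : R :=
  match t with
  | TVar i => e i
  | TAdd t1 t2 => fo_eval e t1 + fo_eval e t2
  | TMul t1 t2 => fo_eval e t1 * fo_eval e t2
  end.

Fixpoint fo_sat e (f : fo) : Prop :=
  match f with
  | FLe t1 t2 => fo_eval e t1 <= fo_eval e t2
  | FEq t1 t2 => fo_eval e t1 = fo_eval e t2
  | FNot g => ~ fo_sat e g
  | FAnd g h => fo_sat e g /\ fo_sat e h
  | FOr g h => fo_sat e g \/ fo_sat e h
  | FImp g h => fo_sat e g -> fo_sat e h
  | FAll i g => forall x : R, fo_sat (env_upd e i x) g
  | FEx i g => exists x : R, fo_sat (env_upd e i x) g
  end.

Definition fo_holds (f : fo) : Prop := forall e, fo_sat e f.

(* The free variable of an expressing formula is variable number 0. *)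
Definition expresses (f : fo) (c : R) : Prop :=
  all (pred1 0%N) (fo_fv f) /\ forall e, fo_sat e f <-> e 0%N = c.

End FoSemantics.

(** * Computability *)

(* Partial recursive functions on binary trees, presented by a while language
   without variables: the tree is the store, [Leaf] is both nil and "false".
   The language is Turing complete (a counter machine keeps its control state
   and its counters, in unary, in a tuple). *)
Inductive tree : Type :=
  | Leaf
  | Node of tree & tree.

Inductive prog : Type :=
  | PId
  | PNil
  | PFst
  | PSnd
  | PPair of prog & prog
  | PComp of prog & prog
  | PIf of prog & prog & prog
  | PWhile of prog & prog.

(* [computes M x y]: the program M halts on input x with output y. *)
Inductive computes : prog -> tree -> tree -> Prop :=
  | run_id x : computes PId x x
  | run_nil x : computes PNil x Leaf
  | run_fst_leaf : computes PFst Leaf Leaf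
  | run_fst x y : computes PFst (Node x y) x
  | run_snd_leaf : computes PSnd Leaf Leaf
  | run_snd x y : computes PSnd (Node x y) y
  | run_pair f g x y z : computes f x y -> computes g x z ->
      computes (PPair f g) x (Node y z)
  | run_comp f g x y z : computes f x y -> computes g y z ->
      computes (PComp g f) x z
  | run_if_true c f g x u v y : computes c x (Node u v) -> computes f x y ->
      computes (PIf c f g) x y
  | run_if_false c f g x y : computes c x Leaf -> computes g x y ->
      computes (PIf c f g) x y
  | run_while_stop c f x : computes c x Leaf -> computes (PWhile c f) x x
  | run_while_step c f x u v y z : computes c x (Node u v) ->
      computes f x y -> computes (PWhile c f) y z ->
      computes (PWhile c f) x z.

(** * Encoding of finite objects as trees *)

Definition enc_nat (n : nat) : tree := iter n (Node Leaf) Leaf.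

Definition enc_seq (T : Type) (enc : T -> tree) (s : seq T) : tree :=
  foldr (fun x t => Node (enc x) t) Leaf s.

Definition enc_fin (T : finType) (x : T) : tree := enc_nat (enum_rank x).

Definition enc_int (z : int) : tree :=
  match z with
  | Posz n => Node Leaf (enc_nat n)
  | Negz n => Node (Node Leaf Leaf) (enc_nat n)
  end.

Definition enc_rat (y : rat) : tree := Node (enc_int (numq y)) (enc_int (denq y)).

Fixpoint enc_term (t : fo_term) : tree :=
  match t with
  | TVar i => Node (enc_nat 0) (enc_nat i)
  | TAdd t1 t2 => Node (enc_nat 1) (Node (enc_term t1) (enc_term t2))
  | TMul t1 t2 => Node (enc_nat 2) (Node (enc_term t1) (enc_term t2))
  end.

Fixpoint enc_fo (f : fo) : tree :=
  match f with
  | FLe t1 t2 => Node (enc_nat 0) (Node (enc_term t1) (enc_term t2))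
  | FEq t1 t2 => Node (enc_nat 1) (Node (enc_term t1) (enc_term t2))
  | FNot g => Node (enc_nat 2) (enc_fo g)
  | FAnd g h => Node (enc_nat 3) (Node (enc_fo g) (enc_fo h))
  | FOr g h => Node (enc_nat 4) (Node (enc_fo g) (enc_fo h))
  | FImp g h => Node (enc_nat 5) (Node (enc_fo g) (enc_fo h))
  | FAll i g => Node (enc_nat 6) (Node (enc_nat i) (enc_fo g))
  | FEx i g => Node (enc_nat 7) (Node (enc_nat i) (enc_fo g))
  end.

Inductive comparison_sym : Type := CLe | CLt | CGe | CGt | CEq.

Definition enc_cmp (c : comparison_sym) : tree :=
  enc_nat match c with CLe => 0 | CLt => 1 | CGe => 2 | CGt => 3 | CEq => 4 end.

Definition cmp_rel (R : realType) (c : comparison_sym) (x y : R) : Prop :=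
  match c with
  | CLe => x <= y
  | CLt => x < y
  | CGe => x >= y
  | CGt => x > y
  | CEq => x = y
  end.

(** * Probabilistic pushdown automata *)

(* ((p, X), (q, alpha)) stands for the rule pX -> q alpha. *)
Definition rule (Q Γ : finType) : Type := ((Q * Γ) * (Q * seq Γ))%type.

(* The values of [prob] outside [rules] are irrelevant. *)
Record ppda (R : realType) (Q Γ : finType) : Type := PPDA {
  rules : {fset rule Q Γ};
  prob : rule Q Γ -> R;
  prob_bounds : forall r, r \in rules -> 0 < prob r <= 1;
  prob_sum : forall h : Q * Γ,
    let total := \sum_(r <- enum_fset rules | r.1 == h) prob r in
    total = 0 \/ total = 1
}.

Section Runs.
Variables (R : realType) (Q Γ : finType) (Δ : ppda R Q Γ).

(* The top of the stack is the first letter. *)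
Definition config : Type := (Q * seq Γ)%type.

Definition fires (s t : config) (r : rule Q Γ) : bool :=
  match s with
  | (p, X :: β) => (r.1 == (p, X)) && (t == (r.2.1, r.2.2 ++ β))
  | (_, [::]) => false
  end.

Definition step (s t : config) : bool := has (fires s t) (enum_fset (rules Δ)).

(* At most one rule contributes to the sum. *)
Definition step_prob (s t : config) : R :=
  \sum_(r <- enum_fset (rules Δ) | fires s t r) prob Δ r.

(* Maximal paths as option-valued sequences: a finite path is continued by
   [None] after its last configuration, which has no successor. *)
Definition is_run (s : config) (w : nat -> option config) : Prop :=
  w 0%N = Some s /\
  forall i, match w i, w i.+1 return Prop with
            | Some t, Some u => step t u
            | Some t, None => forall u, ~~ step t u
            | None, Some _ => False
            | None, None => True
            end.

Definition next_config (o : option config) : option config :=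
  if o is Some (p, X :: β) then
    if [seq r <- enum_fset (rules Δ) | r.1 == (p, X)] is r :: _
    then Some (r.2.1, r.2.2 ++ β) else None
  else None.

Lemma is_run_iter_next (s : config) :
  is_run s (fun i => iter i next_config (Some s)).
Proof.
split=> // i /=; case: (iter i _ _) => [[p [|X β]]|] //=.
  by move=> u; apply/hasPn.
have mem_l r : (r \in [seq r <- enum_fset (rules Δ) | r.1 == (p, X)]) =
    (r.1 == (p, X)) && (r \in enum_fset (rules Δ)) by rewrite mem_filter.
case: (seq.filter _ _) mem_l => [|r l] mem_l.
  move=> u; apply/hasPn => r rin; apply/negP => /andP[r1 _].
  by have := mem_l r; rewrite r1 rin.
have := mem_l r; rewrite mem_head => /esym/andP[r1 rin].
by apply/hasP; exists r => //=; rewrite r1 !eqxx.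
Qed.

Definition run (s : config) : Type := {w : nat -> option config | is_run s w}.

HB.instance Definition _ (s : config) := gen_eqMixin (run s).
HB.instance Definition _ (s : config) := gen_choiceMixin (run s).
HB.instance Definition _ (s : config) :=
  isPointed.Build (run s) (exist _ _ (is_run_iter_next s)).

(* Run(s; u_1; ...; u_m), for u = [:: u_1; ...; u_m]. *)
Definition cylinder (s : config) (u : seq config) : set (run s) :=
  [set w | forall i, (i <= size u)%N -> sval w i = Some (nth s (s :: u) i)].

Definition cylinders (s : config) : set (set (run s)) :=
  [set @cylinder s u | u in [set u | path step s u]].

Definition run_space (s : config) := g_sigma_algebraType (@cylinders s).

(* These values determine the measure: on Run(s) itself (u = [::]) it is 1. *)
Definition is_run_measure (s : config)
    (P : {measure set (run_space s) -> \bar R}) : Prop :=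
  forall u : seq config, path step s u ->
    P (@cylinder s u) =
    (\prod_(i < size u) step_prob (nth s (s :: u) i) (nth s u i))%:E.

End Runs.

(** * Observing automata *)

Record observer (Q Γ : finType) (A : finType) : Type := Observer {
  obs_step : A -> Q * Γ -> A;
  obs_init : A;
  obs_acc : {set {set A}}
}.

Section Acceptance.
Variables (R : realType) (Q Γ : finType) (Δ : ppda R Q Γ).
Variables (A : finType) (𝒜 : observer Q Γ A) (s : config Q Γ).
Implicit Type w : run Δ s.

Definition infinite_run w : Prop := forall i, sval w i <> None.

(* Positions are numbered from 0, as are the minima and the observations. The
   definitions down to [inf_obs] are only meaningful for infinite runs. *)
Definition conf w (i : nat) : config Q Γ := odflt s (sval w i).

Definition is_min w (i : nat) : Prop :=
  forall j, (i <= j)%N -> (size (conf w i).2 <= size (conf w j).2)%N.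

Definition min_pos w (k : nat) : nat :=
  xget 0%N [set i | is_min w i /\ (\sum_(j < i) `[< is_min w j >])%N = k].

Definition head_of (c : config Q Γ) : option (Q * Γ) :=
  if c is (q, Y :: _) then Some (q, Y) else None.

Definition heads_between w (i j : nat) : seq (Q * Γ) :=
  pmap (fun l => head_of (conf w l)) (iota i.+1 (j - i)).

Definition obs w (k : nat) : A :=
  foldl (obs_step 𝒜) (obs_init 𝒜)
    (heads_between w (min_pos w k) (min_pos w k.+1)).

Definition inf_obs w : {set A} :=
  [set a | `[< forall N, exists2 k, (N <= k)%N & obs w k = a >]]%SET.

Definition accepting : set (run Δ s) :=
  [set w | infinite_run w /\ inf_obs w \in obs_acc 𝒜].

End Acceptance.

Arguments accepting {R Q Γ} Δ {A} 𝒜 s.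

(** * Effective presentation of the input *)

(* Transition probabilities are real numbers; as data for an algorithm they
   are given by formulas expressing them, [pf r] for the rule r. Rational
   probabilities are a special case. *)
Definition presents (R : realType) (Q Γ : finType) (Δ : ppda R Q Γ)
    (pf : rule Q Γ -> fo) : Prop :=
  forall r, r \in rules Δ -> expresses (pf r) (prob Δ r).

Section EncodeInput.
Variables (R : realType) (Q Γ : finType).

Definition enc_head (h : Q * Γ) : tree := Node (enc_fin h.1) (enc_fin h.2).

Definition enc_rule (r : rule Q Γ) : tree :=
  Node (enc_head r.1) (Node (enc_fin r.2.1) (enc_seq (@enc_fin Γ) r.2.2)).

Definition enc_ppda (Δ : ppda R Q Γ) (pf : rule Q Γ -> fo) : tree :=
  Node (enc_nat #|Q|) (Node (enc_nat #|Γ|)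
    (enc_seq (fun r => Node (enc_rule r) (enc_fo (pf r)))
       (enum_fset (rules Δ)))).

(* The transition function is given by its table. *)
Definition enc_observer (A : finType) (𝒜 : observer Q Γ A) : tree :=
  Node (enc_nat #|A|)
 (Node (enc_seq
          (fun ah : A * (Q * Γ) =>
             Node (Node (enc_fin ah.1) (enc_head ah.2))
                  (enc_fin (obs_step 𝒜 ah.1 ah.2)))
          (enum {: A * (Q * Γ)}))
 (Node (enc_fin (obs_init 𝒜))
       (enc_seq (fun B : {set A} => enc_seq (@enc_fin A) (enum B))
          (enum (obs_acc 𝒜))))).

Definition enc_input (Δ : ppda R Q Γ) (pf : rule Q Γ -> fo)
    (A : finType) (𝒜 : observer Q Γ A) (h : Q * Γ) : tree :=
  Node (enc_ppda Δ pf) (Node (enc_observer 𝒜) (enc_head h)).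

End EncodeInput.

(* Main.v *)
(** Run the pPDA in product with the observer. The probabilities E(s, Y, t) of
    popping Y from state s into state t form the least nonnegative solution of
    a polynomial system. Between two consecutive minima a run makes one step
    and pops some of the symbols just pushed; hence, for functions f of a head,
    there is an operator T_C, polynomial in E, that sums f over the possible next
    minima after qY whose observation lies in C, weighted by the probability of
    the path leading there. It is not normalised by the probability of never
    popping Y, so no division occurs. Let v(qY) be the probability that Y is
    never popped. Then T_C^n v decreases to the probability g_C that the run is
    infinite, never pops Y and has all its observations in C; g_C is the
    greatest g <= v with g <= T_C g. For T the operator without restriction on
    observations, T^n g_C increases to the probability h_C that all but finitely
    many observations lie in C; h_C is the least h >= g_C with T h <= h. Both characterisations are first-order, and
    they make any study of recurrent states superfluous. The probability that
    a given set is the set of observations made infinitely often is an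
    alternating sum of values h_C. The formula is written by nested folds over
    the lists in the input, and folds are computable by while programs. *)

Require Import Defs.
From mathcomp Require Import all_boot all_order all_algebra.
From mathcomp Require Import finmap.
From mathcomp Require Import all_classical all_reals all_analysis.
From mathcomp Require Import ring zify.

Set Implicit Arguments.
Unset Strict Implicit.
Unset Printing Implicit Defensive.

Import Order.TTheory GRing.Theory Num.Theory numFieldNormedType.Exports.

(** * While programs on trees *)

(** Whether a position is a minimum depends on the whole future of the run, so no event about minima
    is decided by a finite prefix. Probabilities are therefore computed first for n steps, by
    induction from cylinders, and then n tends to infinity. One truncated recursion,
    [popped_within], serves both the popping probabilities and the search for the next minimum.

    The observer restarts from its initial state after every minimum, so g_C and h_C are functions
    of a head alone.

    The value v also counts runs that get stuck above Y. They vanish in the limit of T_C^n v, since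
    every further observation takes at least one more step; that the run is infinite thus needs no
    separate condition.

    The condition h >= g_C is stated as: h lies above every g that competes for the greatest
    solution. So g_C is never named in the formula. The set C enters only through the values of
    variables, and one subformula for h_C serves all C. *)

Definition tfst (t : tree) : tree := if t is Node x _ then x else Leaf.
Definition tsnd (t : tree) : tree := if t is Node _ y then y else Leaf.
Definition tif (c x y : tree) : tree := if c is Node _ _ then x else y.

(** A tree is read as the list along its right spine. Numbers are lists of leaves, so the same fold
    is also iteration, and it is the only recursion in the builders of the formula. *)
Fixpoint tfoldr (f : tree -> tree -> tree) (z t : tree) : tree :=
  if t is Node x t' then f x (tfoldr f z t') else z.

(** Total on all trees, also on those that encode nothing, so that composition carries no side
    condition. *)
Definition computable (f : tree -> tree) : Prop :=
  exists M, forall x, computes M x (f x).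

Lemma cpt_id : computable id.
Proof. by exists PId => x; constructor. Qed.

Lemma cpt_comp f g : computable g -> computable f -> computable (fun x => g (f x)).
Proof.
move=> [N hN] [M hM]; exists (PComp N M) => x.
exact: run_comp (hM x) (hN _).
Qed.

Lemma cpt_leaf : computable (fun=> Leaf).
Proof. by exists PNil => x; constructor. Qed.

Lemma cpt_node f g :
  computable f -> computable g -> computable (fun x => Node (f x) (g x)).
Proof. by move=> [M hM] [N hN]; exists (PPair M N) => x; constructor. Qed.

Lemma cpt_fst f : computable f -> computable (fun x => tfst (f x)).
Proof.
by apply: cpt_comp; exists PFst => -[|x y]; constructor.
Qed.

Lemma cpt_snd f : computable f -> computable (fun x => tsnd (f x)).
Proof.
by apply: cpt_comp; exists PSnd => -[|x y]; constructor.
Qed.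

Lemma cpt_if c f g : computable c -> computable f -> computable g ->
  computable (fun x => tif (c x) (f x) (g x)).
Proof.
move=> [K hK] [M hM] [N hN]; exists (PIf K M N) => x.
case ec : (c x) => [|u v] /=.
  by apply: run_if_false (hN x); move: (hK x); rewrite ec.
by move: (hK x); rewrite ec => h; exact: run_if_true h (hM x).
Qed.

Lemma cpt_const k : computable (fun=> k).
Proof. by elim: k => [|x hx y hy]; [exact: cpt_leaf | exact: cpt_node]. Qed.

Fixpoint tfoldl (f : tree -> tree -> tree) (z t : tree) : tree :=
  if t is Node x t' then tfoldl f (f x z) t' else z.

(** A loop meets the head of a list first and so computes left folds; a right fold is a left fold
    over the reversed list. *)
Lemma tfoldr_rev f z t :
  tfoldr f z t = tfoldl f z (tfoldl Node Leaf t).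
Proof.
suff H s : tfoldl f z (tfoldl Node s t) = tfoldl f (tfoldr f z t) s by rewrite H.
by elim: t s => [|x _ t IH] s //=; rewrite IH.
Qed.

(* The loop state is [Node l (Node acc x)], with l the part of the list still to be read. *)
Lemma cpt_foldl F z l :
  computable (fun t => F (tfst t) (tfst (tsnd t)) (tsnd (tsnd t))) ->
  computable z -> computable l ->
  computable (fun x => tfoldl (F x) (z x) (l x)).
Proof.
move=> hF hz hl.
have [B hB] : computable (fun s => Node (tsnd (tfst s))
    (Node (F (tsnd (tsnd s)) (tfst (tfst s)) (tfst (tsnd s))) (tsnd (tsnd s)))).
  have h := cpt_comp hF (cpt_node (cpt_snd (cpt_snd cpt_id))
    (cpt_node (cpt_fst (cpt_fst cpt_id)) (cpt_fst (cpt_snd cpt_id)))).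
  apply: cpt_node; first exact: cpt_snd (cpt_fst cpt_id).
  by apply: cpt_node; [exact: h | exact: cpt_snd (cpt_snd cpt_id)].
have [L hL] : computable (fun s => tfst (tsnd s)) by exact: cpt_fst (cpt_snd cpt_id).
have [I hI] := cpt_node hl (cpt_node hz cpt_id).
exists (PComp L (PComp (PWhile PFst B) I)) => x.
apply: (@run_comp _ _ _ (Node Leaf (Node (tfoldl (F x) (z x) (l x)) x))); last exact: hL.
apply: run_comp (hI x) _.
elim: (l x) (z x) => [|y _ t IH] acc /=.
  by apply: run_while_stop; constructor.
by apply: run_while_step; [constructor | exact: hB | exact: IH].
Qed.

(** The input [x] reaches the body as the first component of its argument, so the body may itself
    fold over parts of the input. This gives nested folds. *)
Lemma cpt_foldr F z l :
  computable (fun t => F (tfst t) (tfst (tsnd t)) (tsnd (tsnd t))) ->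
  computable z -> computable l ->
  computable (fun x => tfoldr (F x) (z x) (l x)).
Proof.
move=> hF hz hl.
rewrite (_ : (fun _ => _) = fun x => tfoldl (F x) (z x) (tfoldl Node Leaf (l x))).
  by apply: cpt_foldl => //; apply: (@cpt_foldl (fun=> Node)) cpt_leaf hl;
     apply: cpt_node; [exact: cpt_fst (cpt_snd cpt_id) | exact: cpt_snd (cpt_snd cpt_id)].
by apply/funext => x; exact: tfoldr_rev.
Qed.

Local Open Scope classical_set_scope.
Local Open Scope ring_scope.

(** * Limits of real sequences *)

Section Sequences.
Variable R : realType.
Implicit Types (u v : nat -> R) (l : R).

Lemma cvg_sumr (I : Type) (r : seq I) (P : pred I) (F : I -> nat -> R) (f : I -> R) :
  (forall i, P i -> F i n @[n --> \oo] --> f i) ->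
  \sum_(i <- r | P i) F i n @[n --> \oo] --> \sum_(i <- r | P i) f i.
Proof. by move=> h; apply: cvg_big => //; exact: add_continuous. Qed.

Lemma cvg_le u v l l' : (forall n, u n <= v n) ->
  u n @[n --> \oo] --> l -> v n @[n --> \oo] --> l' -> l <= l'.
Proof. by move=> h hu hv; apply: ler_cvg_to hu hv _; exact: nearW. Qed.

Lemma cvg_cst_le v l l' : (forall n, l <= v n) -> v n @[n --> \oo] --> l' -> l <= l'.
Proof. by move=> h; apply: cvg_le h _; exact: cvg_cst. Qed.

Lemma cvg_le_cst u l l' : (forall n, u n <= l') -> u n @[n --> \oo] --> l -> l <= l'.
Proof. by move=> h hu; apply: cvg_le h hu _; exact: cvg_cst. Qed.

Lemma nondecreasing_cvg_le u l n :
  {homo u : m n / (m <= n)%N >-> m <= n} -> u n @[n --> \oo] --> l -> u n <= l.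
Proof.
move=> hu ul; rewrite -(cvg_lim _ ul)//; apply: nondecreasing_cvgn_le => //.
by apply/cvg_ex; exists l.
Qed.

Lemma nonincreasing_cvg_ge u l n :
  {homo u : m n / (m <= n)%N >-> n <= m} -> u n @[n --> \oo] --> l -> l <= u n.
Proof.
move=> hu ul; rewrite -(cvg_lim _ ul)//; apply: nonincreasing_cvgn_ge => //.
by apply/cvg_ex; exists l.
Qed.

Lemma nondecreasing_bounded_cvg u M :
  {homo u : m n / (m <= n)%N >-> m <= n} -> (forall n, u n <= M) ->
  u n @[n --> \oo] --> limn u.
Proof.
by move=> hu hM; apply: nondecreasing_is_cvgn => //; exists M => _ [n _ <-].
Qed.

Lemma nonincreasing_bounded_cvg u M :
  {homo u : m n / (m <= n)%N >-> n <= m} -> (forall n, M <= u n) ->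
  u n @[n --> \oo] --> limn u.
Proof.
by move=> hu hM; apply: nonincreasing_is_cvgn => //; exists M => _ [n _ <-].
Qed.

(** Joining two truncated phases costs additional steps, so lower bounds on [u] are available only
    at a later index [phi n]. *)
Lemma nondecreasing_squeeze u v (phi : nat -> nat) l :
  {homo u : m n / (m <= n)%N >-> m <= n} -> (forall n, u n <= l) ->
  (forall n, v n <= u (phi n)) -> v n @[n --> \oo] --> l ->
  u n @[n --> \oo] --> l.
Proof.
move=> hu ul vu vl; have := nondecreasing_bounded_cvg hu ul.
move: (limn u) => l' ul'; suff -> : l = l' by [].
apply/eqP; rewrite eq_le (cvg_le_cst ul ul') andbT.
apply: cvg_le_cst vl => n; apply: le_trans (vu n) _.
exact: nondecreasing_cvg_le.
Qed.

End Sequences.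

(** * Popping probabilities *)

Section Pushdown.
Variables (R : realType) (Q Γ : finType) (Δ : ppda R Q Γ).
Variables (A : finType) (𝒜 : observer Q Γ A).

(* The observer runs in parallel with the control, and reads the head of a
   configuration when the run leaves that configuration. *)
Local Notation S := (Q * A)%type.
Implicit Types (s t : S) (Y : Γ) (α β γ : seq Γ) (k n m : nat).
Implicit Types (base : S -> Γ -> R) (term : S -> R) (x : S -> Γ -> S -> R).

Definition obs_next s Y : A := obs_step 𝒜 s.2 (s.1, Y).

Definition rule_sum s Y (F : S -> seq Γ -> R) : R :=
  \sum_(r <- enum_fset (rules Δ) | r.1 == (s.1, Y))
     prob Δ r * F (r.2.1, obs_next s Y) r.2.2.

Lemma rule_prob_ge0 r : r \in enum_fset (rules Δ) -> 0 <= prob Δ r.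
Proof. by move/(prob_bounds (p := Δ)) => /andP[/ltW]. Qed.

Lemma rule_sum_ge0 s Y F : (forall t γ, 0 <= F t γ) -> 0 <= rule_sum s Y F.
Proof.
move=> F0; rewrite /rule_sum big_seq_cond; apply: sumr_ge0 => r /andP[hr _].
by rewrite mulr_ge0// rule_prob_ge0.
Qed.

Lemma le_rule_sum s Y F G :
  (forall t γ, F t γ <= G t γ) -> rule_sum s Y F <= rule_sum s Y G.
Proof.
move=> FG; rewrite /rule_sum big_seq_cond [leRHS]big_seq_cond.
apply: ler_sum => r /andP[hr _].
by rewrite ler_wpM2l// rule_prob_ge0.
Qed.

Lemma eq_rule_sum s Y F G :
  (forall t γ, F t γ = G t γ) -> rule_sum s Y F = rule_sum s Y G.
Proof. by move=> FG; apply: eq_bigr => r _; rewrite FG. Qed.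

Lemma rule_sum_sum s Y (I : Type) (r : seq I) (P : pred I)
    (F : I -> S -> seq Γ -> R) :
  rule_sum s Y (fun t γ => \sum_(i <- r | P i) F i t γ) =
  \sum_(i <- r | P i) rule_sum s Y (F i).
Proof.
rewrite /rule_sum exchange_big /=; apply: eq_bigr => r0 _.
by rewrite mulr_sumr.
Qed.

Lemma rule_sumMr s Y F c :
  rule_sum s Y (fun t γ => F t γ * c) = rule_sum s Y F * c.
Proof. by rewrite /rule_sum mulr_suml; apply: eq_bigr => r _; rewrite mulrA. Qed.

Lemma rule_sumB s Y F G :
  rule_sum s Y (fun t γ => F t γ - G t γ) = rule_sum s Y F - rule_sum s Y G.
Proof. by rewrite /rule_sum -sumrB; apply: eq_bigr => r _; rewrite mulrBr. Qed.

Lemma rule_sum1_le1 s Y : rule_sum s Y (fun _ _ => 1) <= 1.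
Proof.
rewrite /rule_sum (eq_bigr (prob Δ)) => [|r _]; last by rewrite mulr1.
by case: (prob_sum Δ (s.1, Y)) => /= ->.
Qed.

Lemma cvg_rule_sum s Y (F : nat -> S -> seq Γ -> R) G :
  (forall t γ, F n t γ @[n --> \oo] --> G t γ) ->
  rule_sum s Y (F n) @[n --> \oo] --> rule_sum s Y G.
Proof.
move=> FG.
apply: (@cvg_sumr R _ _ _ (fun r n => prob Δ r * F n (r.2.1, obs_next s Y) r.2.2)) => r _.
by apply: cvgMr; exact: FG.
Qed.

(* Weight collected while the word α is popped symbol by symbol: [base t Y] for
   each symbol Y of α that is uncovered in state t, [term t] once α is gone;
   [x t Y t'] stands for the probability of popping Y from t to t'. *)
Fixpoint popped x base term α s : R :=
  if α is Y :: β then base s Y + \sum_t x s Y t * popped x base term β t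
  else term s.

(* The part of [popped] due to the first n steps. Only those symbols count
   that are uncovered with less than k symbols below, and the symbols
   strictly below the lowest stack seen so far. *)
Fixpoint popped_within base term n α k s : R :=
  match n, α with
  | _, [::] => term s
  | 0, _ :: _ => 0
  | n'.+1, Y :: β => (if (size β < k)%N then base s Y else 0) +
      rule_sum s Y (fun t γ =>
        popped_within base term n' (γ ++ β) (minn k (size β)) t)
  end.

Definition delta t s : R := (s == t)%:R.
Definition zero_base s Y : R := 0.
Definition zero_term s : R := 0.

Definition pop_within n α s t : R := popped_within zero_base (delta t) n α 0 s.

Lemma popped_within_ge0 base term n α k s :
  (forall s Y, 0 <= base s Y) -> (forall s, 0 <= term s) ->
  0 <= popped_within base term n α k s.
Proof.
move=> b0 t0; elim: n α k s => [|n IH] [|Y β] k s //=.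
by rewrite addr_ge0//; [case: ifP | apply: rule_sum_ge0].
Qed.

Lemma popped_within_mono base term α k s :
  (forall s Y, 0 <= base s Y) -> (forall s, 0 <= term s) ->
  {homo (fun n => popped_within base term n α k s) : m n / (m <= n)%N >-> m <= n}.
Proof.
move=> b0 t0; apply/nondecreasing_seqP => n.
elim: n α k s => [|n IH] [|Y β] k s //=.
  rewrite addr_ge0//; first by case: ifP.
  by apply: rule_sum_ge0 => t γ; exact: (popped_within_ge0 0).
by rewrite lerD2l; apply: le_rule_sum => t γ; exact: IH.
Qed.

(** The threshold only selects which values of [base] count. Hence [pop_within], stated with
    threshold 0, falls under the results for threshold [size α]. *)
Lemma popped_within_zero_base term n α k s :
  popped_within zero_base term n α k s = popped_within zero_base term n α 0 s.
Proof.
elim: n α k s => [|n IH] [|Y β] k s //=.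
congr (_ + _); first by do 2?case: ifP.
by apply: eq_rule_sum => t γ; rewrite IH [RHS]IH.
Qed.

Lemma delta_ge0 t s : 0 <= delta t s. Proof. exact: ler0n. Qed.

Lemma pop_within_ge0 n α s t : 0 <= pop_within n α s t.
Proof. by apply: popped_within_ge0 => // *; exact: delta_ge0. Qed.

Lemma sum_delta (F : S -> R) s : \sum_t delta t s * F t = F s.
Proof.
rewrite (bigD1 s)//= /delta eqxx mul1r big1 ?addr0// => t ts.
by rewrite eq_sym (negbTE ts) mul0r.
Qed.

Lemma pop_within_nil n s t : pop_within n [::] s t = delta t s.
Proof. by case: n. Qed.

Lemma pop_within_cons n Y β s t : pop_within n.+1 (Y :: β) s t =
  rule_sum s Y (fun s' γ => pop_within n (γ ++ β) s' t).
Proof. by rewrite /pop_within /= add0r min0n. Qed.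

(** * Splitting a pop when the lower part of the stack is uncovered *)

Section Convolution.
Variables (base : S -> Γ -> R) (term : S -> R).
Hypotheses (base0 : forall s Y, 0 <= base s Y) (term0 : forall s, 0 <= term s).

Lemma popped_within_cons_low n Y α k s : (k <= size α)%N ->
  popped_within base term n.+1 (Y :: α) k s =
  rule_sum s Y (fun t γ => popped_within base term n (γ ++ α) k t).
Proof. by move=> h /=; rewrite ltnNge h add0r (minn_idPl h). Qed.

(** With threshold [size β] no symbol of [α] is counted. The two phases share n steps on the left
    and have n steps each on the right. *)
Lemma popped_within_cat_le n α β s :
  popped_within base term n (α ++ β) (size β) s <=
  \sum_t pop_within n α s t * popped_within base term n β (size β) t.
Proof.
elim: n α s => [|n IH] [|Y α] s; try by rewrite (eq_bigr _ (fun t _ =>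
    congr1 ( *%R^~ _) (pop_within_nil _ _ _))) sum_delta.
  by apply: sumr_ge0 => t _; rewrite mulr_ge0 ?pop_within_ge0 ?popped_within_ge0.
rewrite cat_cons popped_within_cons_low ?size_cat ?leq_addl//.
under eq_bigr do rewrite pop_within_cons -rule_sumMr.
rewrite -rule_sum_sum; apply: le_rule_sum => t γ.
(* The step just made leaves n steps for both phases; the bound on the second phase is relaxed back
   to n + 1. *)
rewrite catA; apply: le_trans (IH _ _) _; apply: ler_sum => t' _.
by rewrite ler_wpM2l ?pop_within_ge0//; apply: popped_within_mono.
Qed.

Lemma popped_within_cat_ge n m α β s :
  \sum_t pop_within n α s t * popped_within base term m β (size β) t <=
  popped_within base term (n + m) (α ++ β) (size β) s.
Proof.
elim: n α s => [|n IH] [|Y α] s; try rewrite (eq_bigr _ (fun t _ =>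
    congr1 ( *%R^~ _) (pop_within_nil _ _ _))) sum_delta.
- by [].
- rewrite big1 ?popped_within_ge0// => t _; by rewrite [X in X * _](_ : _ = 0) ?mul0r.
- by apply: popped_within_mono => //; exact: leq_addl.
rewrite cat_cons addSn popped_within_cons_low ?size_cat ?leq_addl//.
under eq_bigr do rewrite pop_within_cons -rule_sumMr.
by rewrite -rule_sum_sum; apply: le_rule_sum => t γ; rewrite catA.
Qed.

End Convolution.

End Pushdown.

(** * Limits of the truncated popping weights *)

Section PopProbabilities.
Variables (R : realType) (Q Γ : finType) (Δ : ppda R Q Γ).
Variables (A : finType) (𝒜 : observer Q Γ A).
Local Notation S := (Q * A)%type.
Implicit Types (s t : S) (Y : Γ) (α β γ : seq Γ) (k n m : nat).
Implicit Types (base : S -> Γ -> R) (term : S -> R) (x : S -> Γ -> S -> R).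

Local Notation popped_within := (popped_within Δ 𝒜).
Local Notation pop_within := (pop_within Δ 𝒜).
Local Notation rule_sum := (rule_sum Δ 𝒜).
Local Notation zero_base := (@zero_base R Q Γ A).
Local Notation zero_term := (@zero_term R Q A).
Local Notation delta := (@delta R Q A).

Lemma zero_base_ge0 s Y : 0 <= zero_base s Y. Proof. exact: lexx. Qed.

Lemma sum_pop_within n α s :
  \sum_t pop_within n α s t = popped_within zero_base (fun=> 1) n α 0 s.
Proof.
elim: n α s => [|n IH] [|Y α] s; last first.
- under eq_bigr do rewrite pop_within_cons.
  rewrite -rule_sum_sum /= add0r min0n.
  by apply: eq_rule_sum => t γ; exact: IH.
- under eq_bigr do rewrite pop_within_nil -[delta _ _]mulr1.
  by rewrite (sum_delta (fun=> 1)).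
- by rewrite big1.
- under eq_bigr do rewrite pop_within_nil -[delta _ _]mulr1.
  by rewrite (sum_delta (fun=> 1)).
Qed.

Lemma popped_within1_le1 n α k s : popped_within zero_base (fun=> 1) n α k s <= 1.
Proof.
elim: n α k s => [|n IH] [|Y α] k s //=.
rewrite (_ : (if _ then _ else _) = 0) ?add0r; last by case: ifP.
by apply: le_trans (rule_sum1_le1 Δ 𝒜 s Y); apply: le_rule_sum => t γ; exact: IH.
Qed.

(** The observer never influences the moves, so the popping probability summed over all final states
    depends on [q] alone. *)
Lemma popped_within1_obs n α q (a b : A) :
  popped_within zero_base (fun=> 1) n α 0 (q, a) =
  popped_within zero_base (fun=> 1) n α 0 (q, b).
Proof.
elim: n α q a b => [|n IH] [|Y α] q a b //=.
rewrite min0n; congr (_ + _).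
by rewrite /rule_sum; apply: eq_bigr => r _; congr (_ * _); exact: IH.
Qed.

Definition pop_prob s Y t : R := limn (fun n => pop_within n [:: Y] s t).

Lemma pop_within_le1 n α s t : pop_within n α s t <= 1.
Proof.
apply: le_trans (popped_within1_le1 n α 0 s); rewrite -sum_pop_within (bigD1 t)//=.
by rewrite lerDl sumr_ge0// => *; exact: pop_within_ge0.
Qed.

Lemma pop_within_mono α s t :
  {homo (fun n => pop_within n α s t) : m n / (m <= n)%N >-> m <= n}.
Proof. by apply: popped_within_mono => *; rewrite ?zero_base_ge0 ?delta_ge0. Qed.

Lemma pop_prob_cvg s Y t : pop_within n [:: Y] s t @[n --> \oo] --> pop_prob s Y t.
Proof.
apply: (@nondecreasing_bounded_cvg _ _ 1) => [|n]; first exact: pop_within_mono.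
exact: pop_within_le1.
Qed.

Lemma pop_within_le_prob n s Y t : pop_within n [:: Y] s t <= pop_prob s Y t.
Proof.
by apply: (nondecreasing_cvg_le n (@pop_within_mono [:: Y] s t)); exact: pop_prob_cvg.
Qed.

Lemma pop_prob_ge0 s Y t : 0 <= pop_prob s Y t.
Proof. exact: le_trans (pop_within_ge0 _ _ 0 _ _ _) (pop_within_le_prob _ _ _ _). Qed.

Section Limit.
Variables (base : S -> Γ -> R) (term : S -> R).
Hypotheses (base0 : forall s Y, 0 <= base s Y) (term0 : forall s, 0 <= term s).

(** The extra unit of threshold admits only the top symbol, which is counted at once; after one step
    the threshold is cut to [size α] in any case. *)
Lemma popped_within_top n Y α s : popped_within base term n.+1 (Y :: α) (size α).+1 s =
  base s Y + popped_within base term n.+1 (Y :: α) (size α) s.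
Proof. by rewrite /= ltnSn ltnn add0r (minn_idPr (leqnSn _)) minnn. Qed.

Lemma popped_ge0 α s : 0 <= popped pop_prob base term α s.
Proof.
elim: α s => [|Y α IH] s //=; rewrite addr_ge0// sumr_ge0// => t _.
by rewrite mulr_ge0// pop_prob_ge0.
Qed.

Lemma popped_within_le n α s :
  popped_within base term n α (size α) s <= popped pop_prob base term α s.
Proof.
elim: α n s => [|Y α IH] n s; first by case: n.
apply: le_trans (popped_within_mono Δ 𝒜 _ _ _ base0 term0 (leqnSn n)) _.
rewrite popped_within_top /= lerD2l.
apply: le_trans (popped_within_cat_le Δ 𝒜 base0 term0 n.+1 [:: Y] α s) _.
apply: ler_sum => t _; apply: ler_pM => //; first exact: pop_within_ge0.
  exact: popped_within_ge0.
exact: pop_within_le_prob.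
Qed.

Lemma popped_within_cvg α s :
  popped_within base term n α (size α) s @[n --> \oo] --> popped pop_prob base term α s.
Proof.
elim: α s => [|Y α IH] s.
  by rewrite [X in X @ _](_ : _ = fun=> term s); [exact: cvg_cst|apply/funext => -[]].
pose v n := base s Y + \sum_t pop_within n [:: Y] s t * popped_within base term n α (size α) t.
(* Take n steps to pop [Y], n steps for the rest, and one more because [popped_within_top] speaks of
   a positive number of steps. *)
apply: (@nondecreasing_squeeze _ _ v (fun n => (n + n).+1)) => [|n|n|].
- exact: popped_within_mono.
- exact: popped_within_le.
- rewrite popped_within_top lerD2l.
  apply: le_trans (popped_within_cat_ge Δ 𝒜 base0 term0 n n [:: Y] α s) _.
  exact: popped_within_mono.
- apply: cvgD; first exact: cvg_cst.
  apply: (@cvg_sumr R _ _ _ (fun t n =>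
    pop_within n [:: Y] s t * popped_within base term n α (size α) t)) => t _.
  by apply: cvgM; [exact: pop_prob_cvg | exact: IH].
Qed.

End Limit.

Lemma pop_within_cvg α s t :
  pop_within n α s t @[n --> \oo] --> popped pop_prob zero_base (delta t) α s.
Proof.
rewrite (_ : (fun n => _) = fun n => popped_within zero_base (delta t) n α (size α) s).
  by apply: popped_within_cvg => *; rewrite ?zero_base_ge0 ?delta_ge0.
by apply/funext => n; rewrite [RHS]popped_within_zero_base.
Qed.

Lemma pop_prob_fix s Y t :
  pop_prob s Y t = rule_sum s Y (fun s' γ => popped pop_prob zero_base (delta t) γ s').
Proof.
have h : rule_sum s Y (fun s' γ => pop_within n γ s' t) @[n --> \oo] -->
    rule_sum s Y (fun s' γ => popped pop_prob zero_base (delta t) γ s').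
  apply: (@cvg_rule_sum _ _ _ Δ _ 𝒜 s Y (fun n s' γ => pop_within n γ s' t)) => s' γ.
  exact: pop_within_cvg.
rewrite -(cvg_lim _ h)//; apply/esym/cvg_lim => //.
have := @pop_prob_cvg s Y t; rewrite -cvg_shiftS.
rewrite (_ : [sequence _]_n = fun n => rule_sum s Y (fun s' γ => pop_within n γ s' t)) //.
apply/funext => n /=; rewrite pop_within_cons; apply: eq_rule_sum => s' γ.
by rewrite cats0.
Qed.

Lemma popped_cat x base term α β s :
  popped x base term (α ++ β) s =
  popped x base (popped x base term β) α s.
Proof. by elim: α s => [|Y α IH] s //=; under eq_bigr do rewrite IH. Qed.

Lemma popped_term_sum x (I : Type) (r : seq I) (P : pred I) (F : I -> S -> R)
    (c : I -> R) α s :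
  popped x zero_base (fun t => \sum_(i <- r | P i) c i * F i t) α s =
  \sum_(i <- r | P i) c i * popped x zero_base (F i) α s.
Proof.
elim: α s => [|Y α IH] s //=.
under [RHS]eq_bigr do rewrite add0r mulr_sumr.
rewrite add0r exchange_big /=; apply: eq_bigr => t _.
by rewrite IH mulr_sumr; apply: eq_bigr => i _; rewrite mulrCA.
Qed.

Lemma popped_delta x term α s :
  popped x zero_base term α s =
  \sum_t popped x zero_base (delta t) α s * term t.
Proof.
under [RHS]eq_bigr do rewrite mulrC.
rewrite -popped_term_sum; congr popped; apply/funext => t.
rewrite -[LHS](sum_delta term t); apply: eq_bigr => t' _; exact: mulrC.
Qed.

Lemma popped_x_ge0 x base term α s :
  (forall s Y t, 0 <= x s Y t) -> (forall s Y, 0 <= base s Y) ->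
  (forall s, 0 <= term s) -> 0 <= popped x base term α s.
Proof.
move=> x0 b0 t0; elim: α s => [|Y α IH] s //=; rewrite addr_ge0// sumr_ge0// => t _.
by rewrite mulr_ge0.
Qed.

(** Fixed-point induction on the number of steps. A rule replaces a symbol by a word, so the bound
    is proved for all words at once, and [popped_cat] with [popped_delta] composes it. *)
Lemma pop_within_le_popped x n α s t :
  (forall s Y t, 0 <= x s Y t) ->
  (forall s Y t, rule_sum s Y (fun s' γ => popped x zero_base (delta t) γ s') <= x s Y t) ->
  pop_within n α s t <= popped x zero_base (delta t) α s.
Proof.
move=> x0 hx; elim: n α s => [|n IH] [|Y α] s //.
  by apply: popped_x_ge0 => // *; rewrite ?delta_ge0.
rewrite pop_within_cons.
have -> : popped x zero_base (delta t) (Y :: α) s =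
  \sum_s' x s Y s' * popped x zero_base (delta t) α s' by rewrite /= add0r.
apply: (@le_trans _ _ (\sum_s' rule_sum s Y (fun t' γ => popped x zero_base (delta s') γ t')
    * popped x zero_base (delta t) α s')); last first.
  apply: ler_sum => s' _; apply: ler_wpM2r => //.
  by apply: popped_x_ge0 => // *; rewrite ?delta_ge0.
under [leRHS]eq_bigr do rewrite -rule_sumMr.
rewrite -rule_sum_sum; apply: le_rule_sum => t' γ.
by apply: le_trans (IH _ _) _; rewrite popped_cat popped_delta.
Qed.

Lemma pop_prob_least x s Y t :
  (forall s Y t, 0 <= x s Y t) ->
  (forall s Y t, rule_sum s Y (fun s' γ => popped x zero_base (delta t) γ s') <= x s Y t) ->
  pop_prob s Y t <= x s Y t.
Proof.
move=> x0 hx; have := @pop_prob_cvg s Y t; apply: cvg_le_cst => n.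
apply: le_trans (pop_within_le_popped n [:: Y] s t x0 hx) _ => /=.
rewrite add0r.
rewrite (_ : \sum_(_ | _) _ = x s Y t)// -[RHS](sum_delta (fun t => x s Y t)).
by apply: eq_bigr => t' _; rewrite mulrC /delta eq_sym.
Qed.

End PopProbabilities.

(** * The chain of minima *)

Section MinimaOperator.
Variables (R : realType) (Q Γ : finType) (Δ : ppda R Q Γ).
Variables (A : finType) (𝒜 : observer Q Γ A).
Local Notation S := (Q * A)%type.
Implicit Types (q : Q) (s t : S) (Y : Γ) (α β γ : seq Γ) (n : nat).
Implicit Types (f g h : Q -> Γ -> R) (m : A -> R).

Local Notation rule_sum := (rule_sum Δ 𝒜).
Local Notation zero_base := (@zero_base R Q Γ A).
Local Notation zero_term := (@zero_term R Q A).
Local Notation pop_prob := (pop_prob Δ 𝒜).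
Local Notation pop_all := (popped pop_prob zero_base (fun=> 1)).

Lemma pop_all_obs α q (a b : A) : pop_all α (q, a) = pop_all α (q, b).
Proof.
have h c : popped_within Δ 𝒜 zero_base (fun=> 1) n α 0 (q, c) @[n --> \oo] --> pop_all α (q, c).
  rewrite (_ : (fun n => _) = fun n =>
    popped_within Δ 𝒜 zero_base (fun=> 1) n α (size α) (q, c)).
    by apply: popped_within_cvg => *; rewrite ?zero_base_ge0.
  by apply/funext => n; rewrite [RHS]popped_within_zero_base.
rewrite -(cvg_lim _ (h a))// -(cvg_lim _ (h b))//; congr (limn _); apply/funext => n.
exact: popped_within1_obs.
Qed.

Lemma pop_all1 Y s : pop_all [:: Y] s = \sum_t pop_prob s Y t.
Proof. by rewrite /= add0r; apply: eq_bigr => t _; rewrite mulr1. Qed.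

Lemma pop_all1_fix Y s : pop_all [:: Y] s = rule_sum s Y (fun t γ => pop_all γ t).
Proof.
rewrite pop_all1 (eq_bigr _ (fun t _ => pop_prob_fix Δ 𝒜 s Y t)) -rule_sum_sum.
apply: eq_rule_sum => t γ; rewrite [RHS]popped_delta.
by apply: eq_bigr => t' _; rewrite mulr1.
Qed.

(** Runs that end with [Y] still on the stack count as never popping it. By [never_popE] any other
    observer state would give the same value as [obs_init]. *)
Definition never_pop q Y : R := 1 - \sum_t pop_prob (q, obs_init 𝒜) Y t.

Lemma never_popE Y s : never_pop s.1 Y = 1 - \sum_t pop_prob s Y t.
Proof.
by case: s => q a; rewrite /never_pop -!pop_all1 (pop_all_obs _ _ _ a).
Qed.

Lemma sum_pop_prob_le1 s Y : \sum_t pop_prob s Y t <= 1.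
Proof.
have h : \sum_t pop_within Δ 𝒜 n [:: Y] s t @[n --> \oo] --> \sum_t pop_prob s Y t.
  apply: (@cvg_sumr R _ _ _ (fun t n => pop_within Δ 𝒜 n [:: Y] s t)) => t _.
  exact: pop_prob_cvg.
by apply: cvg_le_cst h => n; rewrite sum_pop_within popped_within1_le1.
Qed.

Lemma never_pop_ge0 q Y : 0 <= never_pop q Y.
Proof. by rewrite subr_ge0 sum_pop_prob_le1. Qed.

(** The observation includes the head of the new minimum, hence [obs_next]; it excludes the head of
    the old one, hence [next_min] starts from [obs_init] after the rule. *)
Definition min_base f m s Y : R := f s.1 Y * m (obs_next 𝒜 s Y).

(* One step of the chain of minima, not normalised: from qY, the next minimum
   contributes the value of f at its head, weighted by m at the observation. *)
Definition next_min f m q Y : R :=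
  \sum_(r <- enum_fset (rules Δ) | r.1 == (q, Y))
     prob Δ r * popped pop_prob (min_base f m) zero_term r.2.2 (r.2.1, obs_init 𝒜).

Lemma le_popped_min f g m m' α s :
  (forall q Y a, f q Y * m a <= g q Y * m' a) ->
  popped pop_prob (min_base f m) zero_term α s <=
  popped pop_prob (min_base g m') zero_term α s.
Proof.
move=> fg; elim: α s => [|Y α IH] s //=; apply: lerD; first exact: fg.
by apply: ler_sum => t _; rewrite ler_wpM2l// pop_prob_ge0.
Qed.

Lemma le_next_min2 f g m m' q Y :
  (forall q Y a, f q Y * m a <= g q Y * m' a) ->
  next_min f m q Y <= next_min g m' q Y.
Proof.
move=> fg; rewrite /next_min big_seq_cond [leRHS]big_seq_cond.
apply: ler_sum => r /andP[hr _].
by rewrite ler_wpM2l ?rule_prob_ge0// le_popped_min.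
Qed.

Lemma le_next_min f g m q Y : (forall a, 0 <= m a) ->
  (forall q Y, f q Y <= g q Y) -> next_min f m q Y <= next_min g m q Y.
Proof. by move=> m0 fg; apply: le_next_min2 => q' Y' a; rewrite ler_wpM2r. Qed.

Lemma next_min_ge0 f m q Y : (forall a, 0 <= m a) ->
  (forall q Y, 0 <= f q Y) -> 0 <= next_min f m q Y.
Proof.
move=> m0 f0; rewrite /next_min big_seq_cond sumr_ge0// => r /andP[hr _].
rewrite mulr_ge0 ?rule_prob_ge0//; apply: popped_ge0 => // *.
by rewrite mulr_ge0.
Qed.

Lemma cvg_next_min (f : nat -> Q -> Γ -> R) g m q Y :
  (forall q Y, f n q Y @[n --> \oo] --> g q Y) ->
  next_min (f n) m q Y @[n --> \oo] --> next_min g m q Y.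
Proof.
move=> fg.
have h α s : popped pop_prob (min_base (f n) m) zero_term α s @[n --> \oo] -->
    popped pop_prob (min_base g m) zero_term α s.
  elim: α s => [|Z α IH] s /=; first exact: cvg_cst.
  apply: cvgD; first by apply: cvgMl; exact: fg.
  apply: (@cvg_sumr R _ _ _ (fun t n =>
    pop_prob s Z t * popped pop_prob (min_base (f n) m) zero_term α t)) => t _.
  by apply: cvgMr; exact: IH.
apply: (@cvg_sumr R _ _ _ (fun r n => prob Δ r *
  popped pop_prob (min_base (f n) m) zero_term r.2.2 (r.2.1, obs_init 𝒜))) => r _.
by apply: cvgMr; exact: h.
Qed.

(** Either [α] is popped entirely, or exactly one of its symbols is uncovered and stays forever; the
    sum over these symbols telescopes. *)
Lemma popped_never_pop α s :
  popped pop_prob (min_base never_pop (fun=> 1)) zero_term α s = 1 - pop_all α s.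
Proof.
elim: α s => [|Y α IH] s; first by rewrite /= subrr.
rewrite /= /min_base mulr1 never_popE /zero_base add0r.
under eq_bigr do rewrite IH mulrBr mulr1.
by rewrite sumrB addrA subrK.
Qed.

(** For [m] equal to 1 both sides agree unless [qY] has no rule; then the left side is 0 and the
    right side 1. This loss removes the finite runs in the limit. *)
Lemma next_min_never_pop m q Y : (forall a, m a <= 1) ->
  next_min never_pop m q Y <= never_pop q Y.
Proof.
move=> m1; apply: (@le_trans _ _ (next_min never_pop (fun=> 1) q Y)).
  by apply: le_next_min2 => q' Y' a; rewrite ler_wpM2l// never_pop_ge0.
rewrite /never_pop -pop_all1 pop_all1_fix.
apply: (le_trans _ (lerD (rule_sum1_le1 Δ 𝒜 (q, obs_init 𝒜) Y) (lexx _))).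
rewrite -rule_sumB le_eqVlt; apply/orP; left; apply/eqP; apply: eq_bigr => r _ /=.
by rewrite popped_never_pop (pop_all_obs _ _ _ (obs_next 𝒜 (q, obs_init 𝒜) Y)).
Qed.

(* Probability that qY is never popped and that the next n observations
   (these exist even on some finite runs) are weighted by ms 0, ms 1, etc. *)
Fixpoint min_iter n (ms : nat -> A -> R) : Q -> Γ -> R :=
  if n is n'.+1 then next_min (min_iter n' (fun k => ms k.+1)) (ms 0%N)
  else never_pop.

(** For [m] the indicator of C, [stay m] is g_C, [reach m n] is T^n g_C and [eventually_stay m] is
    h_C. *)
Definition stay m q Y : R := limn (fun n => min_iter n (fun=> m) q Y).

Definition reach m n : Q -> Γ -> R := iter n (fun f => next_min f (fun=> 1)) (stay m).

Definition eventually_stay m q Y : R := limn (fun n => reach m n q Y).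

Section Indicator.
Variable m : A -> R.
Hypotheses (m0 : forall a, 0 <= m a) (m1 : forall a, m a <= 1).

Let min_iterS n : min_iter n.+1 (fun=> m) = next_min (min_iter n (fun=> m)) m.
Proof. by []. Qed.

Lemma min_iter_ge0 n q Y : 0 <= min_iter n (fun=> m) q Y.
Proof.
elim: n q Y => [|n IH] q Y; first exact: never_pop_ge0.
by rewrite min_iterS next_min_ge0.
Qed.

Lemma min_iter_noninc q Y :
  {homo (fun n => min_iter n (fun=> m) q Y) : i j / (i <= j)%N >-> j <= i}.
Proof.
apply/nonincreasing_seqP => n; elim: n q Y => [|n IH] q Y.
  exact: next_min_never_pop.
by rewrite min_iterS [leRHS]/= le_next_min.
Qed.

Lemma stay_cvg q Y : min_iter n (fun=> m) q Y @[n --> \oo] --> stay m q Y.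
Proof.
apply: (@nonincreasing_bounded_cvg _ _ 0) => [|n]; first exact: min_iter_noninc.
exact: min_iter_ge0.
Qed.

Lemma stay_ge0 q Y : 0 <= stay m q Y.
Proof. by apply: cvg_cst_le (@stay_cvg q Y) => n; exact: min_iter_ge0. Qed.

Lemma stay_le_never_pop q Y : stay m q Y <= never_pop q Y.
Proof. exact: (nonincreasing_cvg_ge 0 (@min_iter_noninc q Y) (@stay_cvg q Y)). Qed.

Lemma stay_fix q Y : stay m q Y = next_min (stay m) m q Y.
Proof.
have h : next_min (min_iter n (fun=> m)) m q Y @[n --> \oo] --> next_min (stay m) m q Y.
  by apply: (@cvg_next_min (fun n => min_iter n (fun=> m))) => *; exact: stay_cvg.
rewrite -(cvg_lim _ h)//; apply/esym/cvg_lim => //.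
have := @stay_cvg q Y; rewrite -cvg_shiftS; exact.
Qed.

Lemma stay_greatest g : (forall q Y, g q Y <= never_pop q Y) ->
  (forall q Y, g q Y <= next_min g m q Y) -> forall q Y, g q Y <= stay m q Y.
Proof.
move=> g0 g1 q Y; apply: cvg_cst_le (@stay_cvg q Y) => n.
elim: n q Y => [|n IH] q Y; first exact: g0.
by rewrite min_iterS; apply: le_trans (g1 q Y) _; exact: le_next_min.
Qed.

Lemma reach_nondec q Y : {homo (fun n => reach m n q Y) : i j / (i <= j)%N >-> i <= j}.
Proof.
apply/nondecreasing_seqP => n; elim: n q Y => [|n IH] q Y.
  (* [stay m] is fixed by the operator with weight [m], and the operator with weight 1 dominates
     that one on nonnegative functions. *)
  rewrite /reach /= [leLHS]stay_fix; apply: le_next_min2 => q' Y' a.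
  by rewrite ler_wpM2l// stay_ge0.
by apply: le_next_min => // *; exact: ler01.
Qed.

Lemma reach_le_never_pop n q Y : reach m n q Y <= never_pop q Y.
Proof.
elim: n q Y => [|n IH] q Y; first exact: stay_le_never_pop.
apply: le_trans (@next_min_never_pop (fun=> 1) q Y _) => //.
by apply: le_next_min => // *; exact: ler01.
Qed.

Lemma eventually_stay_cvg q Y : reach m n q Y @[n --> \oo] --> eventually_stay m q Y.
Proof.
apply: (@nondecreasing_bounded_cvg _ _ (never_pop q Y)) => [|n]; first exact: reach_nondec.
exact: reach_le_never_pop.
Qed.

Lemma stay_le_eventually q Y : stay m q Y <= eventually_stay m q Y.
Proof. exact: (nondecreasing_cvg_le 0 (@reach_nondec q Y) (@eventually_stay_cvg q Y)). Qed.

Lemma eventually_stay_fix q Y :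
  next_min (eventually_stay m) (fun=> 1) q Y = eventually_stay m q Y.
Proof.
have h : next_min (reach m n) (fun=> 1) q Y @[n --> \oo] -->
    next_min (eventually_stay m) (fun=> 1) q Y.
  by apply: cvg_next_min => *; exact: eventually_stay_cvg.
rewrite -(cvg_lim _ h)//; apply/cvg_lim => //.
have := @eventually_stay_cvg q Y; rewrite -cvg_shiftS; exact.
Qed.

Lemma eventually_stay_least h : (forall q Y, stay m q Y <= h q Y) ->
  (forall q Y, next_min h (fun=> 1) q Y <= h q Y) ->
  forall q Y, eventually_stay m q Y <= h q Y.
Proof.
move=> h0 h1 q Y; apply: cvg_le_cst (@eventually_stay_cvg q Y) => n.
elim: n q Y => [|n IH] q Y; first exact: h0.
by apply: le_trans (h1 q Y); apply: le_next_min => // *; exact: ler01.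
Qed.

(** Lying above [stay m] is expressed as lying above every g allowed in [stay_greatest], so that the
    condition is first-order in h without a name for [stay m]. *)
Definition eventually_bound h : Prop :=
  (forall g, (forall q Y, g q Y <= never_pop q Y) ->
     (forall q Y, g q Y <= next_min g m q Y) -> forall q Y, g q Y <= h q Y) /\
  (forall q Y, next_min h (fun=> 1) q Y <= h q Y).

Lemma eventually_stay_bound : eventually_bound (eventually_stay m).
Proof.
split=> [g g0 g1 q Y|q Y]; last by rewrite eventually_stay_fix.
exact: le_trans (stay_greatest g0 g1 q Y) (stay_le_eventually q Y).
Qed.

Lemma eventually_bound_least h : eventually_bound h ->
  forall q Y, eventually_stay m q Y <= h q Y.
Proof.
case=> h0 h1; apply: eventually_stay_least h1 => q Y.
by apply: h0 => q' Y'; rewrite ?stay_le_never_pop// -stay_fix.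
Qed.

(** By continuity of [next_min], the k unrestricted rounds move inside the limit. The terms become
    probabilities of finite chains of minima whose first k observations are free. *)
Lemma reach_cvg k q Y :
  min_iter (k + n) (fun i => if (i < k)%N then fun=> 1 else m) q Y @[n --> \oo] -->
  reach m k q Y.
Proof.
elim: k q Y => [|k IH] q Y; first exact: stay_cvg.
rewrite /reach iterS; apply: (@cvg_next_min
  (fun n => min_iter (k + n) (fun i => if (i < k)%N then fun=> 1 else m))).
exact: IH.
Qed.

End Indicator.

End MinimaOperator.

(** * Runs and their measure *)

Section RunMeasure.
Variables (R : realType) (Q Γ : finType) (Δ : ppda R Q Γ) (s : Q * seq Γ).
Local Notation conf := (@conf R Q Γ Δ s).
Local Notation cyl := (@cylinder R Q Γ Δ s).
Local Notation succs q Y β :=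
  [seq (r.2.1, r.2.2 ++ β) | r <- enum_fset (rules Δ) & r.1 == (q, Y)].
Implicit Types (w : run Δ s) (u : seq (Q * seq Γ)) (i j k n : nat).

Definition alive w i : bool := isSome (sval w i).
(** Meaningful only while the run is alive: after its end, [conf] returns the start
    configuration. *)
Definition height w i : nat := size (conf w i).2.

Lemma alive_conf w i : alive w i -> sval w i = Some (conf w i).
Proof. by rewrite /alive /Defs.conf; case: (sval w i). Qed.

Lemma alive0 w : alive w 0. Proof. by rewrite /alive (svalP w).1. Qed.

Lemma aliveS w i : alive w i.+1 -> alive w i.
Proof.
rewrite /alive; have := (svalP w).2 i.
by case: (sval w i) => //; case: (sval w i.+1).
Qed.

Lemma alive_le w i j : (i <= j)%N -> alive w j -> alive w i.
Proof.
elim: j => [|j IH]; first by rewrite leqn0 => /eqP->.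
by rewrite leq_eqVlt ltnS => /orP[/eqP->//|ij /aliveS]; exact: IH.
Qed.

Lemma step_conf w i : alive w i.+1 -> step Δ (conf w i) (conf w i.+1).
Proof.
move=> h; have := (svalP w).2 i.
by rewrite (alive_conf h) (alive_conf (aliveS h)).
Qed.

Lemma mem_succs q Y β t : (t \in succs q Y β) = step Δ (q, Y :: β) t.
Proof.
apply/mapP/hasP => [[r]|[r hr]].
  by rewrite mem_filter => /andP[h hr] ->; exists r => //=; rewrite h eqxx.
by rewrite /= => /andP[h /eqP->]; exists r; rewrite ?mem_filter ?h.
Qed.

(** The common suffix [β] forces the two right-hand sides to have equal length, hence to be equal.
    So each step determines its rule. *)
Lemma succs_inj q Y β : {in [seq r <- enum_fset (rules Δ) | r.1 == (q, Y)] &,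
  injective (fun r : rule Q Γ => (r.2.1, r.2.2 ++ β))}.
Proof.
move=> [h [q1 a1]] [h' [q2 a2]]; rewrite !mem_filter /=.
move=> /andP[/eqP-> _] /andP[/eqP-> _] [-> e].
have /eqP := congr1 size e; rewrite !size_cat eqn_add2r => /eqP sz.
by move/eqP: e; rewrite eqseq_cat// eqxx andbT => /eqP->.
Qed.

Lemma step_prob_rule q Y β r : r \in enum_fset (rules Δ) -> r.1 == (q, Y) ->
  step_prob Δ (q, Y :: β) (r.2.1, r.2.2 ++ β) = prob Δ r.
Proof.
move=> hr hq; rewrite /step_prob big_mkcond (bigD1_seq r)//= ?fset_uniq// hq !eqxx /=.
rewrite big1_seq ?addr0// => r' /andP[ne hr']; case: ifP => // /andP[h1 /eqP h2].
case/eqP: ne; symmetry.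
by apply: (@succs_inj q Y β); rewrite ?mem_filter ?h1 ?hq.
Qed.

Lemma cyl_last u w : cyl u w -> sval w (size u) = Some (last s u).
Proof. by move/(_ _ (leqnn _)); rewrite (last_nth s). Qed.

Lemma cyl_rcons u t w :
  cyl (rcons u t) w <-> cyl u w /\ sval w (size u).+1 = Some t.
Proof.
rewrite /cylinder /= size_rcons; split => [h|[h1 h2] i].
  split=> [i iu|].
    by rewrite h ?(leq_trans iu)// -rcons_cons nth_rcons /= ltnS iu.
  by rewrite h// -rcons_cons nth_rcons /= ltnn eqxx.
rewrite leq_eqVlt ltnS => /orP[/eqP->|iu].
  by rewrite h2 -rcons_cons nth_rcons /= ltnn eqxx.
by rewrite h1// -rcons_cons nth_rcons /= ltnS iu.
Qed.

Lemma cyl_path u w : cyl u w -> path (step Δ) s u.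
Proof.
move=> h; apply/(pathP s) => i iu.
have := (svalP w).2 i; rewrite (h i (ltnW iu)) (h i.+1 iu).
by [].
Qed.

Lemma alive_cyl w i : alive w i -> exists2 u, size u = i & cyl u w.
Proof.
elim: i => [|i IH] h.
  by exists [::] => // -[|i] //= _; rewrite (svalP w).1.
have [u su hu] := IH (aliveS h); exists (rcons u (conf w i.+1)).
  by rewrite size_rcons su.
by apply/cyl_rcons; rewrite su -alive_conf.
Qed.

Definition weight u : R := \prod_(i < size u) step_prob Δ (nth s (s :: u) i) (nth s u i).

Lemma weight_rcons u t : weight (rcons u t) = weight u * step_prob Δ (last s u) t.
Proof.
rewrite /weight size_rcons big_ord_recr /=; congr (_ * _).
  apply: eq_bigr => i _; rewrite -rcons_cons !nth_rcons /= ltn_ord.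
  by rewrite ltnS ltnW.
by rewrite nth_rcons ltnn eqxx -rcons_cons nth_rcons /= ltnSn (last_nth s).
Qed.

Local Notation run_space := (run_space Δ s).

Lemma measurable_cyl u : measurable (cyl u : set run_space).
Proof.
have [hu|hu] := boolP (path (step Δ) s u).
  by apply: sub_sigma_algebra; exists u.
rewrite (_ : cyl u = set0) ?measurable0//; apply/seteqP; split=> // w /cyl_path.
by rewrite (negbTE hu).
Qed.

(** Paths are countable: fixing the i-th configuration gives a countable union of cylinders, and
    [None] is the complement of all these events. *)
Lemma measurable_at i (o : option (Q * seq Γ)) :
  measurable ([set w | sval w i = o] : set run_space).
Proof.
suff h c : measurable ([set w | sval w i = Some c] : set run_space).
  case: o => // ; rewrite (_ : [set _ | _] = ~` \bigcup_c [set w | sval w i = Some c]).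
    by apply: measurableC; apply: countable_bigcupT_measurable => //; exact: countableP.
  apply/seteqP; split => w /=; first by move=> h' [c _ /=]; rewrite h'.
  by move=> h'; case e: (sval w i) => [c|] //; case: h'; exists c.
rewrite (_ : [set _ | _] =
  \bigcup_u (if (size u == i) && (last s u == c) then cyl u else set0)).
  apply: countable_bigcupT_measurable => [|u]; first exact: countableP.
  by case: ifP => _; [exact: measurable_cyl | exact: measurable0].
apply/seteqP; split => w /= => [h'|[u _]].
  have [|u su hu] := @alive_cyl w i; first by rewrite /alive h'.
  have [e] : Some (last s u) = Some c by rewrite -(cyl_last hu) su.
  by exists u => //=; rewrite su e !eqxx.
by case: ifP => // /andP[/eqP<- /eqP<-] /cyl_last.
Qed.

(** There are countably many prefixes of length n + 1, and a set closed under agreement up to n is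
    the union of the prefix events that meet it. *)
Lemma measurable_prefix n (B : set run_space) :
  (forall w w', (forall i, (i <= n)%N -> sval w i = sval w' i) -> B w -> B w') ->
  measurable B.
Proof.
move=> hB; pose pre w := [seq sval w i | i <- iota 0 n.+1].
have prek w i : (i <= n)%N -> nth None (pre w) i = sval w i.
  by move=> h; rewrite (nth_map 0%N) ?size_iota// nth_iota.
have mpre v : measurable ([set w | pre w = v] : set run_space).
  have [sv|sv] := eqVneq (size v) n.+1; last first.
    rewrite (_ : [set _ | _] = set0) ?measurable0//; apply/seteqP; split => // w /= e.
    by move: sv; rewrite -e size_map size_iota eqxx.
  rewrite (_ : [set _ | _] = \bigcap_(i in `I_n.+1) [set w | sval w i = nth None v i]).
    by apply: bigcap_measurable => [|i _]; [exists 0%N | exact: measurable_at].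
  apply/seteqP; split => w /= => [<- i /= h|h]; first by rewrite prek.
  apply: (@eq_from_nth _ None) => [|i]; rewrite size_map size_iota ?sv// => h'.
  by rewrite prek//; exact: h.
rewrite (_ : B =
  \bigcup_v (if `[< exists2 w, B w & pre w = v >] then [set w | pre w = v] else set0)).
  apply: countable_bigcupT_measurable => [|v]; first exact: countableP.
  by case: ifP => _; [exact: mpre | exact: measurable0].
apply/seteqP; split => w /= => [Bw|[v _]].
  by exists (pre w) => //; case: asboolP => // -[]; exists w.
case: asboolP => // -[w' Bw' <-] /= e; apply: hB Bw' => i h.
by rewrite -!prek// e.
Qed.

End RunMeasure.

Lemma measure_list_cover d (T : measurableType d) (R : realType)
    (mu : {measure set T -> \bar R}) (I : eqType) (l : seq I) (F : I -> set T) (G : set T) :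
  uniq l -> (forall i, i \in l -> measurable (F i)) ->
  (forall i j w, i \in l -> j \in l -> F i w -> F j w -> i = j) ->
  (forall w, G w <-> exists2 i, i \in l & F i w) ->
  mu G = (\sum_(i <- l) mu (F i))%E.
Proof.
elim: l G => [|i l IH] G /=.
  move=> _ _ _ h; rewrite big_nil (_ : G = set0) ?measure0//.
  by apply/seteqP; split => // w /h[].
move=> /andP[il ul] mF dF hG; rewrite big_cons.
have mem_l j : j \in l -> j \in i :: l by rewrite in_cons orbC => ->.
rewrite -(IH [set w | exists2 j, j \in l & F j w])//; first last.
- by move=> j k w /mem_l + /mem_l; exact: dF.
- by move=> j /mem_l; exact: mF.
rewrite (_ : G = F i `|` [set w | exists2 j, j \in l & F j w]); last first.
  apply/seteqP; split => w.
    move=> /hG[j]; rewrite in_cons => /orP[/eqP->|jl] h; [by left | by right; exists j].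
  by case=> [h|[j /mem_l jl h]]; apply/hG; [exists i => //; exact: mem_head | exists j].
rewrite measureU//.
- exact/mF/mem_head.
- rewrite (_ : [set w | _] = \bigcup_(j in [set` l]) F j).
    by apply: fin_bigcup_measurable => // j /mem_l; exact: mF.
  by apply/seteqP; split => w /= [j]; exists j.
- apply/seteqP; split => // w [hi [j jl hj]].
  by move: il; rewrite (dF _ _ _ (mem_head _ _) (mem_l _ jl) hi hj) jl.
Qed.

Section RunProbabilities.
Variables (R : realType) (Q Γ : finType) (Δ : ppda R Q Γ) (s : Q * seq Γ).
Variables (A : finType) (𝒜 : observer Q Γ A).
Variable P : {measure set (run_space Δ s) -> \bar R}.
Hypothesis hP : is_run_measure P.
Local Notation conf := (@conf R Q Γ Δ s).
Local Notation cyl := (@cylinder R Q Γ Δ s).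
Local Notation run_space := (run_space Δ s).
Local Notation weight := (weight Δ s).
Implicit Types (w : run Δ s) (u : seq (Q * seq Γ)) (i j k n : nat).
Implicit Types (q : Q) (Y : Γ) (α β γ : seq Γ).

Lemma prob_cyl u : path (step Δ) s u -> P (cyl u) = (weight u)%:E.
Proof. exact: hP. Qed.

Lemma prob_setT : P setT = 1%E.
Proof.
rewrite (_ : setT = cyl [::]); first by rewrite prob_cyl// /weight big_ord0.
by apply/seteqP; split => // w _ [|i] //= _; rewrite (svalP w).1.
Qed.

Lemma prob_le1 (Z : set run_space) : measurable Z -> (P Z <= 1)%E.
Proof. by move=> mZ; rewrite -prob_setT le_measure ?inE. Qed.

Lemma path_succ u r q Y β : path (step Δ) s u -> last s u = (q, Y :: β) ->
  r \in enum_fset (rules Δ) -> r.1 == (q, Y) ->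
  path (step Δ) s (rcons u (r.2.1, r.2.2 ++ β)).
Proof.
move=> pu lu hr hq; rewrite rcons_path pu lu; apply/hasP; exists r => //=.
by rewrite hq eqxx.
Qed.

(** One step of the run. That [Z] requires a further configuration excludes the runs stuck at the
    end of [u], which follow no rule. *)
Lemma prob_split u q Y β (Z : set run_space) (G : Q -> seq Γ -> R) :
  path (step Δ) s u -> last s u = (q, Y :: β) -> measurable Z ->
  (forall w, Z w -> alive w (size u).+1) ->
  (forall r, r \in enum_fset (rules Δ) -> r.1 == (q, Y) ->
    let v := rcons u (r.2.1, r.2.2 ++ β) in
    P (cyl v `&` Z) = (weight v * G r.2.1 r.2.2)%:E) ->
  P (cyl u `&` Z) =
  (weight u * \sum_(r <- enum_fset (rules Δ) | r.1 == (q, Y)) prob Δ r * G r.2.1 r.2.2)%:E.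
Proof.
move=> pu lu mZ aZ hG.
pose F (r : rule Q Γ) := cyl (rcons u (r.2.1, r.2.2 ++ β)) `&` Z.
rewrite (@measure_list_cover _ _ _ P _ [seq r <- enum_fset (rules Δ) | r.1 == (q, Y)] F).
- rewrite mulr_sumr big_filter -sumEFin big_seq_cond [RHS]big_seq_cond.
  apply: eq_bigr => r /andP[hr hq].
  by rewrite /F hG// weight_rcons lu step_prob_rule// mulrA.
- by rewrite filter_uniq// fset_uniq.
- by move=> r _; apply: measurableI => //; exact: measurable_cyl.
- move=> r r' w hr hr' [/cyl_rcons[_ h] _] [/cyl_rcons[_ h'] _].
  by apply: (@succs_inj R Q Γ Δ q Y β) => //; move: h; rewrite h' => -[-> ->].
- move=> w; split=> [[cu Zw]|[r _ [/cyl_rcons[]]]] //.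
  have h := aZ _ Zw; have := step_conf h.
  have := cyl_last cu; rewrite (alive_conf (aliveS h)) lu => -[->].
  rewrite -mem_succs => /mapP[r hr e]; exists r => //; split => //.
  by apply/cyl_rcons; split => //; rewrite (alive_conf h) e.
Qed.

Lemma cyl_height u w : cyl u w -> height w (size u) = size (last s u).2.
Proof. by move=> /cyl_last e; rewrite /height /Defs.conf e. Qed.

Lemma cyl_alive u w : cyl u w -> alive w (size u).
Proof. by move=> /cyl_last e; rewrite /alive e. Qed.

Definition drops i k n w : Prop :=
  exists l, [/\ (i <= l <= i + n)%N, alive w l & (height w l <= k)%N].

Lemma alive_ext w w' n l : (forall i, (i <= n)%N -> sval w i = sval w' i) ->
  (l <= n)%N -> (alive w l = alive w' l) * (conf w l = conf w' l) * (height w l = height w' l).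
Proof. by move=> h ln; rewrite /alive /height /Defs.conf !h. Qed.

Lemma measurable_drops i k n : measurable (drops i k n : set run_space).
Proof.
apply: (@measurable_prefix _ _ _ _ _ (i + n)) => w w' ww' [l [h a b]].
have ln : (l <= i + n)%N by case/andP: h.
by exists l; rewrite -!(alive_ext ww' ln).
Qed.

(** [α] has been popped exactly when the height has come down to that of [β]; [a] is an arbitrary
    state of the passive observer. *)
Lemma prob_drops u q α β n (a : A) : path (step Δ) s u -> last s u = (q, α ++ β) ->
  P (cyl u `&` drops (size u) (size β) n) =
  (weight u * popped_within Δ 𝒜 (@zero_base R Q Γ A) (fun=> 1) n α 0 (q, a))%:E.
Proof.
elim: n u q α a => [|n IH] u q [|Y α] a pu lu.
- rewrite mulr1 -prob_cyl//; congr (P _); apply/seteqP; split => [w []//|w cw].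
  split => //; exists (size u); rewrite cyl_alive// cyl_height// lu leqnn; split=> //; lia.
- rewrite /= mulr0 (_ : _ `&` _ = set0) ?measure0//; apply/seteqP; split => // w [cw [l [h _]]].
  have -> : l = size u by lia.
  by rewrite cyl_height// lu size_cat /=; lia.
- rewrite mulr1 -prob_cyl//; congr (P _); apply/seteqP; split => [w []//|w cw].
  split => //; exists (size u); rewrite cyl_alive// cyl_height// lu leqnn; split=> //; lia.
(* The current position is too high to be a witness, so the window of n + 1 steps may start one
   position later with n. *)
- rewrite (_ : _ `&` _ = cyl u `&` drops (size u).+1 (size β) n); last first.
    apply/seteqP; split => w [cw [l [h al hl]]]; split => //; exists l; split=> //; last by lia.
    suff : l != size u by lia.
    by apply/eqP => e; move: hl; rewrite e cyl_height// lu size_cat /=; lia.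
  rewrite (prob_split (G := fun q' γ => popped_within Δ 𝒜 (@zero_base R Q Γ A) (fun=> 1) n
    (γ ++ α) 0 (q', obs_next 𝒜 (q, a) Y)) pu lu).
  + by rewrite /= min0n add0r.
  + exact: measurable_drops.
  + by move=> w [l [h al _]]; apply: alive_le al; lia.
  + move=> r hr hq v; rewrite -[(size u).+1](size_rcons u (r.2.1, r.2.2 ++ (α ++ β))).
    by apply: IH; rewrite ?last_rcons ?catA//; exact: (path_succ pu lu hr hq).
Qed.

End RunProbabilities.

(** * Minima as events, and their probabilities *)

Section Minima.
Variables (R : realType) (Q Γ : finType) (Δ : ppda R Q Γ) (s : Q * seq Γ).
Variables (A : finType) (𝒜 : observer Q Γ A).
Local Notation conf := (@conf R Q Γ Δ s).
Local Notation cyl := (@cylinder R Q Γ Δ s).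
Local Notation run_space := (run_space Δ s).
Local Notation weight := (weight Δ s).
Implicit Types (w : run Δ s) (u : seq (Q * seq Γ)) (i j k l n : nat).
Implicit Types (q : Q) (Y : Γ) (α β γ : seq Γ) (a : A).

(* Unlike [is_min], this also makes sense on finite runs. *)
Definition floor_pos w i : Prop :=
  alive w i /\ forall j, (i <= j)%N -> alive w j -> (height w i <= height w j)%N.

Definition seg_obs w a i j : A :=
  foldl (obs_step 𝒜) a (pmap (fun l => head_of (conf w l)) (iota i (j - i))).

(** The event measured by [popped_within] with [min_base]: [b] is the height of the part of the
    stack left untouched, and [k] is the threshold as an absolute height. A strict new low at [j]
    means that the symbol on top has just been uncovered. *)
Definition search (Z : nat -> set run_space) (C : pred A) i k b n a w : Prop :=
  exists j, [/\ [&& (i <= j < i + n)%N, alive w j & (b < height w j <= k)%N],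
    forall l, (i <= l < j)%N -> (height w j < height w l)%N,
    C (seg_obs w a i j.+1) & Z j w].

(** If [j] is moreover a floor, then it is the next minimum after [i], since everything in between
    is strictly higher. Being a floor concerns the infinite future and is kept apart from this
    condition on a finite prefix. *)
Definition next_cand w i j : Prop :=
  [/\ (i < j)%N, alive w j, (height w i <= height w j)%N &
    forall l, (i < l < j)%N -> (height w j < height w l)%N].

(** Only the last position is required to be a floor; [chain_floor] carries this property back along
    the candidates. *)
Fixpoint chain n (Cs : nat -> pred A) i w : Prop :=
  if n is n'.+1 then
    exists j, [/\ next_cand w i j, Cs 0%N (seg_obs w (obs_init 𝒜) i.+1 j.+1) &
      chain n' (fun k => Cs k.+1) j w]
  else floor_pos w i.

Lemma measurable_floor_pos i : measurable ([set w | floor_pos w i] : set run_space).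
Proof.
rewrite (_ : [set _ | _] = \bigcap_j [set w | alive w i /\ ((i <= j)%N -> alive w j ->
   (height w i <= height w j)%N)]).
  apply: bigcapT_measurable => j; apply: (@measurable_prefix _ _ _ _ _ (i + j)) => w w' ww'.
  by rewrite /= -!(alive_ext ww' (leq_addr j i)) -!(alive_ext ww' (leq_addl i j)).
apply/seteqP; split => w /= => [[h1 h2] j _ //=|h]; first by split => //; exact: h2.
by split=> [|j]; [have [] := h 0%N I | have [_] := h j I].
Qed.

Lemma seg_obs_ext w w' n a i j : (forall i, (i <= n)%N -> sval w i = sval w' i) ->
  (j <= n.+1)%N -> seg_obs w a i j = seg_obs w' a i j.
Proof.
move=> ww' jn; rewrite /seg_obs; congr foldl.
have : all (fun l => l <= n)%N (iota i (j - i)).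
  by apply/allP => l; rewrite mem_iota; lia.
elim: (iota _ _) => //= l r IH /andP[ln /IH->].
by rewrite (alive_ext ww' ln).
Qed.

Lemma measurable_search Z C i k b n a : (forall j, measurable (Z j)) ->
  measurable (search Z C i k b n a : set run_space).
Proof.
move=> mZ; rewrite (_ : search _ _ _ _ _ _ _ = \bigcup_j ([set w |
    [/\ [&& (i <= j < i + n)%N, alive w j & (b < height w j <= k)%N],
    forall l, (i <= l < j)%N -> (height w j < height w l)%N &
    C (seg_obs w a i j.+1)]] `&` Z j)).
  apply: bigcupT_measurable => j; apply: measurableI => //.
  apply: (@measurable_prefix _ _ _ _ _ j) => w w' ww' /=.
  rewrite (seg_obs_ext a i ww' (leqnn _)) !(alive_ext ww' (leqnn _)) => -[h1 h2 h3].
  split => // l /[dup] h /h2; rewrite !(alive_ext ww' (l := l))//; lia.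
apply/seteqP; split => w [j]; first by move=> [h1 h2 h3 h4]; exists j.
by move=> _ [[h1 h2 h3] h4]; exists j.
Qed.

Lemma measurable_next (Z : nat -> set run_space) (C : pred A) i :
  (forall j, measurable (Z j)) ->
  measurable ([set w | exists j, [/\ next_cand w i j,
    C (seg_obs w (obs_init 𝒜) i.+1 j.+1) & Z j w]] : set run_space).
Proof.
move=> mZ; rewrite (_ : [set _ | _] = \bigcup_j ([set w |
    next_cand w i j /\ C (seg_obs w (obs_init 𝒜) i.+1 j.+1)] `&` Z j)).
  apply: bigcupT_measurable => j; apply: measurableI => //.
  have [ij|ij] := leqP j i.
    rewrite (_ : [set _ | _] = set0) ?measurable0//.
    by apply/seteqP; split => // w [[]]; rewrite ltnNge ij.
  apply: (@measurable_prefix _ _ _ _ _ j) => w w' ww' /=.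
  rewrite (seg_obs_ext _ _ ww' (leqnn _)) => -[[h1 h2 h3 h4] h5]; split => //.
  split => //; try by rewrite -?(alive_ext ww' (leqnn _)) -?(alive_ext ww' (ltnW ij)).
  by move=> l /[dup] h /h4; rewrite !(alive_ext ww' (leqnn _)) !(alive_ext ww' (l := l))//; lia.
apply/seteqP; split => w [j]; first by move=> [h1 h2 h3]; exists j.
by move=> _ [[h1 h2] h3]; exists j.
Qed.

Lemma measurable_chain n Cs i : measurable (chain n Cs i : set run_space).
Proof.
elim: n Cs i => [|n IH] Cs i; first exact: measurable_floor_pos.
by apply: (@measurable_next (chain n (fun k => Cs k.+1))) => j; exact: IH.
Qed.

Lemma chain_floor n Cs i w : alive w i -> chain n Cs i w -> floor_pos w i.
Proof.
elim: n Cs i => [|n IH] Cs i // ai [j [[ij aj hij hl] _ /(IH _ _ aj)[_ hj]]].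
split => // l il al; have [jl|lj] := leqP j l; first exact: leq_trans hij (hj _ jl al).
have [->//|ne] := eqVneq l i.
by apply: (leq_trans hij); apply/ltnW/hl; lia.
Qed.

(** Of two candidates the later one is strictly lower, which contradicts the earlier one being a
    floor. *)
Lemma next_cand_uniq w i j j' : next_cand w i j -> next_cand w i j' ->
  floor_pos w j -> floor_pos w j' -> j = j'.
Proof.
wlog jj' : j j' / (j < j')%N => [th|].
  case: (ltngtP j j') => // h; first exact: th.
  by move=> *; symmetry; apply: th.
move=> [ij _ _ _] [_ aj' _ h] [_ hj] _.
have := hj _ (ltnW jj') aj'; have := h j; lia.
Qed.

Section Measure.
Variable P : {measure set (run_space) -> \bar R}.
Hypothesis hP : is_run_measure P.

(** The end of [u] fails to be a floor when the height falls to [size β] within some n steps. These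
    events increase with n, and the claim follows by taking the complement in the cylinder. *)
Lemma prob_floor_pos u q Y β : path (step Δ) s u -> last s u = (q, Y :: β) ->
  P (cyl u `&` [set w | floor_pos w (size u)]) =
  (weight u * never_pop Δ 𝒜 q Y)%:E.
Proof.
move=> pu lu.
pose F n : set run_space := cyl u `&` drops (size u) (size β) n.
have mF n : measurable (F n).
  by apply: measurableI; [exact: measurable_cyl | exact: measurable_drops].
have mU : measurable (\bigcup_n F n) by exact: bigcupT_measurable.
have ndF : nondecreasing_seq F.
  move=> i j ij; apply/subsetPset => w [cw [l [h1 h2 h3]]]; split => //.
  by exists l; split=> //; lia.
have hF : P (\bigcup_n F n) = (weight u * (1 - never_pop Δ 𝒜 q Y))%:E.
  rewrite -(cvg_lim _ (nondecreasing_cvg_mu mF mU ndF))//.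
  apply: cvg_lim => //.
  rewrite (_ : _ \o F = fun n => (weight u * popped_within Δ 𝒜 (@zero_base R Q Γ A)
      (fun=> 1) n [:: Y] 0 (q, obs_init 𝒜))%:E); last first.
    by apply/funext => n; exact: (prob_drops 𝒜 hP _ _ pu).
  apply: cvg_EFin; first exact: nearW.
  rewrite /never_pop opprD opprK addrA subrr add0r -pop_all1.
  apply: cvgMr; rewrite (_ : (fun _ => _) = fun n => popped_within Δ 𝒜 (@zero_base R Q Γ A)
      (fun=> 1) n [:: Y] 1 (q, obs_init 𝒜)).
    by apply: popped_within_cvg => *; rewrite ?zero_base_ge0.
  by apply/funext => n; rewrite [RHS]popped_within_zero_base.
rewrite (_ : _ `&` _ = cyl u `\` \bigcup_n F n); last first.
  apply/seteqP; split => w [cw h]; split => //.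
    move=> [n _ [_ [l [h1 h2 h3]]]]; have [_ /(_ l)] := h.
    by rewrite (cyl_height cw) lu /=; lia.
  split; first exact: cyl_alive.
  move=> j uj aj; rewrite leqNgt; apply/negP => hj; apply: h.
  exists j => //; split => //; exists j; split => //; first lia.
  by move: hj; rewrite (cyl_height cw) lu.
have -> : P (cyl u `\` \bigcup_n F n) = (P (cyl u) - P (cyl u `&` \bigcup_n F n))%E.
  apply: measureD => //; first exact: measurable_cyl.
  by apply: le_lt_trans (prob_le1 hP (measurable_cyl u)) _; exact: ltry.
rewrite (_ : cyl u `&` _ = \bigcup_n F n); last first.
  by apply/seteqP; split => w; [case | move=> h; split=> //; case: h => n _ []].
by rewrite hF (prob_cyl hP)// -EFinB; congr EFin; ring.
Qed.

(** * Probability of finding the next minimum *)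

Section Search.
Variables (Z : nat -> set run_space) (C : pred A) (f : Q -> Γ -> R).
Hypothesis mZ : forall j, measurable (Z j).
Hypothesis Zfloor : forall j w, alive w j -> Z j w -> floor_pos w j.
Hypothesis hZ : forall u q Y β, path (step Δ) s u -> last s u = (q, Y :: β) ->
  P (cyl u `&` Z (size u)) = (weight u * f q Y)%:E.

Local Notation m := (fun a => (C a)%:R : R).

Lemma seg_obsS w a i j : (i <= j)%N -> seg_obs w a i j.+1 =
  seg_obs w (if head_of (conf w i) is Some h then obs_step 𝒜 a h else a) i.+1 j.+1.
Proof.
by move=> ij; rewrite /seg_obs subSS subSn//=; case: (head_of _).
Qed.

Lemma search_none u q α β k n a : last s u = (q, α ++ β) ->
  (n == 0%N) || (α == [::]) ->
  cyl u `&` search Z C (size u) (k + size β) (size β) n a = set0.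
Proof.
move=> lu h; apply/seteqP; split => // w [cw [j [/and3P[hj aj hj2] hl _ _]]].
case/orP: h => [/eqP n0|/eqP α0]; first by lia.
have := cyl_height cw; rewrite lu α0 /= => hu.
have [e|ne] := eqVneq j (size u); first by move: hj2; rewrite e hu; lia.
by have := hl (size u); rewrite hu; lia.
Qed.

(** The current position counts if its height is within the threshold and the observation lies in
    [C] ([now]). All other candidates lie strictly below it, hence the new threshold
    [minn k (size α)] ([later]). *)
Lemma prob_search u q α β k n a : path (step Δ) s u -> last s u = (q, α ++ β) ->
  P (cyl u `&` search Z C (size u) (k + size β) (size β) n a) =
  (weight u * popped_within Δ 𝒜 (min_base 𝒜 f m) (@zero_term R Q A) n α k (q, a))%:E.
Proof.
elim: n u q α k a => [|n IH] u q [|Y α] k a pu lu;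
  try by rewrite (search_none _ _ lu)//= measure0 mulr0.
set now := ((size α < k)%N && C (obs_step 𝒜 a (q, Y))).
set later : set run_space := cyl u `&` search Z C (size u).+1 (minn k (size α) + size β)
  (size β) n (obs_step 𝒜 a (q, Y)).
have mlater : measurable later.
  by apply: measurableI; [exact: measurable_cyl | exact: measurable_search].
have headu w : cyl u w -> head_of (conf w (size u)) = Some (q, Y).
  by move=> /cyl_last e; rewrite /Defs.conf e /= lu.
rewrite (_ : _ `&` _ = (if now then cyl u `&` Z (size u) else set0) `|` later); last first.
  apply/seteqP; split => w.
    move=> [cw [j [/and3P[hj aj hj2] hl hC hz]]].
    have := cyl_height cw; rewrite lu /= size_cat => hu.
    have [e|ne] := eqVneq j (size u); [left|right].
      rewrite e hu in hj2 hC hz *; rewrite seg_obsS// headu// in hC.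
      by rewrite /now ifT//; apply/andP; split; [lia | move: hC; rewrite /seg_obs subnn].
    split => //; exists j; split => //; last by move: hC; rewrite seg_obsS ?headu//; lia.
    - by rewrite aj; have := hl (size u); rewrite hu; lia.
    - by move=> l h; apply: hl; lia.
  case.
    rewrite /now; case: ifP => // /andP[ak hC] [cw hz]; split => //.
    have := cyl_height cw; rewrite lu /= size_cat => hu.
    exists (size u); split => //; first by rewrite (cyl_alive cw) hu; lia.
      by move=> l; lia.
    by rewrite seg_obsS// headu// /seg_obs subnn.
  move=> [cw [j [/and3P[hj aj hj2] hl hC hz]]]; split => //.
  have := cyl_height cw; rewrite lu /= size_cat => hu.
  exists j; split => //; last by rewrite seg_obsS ?headu//; lia.
    by rewrite aj; lia.
  move=> l h; have [->|ne] := eqVneq l (size u); first by rewrite hu; lia.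
  by apply: hl; lia.
set X : set run_space := if now then _ else _.
have -> : P (X `|` later) = (P X + P later)%E.
  apply: measureU => //.
  + rewrite /X; case: ifP => _; [|exact: measurable0].
    by apply: measurableI => //; exact: measurable_cyl.
  + apply/seteqP; split => // w []; rewrite /X; case: ifP => // _ [cw hz].
    move=> [_ [j [/and3P[hj aj hj2] _ _ _]]].
    (* The two events are disjoint: [Z] makes the current position a floor, whereas [later] asks for
       a strictly lower one. *)
    have [_ /(_ j)] := Zfloor (cyl_alive cw) hz.
    by have := cyl_height cw; rewrite lu /= size_cat => ->; lia.
rewrite /X {X}.
rewrite /later (prob_split (G := fun q' γ => popped_within Δ 𝒜 (min_base 𝒜 f m)
   (@zero_term R Q A) n (γ ++ α) (minn k (size α)) (q', obs_next 𝒜 (q, a) Y)) pu lu); first last.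
- move=> r hr hq v; rewrite -[(size u).+1](size_rcons u (r.2.1, r.2.2 ++ (α ++ β))).
  by apply: IH; rewrite ?last_rcons ?catA//; exact: (path_succ pu lu hr hq).
- by move=> w [j [/and3P[hj aj _] _ _ _]]; apply: alive_le aj; lia.
- exact: measurable_search.
rewrite /= mulrDr EFinD /rule_sum /=; congr (_ + _)%E.
rewrite /now; case: (size α < k)%N => /=; last by rewrite measure0 mulr0.
rewrite /min_base /= /obs_next /=; case: (C _); last by rewrite measure0 !mulr0.
by rewrite mulr1 (hZ pu lu).
Qed.

Hypothesis f0 : forall q Y, 0 <= f q Y.

Lemma prob_next u q Y β : path (step Δ) s u -> last s u = (q, Y :: β) ->
  P (cyl u `&` [set w | exists j, [/\ next_cand w (size u) j,
       C (seg_obs w (obs_init 𝒜) (size u).+1 j.+1) & Z j w]]) =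
  (weight u * next_min Δ 𝒜 f m q Y)%:E.
Proof.
move=> pu lu.
have mS i k b n a : measurable (search Z C i k b n a : set run_space).
  exact: measurable_search.
set G : set run_space := [set w | _].
have mG : measurable G by exact: measurable_next.
apply: (prob_split (G := fun q' γ => popped (pop_prob Δ 𝒜) (min_base 𝒜 f m)
   (@zero_term R Q A) γ (q', obs_init 𝒜)) pu lu) => //.
  by move=> w [j [[h aj _ _] _ _]]; apply: alive_le aj.
move=> r hr hq v.
have pv : path (step Δ) s v := path_succ pu lu hr hq.
have sv : size v = (size u).+1 by rewrite size_rcons.
have lv : last s v = (r.2.1, r.2.2 ++ β) by rewrite last_rcons.
(* The upper bound admits every symbol pushed by the rule; the lower bound [size β] keeps the stack
   below [Y] untouched. *)
pose F n : set run_space := cyl v `&`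
  search Z C (size v) (size r.2.2 + size β) (size β) n (obs_init 𝒜).
have mF n : measurable (F n) by apply: measurableI => //; exact: measurable_cyl.
have mU : measurable (\bigcup_n F n) by exact: bigcupT_measurable.
have ndF : nondecreasing_seq F.
  move=> i j ij; apply/subsetPset => w [cw [l [/and3P[h1 h2 h3] h4 h5 h6]]]; split => //.
  by exists l; split=> //; rewrite h2 h3; lia.
rewrite (_ : _ `&` _ = \bigcup_n F n).
  rewrite -(cvg_lim _ (nondecreasing_cvg_mu mF mU ndF))//.
  apply: cvg_lim => //.
  rewrite (_ : _ \o F = fun n => (weight v * popped_within Δ 𝒜 (min_base 𝒜 f m)
      (@zero_term R Q A) n r.2.2 (size r.2.2) (r.2.1, obs_init 𝒜))%:E); last first.
    by apply/funext => n; exact: prob_search.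
  apply: cvg_EFin; first exact: nearW.
  by apply: cvgMr; apply: popped_within_cvg => *; rewrite /min_base/zero_term ?mulr_ge0.
apply/seteqP; split => w.
  move=> [cw [j [[uj aj hj hl] hC hz]]]; exists j.+1 => //; split => //.
  have := cyl_height cw; rewrite lv size_cat => hv.
  have [cu _] := (cyl_rcons u (r.2.1, r.2.2 ++ β) w).1 cw.
  have hu := cyl_height cu; rewrite lu /= in hu.
  exists j; rewrite sv in hv *; split => //.
  (* Either the candidate is the first position after the rule, or it lies strictly below that one;
     the upper bound holds in both cases. *)
  have [e|ne] := eqVneq j (size u).+1; first by
    rewrite aj; move: hj; rewrite hu e hv => ->; rewrite !leqnn /=; lia.
  have hj' : (height w j < height w (size u).+1)%N by apply: hl; lia.
  by rewrite hu in hj; rewrite hv in hj'; rewrite aj hj (ltnW hj') /=; lia.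
move=> [n _ [cw [j [/and3P[h1 h2 h3] h4 h5 h6]]]]; split => //.
have [cu _] := (cyl_rcons u (r.2.1, r.2.2 ++ β) w).1 cw.
have hu := cyl_height cu; rewrite lu /= in hu; rewrite sv in h1 h4 h5.
exists j; split => //; split => //; first by lia.
  by rewrite hu; lia.
Qed.

End Search.

End Measure.
End Minima.

(** * Acceptance *)

Section ChainProbability.
Variables (R : realType) (Q Γ : finType) (Δ : ppda R Q Γ) (s : Q * seq Γ).
Variables (A : finType) (𝒜 : observer Q Γ A).
Variable P : {measure set (run_space Δ s) -> \bar R}.
Hypothesis hP : is_run_measure P.

Definition indic (C : pred A) (a : A) : R := (C a)%:R.

Lemma min_iter_seq_ge0 n (ms : nat -> A -> R) q Y : (forall k a, 0 <= ms k a) ->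
  0 <= min_iter Δ 𝒜 n ms q Y.
Proof.
elim: n ms q Y => [|n IH] ms q Y ms0; first exact: never_pop_ge0.
by apply: next_min_ge0 => // q' Y'; apply: IH.
Qed.

Lemma prob_chain n Cs u q Y β : path (step Δ) s u -> last s u = (q, Y :: β) ->
  P (@cylinder _ _ _ Δ s u `&` chain 𝒜 n Cs (size u)) =
  (weight Δ s u * min_iter Δ 𝒜 n (fun k => indic (Cs k)) q Y)%:E.
Proof.
elim: n Cs u q Y β => [|n IH] Cs u q Y β pu lu; first exact: prob_floor_pos lu.
apply: (@prob_next _ _ _ _ _ _ _ P (chain 𝒜 n (fun k => Cs k.+1)) (Cs 0%N)
  (min_iter Δ 𝒜 n (fun k => indic (Cs k.+1)))) lu => //.
- by move=> j; exact: measurable_chain.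
- by move=> j w; exact: chain_floor.
- by move=> v q' Y' β'; exact: IH.
- by move=> q' Y'; apply: min_iter_seq_ge0 => k a; exact: ler0n.
Qed.

End ChainProbability.

Section Acceptance.
Variables (R : realType) (Q Γ : finType) (Δ : ppda R Q Γ).
Variables (A : finType) (𝒜 : observer Q Γ A) (p : Q) (X : Γ).
Local Notation s := ((p, [:: X]) : Q * seq Γ).
Local Notation run_space := (run_space Δ s).
Implicit Types (w : run Δ s) (i j k l n : nat) (C : {set A}).

Lemma infinite_alive w : infinite_run w <-> forall i, alive w i.
Proof.
by split=> h i; have := h i; rewrite /alive; case: (sval w i).
Qed.

Lemma alive_nonempty w i : alive w i.+1 -> (0 < height w i)%N.
Proof.
move=> /step_conf; rewrite /height /step; case: (conf w i) => q [|Y β] //=.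
by case/hasP.
Qed.

(** Every link moves to a later position. Hence chains of all lengths exist only on infinite
    runs. *)
Lemma chain_alive n Cs i w : alive w i -> chain 𝒜 n Cs i w -> alive w (i + n).
Proof.
elim: n Cs i => [|n IH] Cs i; first by rewrite addn0.
move=> ai [j [[ij aj _ _] _ /(IH _ _ aj)]]; apply: alive_le; lia.
Qed.

Lemma chain_pred n Cs i w : alive w i -> chain 𝒜 n.+1 Cs i w -> chain 𝒜 n Cs i w.
Proof.
elim: n Cs i => [|n IH] Cs i ai; first exact: chain_floor.
move=> [j [hj hC h]]; exists j; split => //; apply: IH => //.
by case: hj.
Qed.

Lemma chain_le n n' Cs i w : (n <= n')%N -> alive w i -> chain 𝒜 n' Cs i w -> chain 𝒜 n Cs i w.
Proof.
elim: n' => [|n' IH]; first by rewrite leqn0 => /eqP->.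
by rewrite leq_eqVlt ltnS => /orP[/eqP->//|h ai /(chain_pred ai)]; exact: IH.
Qed.

Definition minima_before w i : nat := (\sum_(j < i) `[< is_min w j >])%N.

Lemma minima_beforeS w i : minima_before w i.+1 = (minima_before w i + `[< is_min w i >])%N.
Proof. by rewrite /minima_before big_ord_recr. Qed.

Lemma minima_before_le w i j : (i <= j)%N -> (minima_before w i <= minima_before w j)%N.
Proof.
elim: j => [|j IH]; first by rewrite leqn0 => /eqP->.
rewrite leq_eqVlt ltnS => /orP[/eqP->//|/IH h].
by rewrite minima_beforeS; lia.
Qed.

Lemma min_posE w i k : is_min w i -> minima_before w i = k -> min_pos w k = i.
Proof.
move=> mi ik; apply: xget_unique => //= j [mj jk].
have h i' j' : is_min w i' -> minima_before w i' = k -> minima_before w j' = k -> (j' <= i')%N.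
  move=> mi' e1 e2; rewrite leqNgt; apply/negP => /(minima_before_le w).
  by rewrite minima_beforeS e1 e2; case: asboolP => //; lia.
by apply/eqP; rewrite eqn_leq !h.
Qed.

Section InfiniteRun.
Variable w : run Δ s.
Hypothesis w_inf : forall i, alive w i.

Lemma is_min_floor i : is_min w i <-> floor_pos w i.
Proof. by split=> [h|[_ h] j ij]; [split => // j ij _; exact: h | exact: h]. Qed.

(** The witness is the first position after [i] that has the least height occurring after [i]. *)
Lemma next_min_exists i : floor_pos w i -> exists2 j, next_cand w i j & floor_pos w j.
Proof.
move=> [_ hi].
pose hp h := `[< exists2 l, (i < l)%N & height w l = h >].
have ex1 : exists h, hp h by exists (height w i.+1); apply/asboolP; exists i.+1.
case: (ex_minnP ex1) => h /asboolP[l0 il0 hl0] hmin.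
have low l : (i < l)%N -> (h <= height w l)%N.
  by move=> il; apply: hmin; apply/asboolP; exists l.
have ex2 : exists l, (i < l)%N && (height w l == h) by exists l0; rewrite il0 hl0 /=.
case: (ex_minnP ex2) => j /andP[ij /eqP jh] jmin.
exists j; last by split => // l jl _; rewrite jh low// (leq_trans ij).
split => //; first by apply: hi => //; exact: ltnW.
move=> l /andP[il lj]; rewrite jh ltn_neqAle low// andbT.
by apply/eqP => e; have := jmin l; rewrite il e eqxx; lia.
Qed.

Lemma min_pos_next i k j : is_min w i -> minima_before w i = k ->
  next_cand w i j -> floor_pos w j -> min_pos w k.+1 = j /\ minima_before w j = k.+1.
Proof.
move=> mi ik [ij _ _ hl] /is_min_floor mj.
suff e : minima_before w j = k.+1 by split => //; apply: min_posE.
have h1 : minima_before w i.+1 = k.+1.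
  by rewrite minima_beforeS ik; case: asboolP => // _; rewrite addn1.
have h n : (i.+1 <= n)%N -> (n <= j)%N -> minima_before w n = k.+1.
  elim: n => // n IH; rewrite leq_eqVlt => /orP[/eqP<- //|/ltnSE i_n nj].
  rewrite minima_beforeS IH ?(ltnW nj)//; case: asboolP => [hn|_]; rewrite ?addn0//.
  by have := hl n; have := hn j (ltnW nj); rewrite /height i_n nj; lia.
exact: h.
Qed.

Lemma min_pos_spec k :
  [/\ is_min w (min_pos w k), minima_before w (min_pos w k) = k &
      next_cand w (min_pos w k) (min_pos w k.+1)].
Proof.
have next i : is_min w i -> minima_before w i = k -> min_pos w k = i ->
  [/\ is_min w (min_pos w k), minima_before w (min_pos w k) = k &
      next_cand w (min_pos w k) (min_pos w k.+1)].
  move=> mi ik e; rewrite e; split => //.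
  have [j ij fj] := next_min_exists ((is_min_floor i).1 mi).
  by have [->] := min_pos_next mi ik ij fj.
elim: k next => [|k IH] next.
  (* The start configuration has one stack symbol, and no configuration of an infinite run has an
     empty stack. *)
  have m0 : is_min w 0.
    move=> j _; apply: leq_trans (alive_nonempty (w_inf j.+1)).
    by rewrite /conf (svalP w).1.
  have e0 : minima_before w 0 = 0%N by rewrite /minima_before big_ord0.
  by apply: next m0 e0 (min_posE m0 e0).
have [|mk bk nk] := IH.
  move=> i mi ik e; rewrite e; split => //.
  have [j ij fj] := next_min_exists ((is_min_floor i).1 mi).
  by have [->] := min_pos_next mi ik ij fj.
have [j ij fj] := next_min_exists ((is_min_floor _).1 mk).
have [e b] := min_pos_next mk bk ij fj.
by apply: next b e; exact/is_min_floor.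
Qed.

Lemma min_pos0 : min_pos w 0 = 0%N.
Proof.
have [_ h [hlt _ _ _]] := min_pos_spec 0.
have m0 : is_min w 0.
  move=> j _; apply: leq_trans (alive_nonempty (w_inf j.+1)).
  by rewrite /conf (svalP w).1.
by apply: min_posE => //; rewrite /minima_before big_ord0.
Qed.

Lemma obsE k : obs 𝒜 w k =
  seg_obs 𝒜 w (obs_init 𝒜) (min_pos w k).+1 (min_pos w k.+1).+1.
Proof. by rewrite /obs /heads_between /seg_obs subSS. Qed.

(** Candidates that are floors are unique, so chains of all lengths pass through the same positions,
    the minima. *)
Lemma chain_obs Cs :
  (forall n, chain 𝒜 n Cs 0 w) <-> (forall k, Cs k (obs 𝒜 w k)).
Proof.
have floor_min k : floor_pos w (min_pos w k) by apply/is_min_floor; have [] := min_pos_spec k.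
have shift k : (fun l => Cs (k + l.+1)%N) = (fun l => Cs (k.+1 + l)%N).
  by apply/funext => l; rewrite addnS.
split=> [h|h n].
  have {}h k n : chain 𝒜 n (fun l => Cs (k + l)%N) (min_pos w k) w /\ Cs k (obs 𝒜 w k).
    suff {n} hk n : chain 𝒜 n (fun l => Cs (k + l)%N) (min_pos w k) w.
      split; first exact: hk.
      have [_ _ nk] := min_pos_spec k.
      have [j [hj hC hc]] := hk 1%N.
      rewrite addn0 in hC; rewrite obsE.
      by rewrite (next_cand_uniq nk hj (floor_min _) hc).
    elim: k n => [|k IH] n; first by rewrite min_pos0.
    have [_ _ nk] := min_pos_spec k.
    have [j [hj hC hc]] := IH n.+1.
    rewrite (next_cand_uniq nk hj (floor_min _) (chain_floor _ hc))//.
    by rewrite -shift.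
  by move=> k; have [] := h k 0%N.
suff : forall k, chain 𝒜 n (fun l => Cs (k + l)%N) (min_pos w k) w.
  by move=> /(_ 0%N); rewrite min_pos0.
elim: n => [|n IH] k; first exact: floor_min.
exists (min_pos w k.+1); split => /=; first by have [] := min_pos_spec k.
  by rewrite addn0 -obsE; exact: h.
by rewrite shift; exact: IH.
Qed.

(** [A] is finite, so the last occurrences of the states outside [C] have a common bound. *)
Lemma inf_obs_sub C : inf_obs 𝒜 w \subset C <->
  exists k, forall i, (k <= i)%N -> obs 𝒜 w i \in C.
Proof.
split=> [h|[k hk]].
  have bound a : exists k, a \notin C -> forall i, (k <= i)%N -> obs 𝒜 w i != a.
    have [aC|aC] := boolP (a \in C); first by exists 0%N.
    have : a \notin inf_obs 𝒜 w by apply: contra aC => /(fintype.subsetP h).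
    rewrite inE => /asboolPn/existsNP[N hN]; exists N => _ i Ni.
    by apply/eqP => e; apply: hN; exists i.
  have [f hf] := choice bound.
  exists (\max_a f a)%N => i hi; apply: contraT => ni.
  have := hf _ ni i (leq_trans (leq_bigmax _) hi).
  by rewrite eqxx.
apply/fintype.subsetP => a; rewrite inE => /asboolP/(_ k)[i ki <-]; exact: hk.
Qed.

End InfiniteRun.

Definition from_on k C i : pred A := if (i < k)%N then fun=> true else fun a => a \in C.

Definition inf_within C : set run_space :=
  [set w | infinite_run w /\ inf_obs 𝒜 w \subset C].

(** The lengths start at k so that the events match the sequence in [reach_cvg]. *)
Definition obs_from k C : set run_space := \bigcap_n chain 𝒜 (k + n) (from_on k C) 0.

Lemma obs_fromE k C w : obs_from k C w <->
  infinite_run w /\ forall i, (k <= i)%N -> obs 𝒜 w i \in C.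
Proof.
have a0 := alive0 w.
have full : obs_from k C w <-> forall n, chain 𝒜 n (from_on k C) 0 w.
  by split=> h n; [apply: (chain_le (leq_addl k n) a0); exact: h | move=> _; exact: h].
rewrite full; split=> [h|[w_inf h]].
  have w_inf i : alive w i by have := chain_alive a0 (h i).
  split=> [|i ki]; first exact/infinite_alive.
  by move/(chain_obs w_inf) : h => /(_ i); rewrite /from_on ltnNge ki.
apply/(chain_obs ((infinite_alive w).1 w_inf)).
by move=> i; rewrite /from_on; case: ltnP => // /h.
Qed.

Lemma inf_within_bigcup C : inf_within C = \bigcup_k obs_from k C.
Proof.
apply/seteqP; split => w.
  move=> [w_inf /inf_obs_sub[k hk]].
  by exists k => //; apply/obs_fromE.
move=> [k _ /obs_fromE[w_inf hk]]; split => //.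
by apply/inf_obs_sub; exists k.
Qed.

Lemma measurable_obs_from k C : measurable (obs_from k C).
Proof. by apply: bigcapT_measurable => n; exact: measurable_chain. Qed.

Lemma measurable_inf_within C : measurable (inf_within C).
Proof.
by rewrite inf_within_bigcup; apply: bigcupT_measurable => k; exact: measurable_obs_from.
Qed.

Variable P : {measure set run_space -> \bar R}.
Hypothesis hP : is_run_measure P.

Local Notation ind C := (fun a => (a \in C)%:R : R).

Lemma prob_obs_from k C : P (obs_from k C) = (reach Δ 𝒜 (ind C) k p X)%:E.
Proof.
pose F n : set run_space := chain 𝒜 (k + n) (from_on k C) 0.
have mF n : measurable (F n) by exact: measurable_chain.
have niF : nonincreasing_seq F.
  move=> i j ij; apply/subsetPset => w; apply: chain_le; last exact: alive0.
  by rewrite leq_add2l.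
have fin : (P (F 0%N) < +oo)%E by apply: le_lt_trans (prob_le1 hP (mF _)) (ltry _).
rewrite -(cvg_lim _ (nonincreasing_cvg_mu fin mF (measurable_obs_from k C) niF))//.
apply: cvg_lim => //.
rewrite (_ : _ \o F = fun n => (min_iter Δ 𝒜 (k + n)
   (fun i => if (i < k)%N then fun=> 1 else ind C) p X)%:E).
  apply: cvg_EFin; first exact: nearW.
  by apply: reach_cvg => a; rewrite ?ler0n ?lern1 ?leq_b1.
apply/funext => n /=.
have := @prob_chain _ _ _ _ _ _ 𝒜 P hP (k + n) (from_on k C) [::] p X [::] isT erefl.
rewrite /weight big_ord0 mul1r (_ : _ `&` _ = F n); last first.
  apply/seteqP; split=> w; first by case.
  by split => // -[|i] //= _; rewrite (svalP w).1.
move=> ->; congr (min_iter _ _ _ _ _ _)%:E; apply/funext => i.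
by rewrite /indic /from_on; case: ifP.
Qed.

Lemma prob_inf_within C : P (inf_within C) = (eventually_stay Δ 𝒜 (ind C) p X)%:E.
Proof.
have nd : nondecreasing_seq (fun k => obs_from k C).
  move=> i j ij; apply/subsetPset => w /obs_fromE[w_inf h]; apply/obs_fromE; split => //.
  by move=> l jl; apply: h; exact: leq_trans jl.
have mU : measurable (\bigcup_k obs_from k C).
  by rewrite -inf_within_bigcup; exact: measurable_inf_within.
have h := nondecreasing_cvg_mu (mu := P) (fun k => measurable_obs_from k C) mU nd.
rewrite inf_within_bigcup -(cvg_lim _ h)//; apply: cvg_lim => //.
rewrite (_ : _ \o _ = fun k => (reach Δ 𝒜 (ind C) k p X)%:E).
  apply: cvg_EFin; first exact: nearW.
  by apply: eventually_stay_cvg => a; rewrite ?ler0n ?lern1 ?leq_b1.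
by apply/funext => k /=; exact: prob_obs_from.
Qed.

(* Inclusion-exclusion on the symbols that have to be observed infinitely often. *)
Fixpoint inf_prob (L : seq A) C : R :=
  if L is b :: L' then inf_prob L' (b |: C) - inf_prob L' C
  else eventually_stay Δ 𝒜 (ind C) p X.

(** Invariant of the recursion in [inf_prob]: states in [L] must recur, those in [C] may recur, all
    others may not. *)
Definition inf_between (L : seq A) C : set run_space :=
  [set w | [/\ infinite_run w, inf_obs 𝒜 w \subset C :|: [set:: L] &
              {subset L <= inf_obs 𝒜 w}]].

(** To demand b, allow it and subtract the runs that do without it. Since b is neither in [C] nor
    again in [L], the subtracted event really excludes it. *)
Lemma prob_inf_between L C : uniq L -> {in L, forall a, a \notin C} ->
  measurable (inf_between L C) /\ P (inf_between L C) = (inf_prob L C)%:E.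
Proof.
elim: L C => [|b L IH] C.
  move=> _ _; have -> : inf_between [::] C = inf_within C.
    apply/seteqP; split=> w; rewrite /inf_between /=.
      move=> [w_inf h _]; split => //; apply: fintype.subset_trans h _.
      by apply/fintype.subsetP => a; rewrite !inE orbF.
    by move=> [w_inf h]; split => //; apply: fintype.subset_trans h (finset.subsetUl _ _).
  by split; [exact: measurable_inf_within | exact: prob_inf_within].
move=> /= /andP[bL uL] hL.
have [a aL|m1 e1] := IH (b |: C) uL.
  rewrite !inE negb_or hL ?in_cons ?aL ?orbT// andbT.
  by apply: contraNneq bL => <-.
have [a aL|m2 e2] := IH C uL; first by apply: hL; rewrite in_cons aL orbT.
have bC : b \notin C by apply: hL; exact: mem_head.
have e : inf_between (b :: L) C = inf_between L (b |: C) `\` inf_between L C.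
  apply/seteqP; split=> w.
    move=> [w_inf h1 h2]; split.
      split => //; last by move=> a aL; apply: h2; rewrite in_cons aL orbT.
      apply: fintype.subset_trans h1 _; apply/fintype.subsetP => a.
      by rewrite !inE => /or3P[] ->; rewrite ?orbT.
    move=> [_ h3 _]; have := h2 b (mem_head _ _) => /(fintype.subsetP h3).
    by rewrite !inE (negbTE bC) (negbTE bL).
  move=> [[w_inf h1 h2] h3]; split => //.
    apply: fintype.subset_trans h1 _; apply/fintype.subsetP => a.
    by rewrite !inE -orbA => /or3P[] ->; rewrite ?orbT.
  move=> a; rewrite in_cons => /orP[/eqP->|]; last exact: h2.
  apply: contraT => nb; case: h3; split => //.
  apply/fintype.subsetP => c hc; have := fintype.subsetP h1 c hc.
  rewrite !inE; case: eqP => //= cb; first by move: nb; rewrite -cb hc.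
split; first by rewrite e; exact: measurableD.
rewrite e; have -> : P (inf_between L (b |: C) `\` inf_between L C) =
  (P (inf_between L (b |: C)) - P (inf_between L (b |: C) `&` inf_between L C))%E.
  by apply: measureD => //; apply: le_lt_trans (prob_le1 hP m1) (ltry _).
have -> : inf_between L (b |: C) `&` inf_between L C = inf_between L C.
  apply/seteqP; split=> w; first by case.
  move=> [w_inf h1 h2]; split => //; split => //.
  by apply: fintype.subset_trans h1 _; apply: finset.setSU; exact: finset.subsetUr.
by rewrite e1 e2.
Qed.

(** With [L] listing B and [C] empty, the set of recurring observations is exactly B, so the events
    for different B are disjoint. *)
Lemma prob_accepting : P (accepting Δ 𝒜 s) =
  (\sum_(B <- enum (obs_acc 𝒜)) inf_prob (enum B) finset.set0)%:E.
Proof.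
rewrite (@measure_list_cover _ _ _ P _ (enum (obs_acc 𝒜))
  (fun B => inf_between (enum B) finset.set0)).
- rewrite -sumEFin; apply: eq_bigr => B _.
  by have [] := @prob_inf_between (enum B) finset.set0 (enum_uniq _) _ => // a; rewrite inE.
- exact: enum_uniq.
- move=> B _; have [] // := @prob_inf_between (enum B) finset.set0 (enum_uniq _) _.
  by move=> a; rewrite inE.
- move=> B B' w _ _ [_ h1 h2] [_ h3 h4]; apply/setP => a.
  apply/idP/idP => aB.
    have := fintype.subsetP h3 a (h2 a _); rewrite !inE !mem_enum /=; exact.
  have := fintype.subsetP h1 a (h4 a _); rewrite !inE !mem_enum /=; exact.
- move=> w; split=> [[w_inf hacc]|[B]].
    exists (inf_obs 𝒜 w); first by rewrite mem_enum.
    split => //; last by move=> a; rewrite mem_enum.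
    by apply/fintype.subsetP => a ha; rewrite !inE mem_enum.
  rewrite mem_enum => hB [w_inf h1 h2]; split => //.
  suff -> : inf_obs 𝒜 w = B by [].
  apply/setP => a; apply/idP/idP => [/(fintype.subsetP h1)|aB].
    by rewrite !inE mem_enum.
  by apply: h2; rewrite mem_enum.
Qed.

End Acceptance.

(** * The formula *)

(* Variables are named by lists of numbers; the answer is the variable [::]. *)
Definition nm (l : seq nat) : nat := CodeSeq.code l.
Arguments nm l : simpl never.
Definition V (l : seq nat) : fo_term := TVar (nm l).
Definition rk (T : finType) (x : T) : nat := enum_rank x.

Notation Ans := (V [::]).
Notation Zero := (V [:: 0%N]).
Notation One := (V [:: 1%N]).
Notation Tmp1 := (V [:: 2%N]).
Notation Tmp2 := (V [:: 3%N]).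

Lemma nm_inj : injective nm.
Proof. exact: can_inj CodeSeq.codeK. Qed.

Lemma rk_inj (T : finType) : injective (@rk T).
Proof. by move=> x y /val_inj/enum_rank_inj. Qed.

Definition sum_term (T : Type) (l : seq T) (f : T -> fo_term) : fo_term :=
  foldr (fun x acc => TAdd (f x) acc) Zero l.

Definition big_and (T : Type) (l : seq T) (f : T -> fo) : fo :=
  foldr (fun x acc => FAnd (f x) acc) (FEq Zero Zero) l.

Definition ex_block (T : Type) (f : T -> seq nat) (l : seq T) (φ : fo) : fo :=
  foldr (fun x acc => FEx (nm (f x)) acc) φ l.

Definition all_block (T : Type) (f : T -> seq nat) (l : seq T) (φ : fo) : fo :=
  foldr (fun x acc => FAll (nm (f x)) acc) φ l.

Section Blocks.
Variable R : realType.
Implicit Type e : nat -> R.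

Definition off (T : eqType) (f : T -> seq nat) (l : seq T) e e' : Prop :=
  forall n, (forall x, x \in l -> n <> nm (f x)) -> e' n = e n.

Lemma off_cons (T : eqType) (f : T -> seq nat) x l e e' :
  off f (x :: l) e e' -> off f l (env_upd e (nm (f x)) (e' (nm (f x)))) e'.
Proof.
move=> h n hn; rewrite /env_upd; case: eqVneq => [->//|ne]; apply: h => y.
by rewrite in_cons => /orP[/eqP-> /eqP|/hn//]; rewrite (negbTE ne).
Qed.

Lemma cons_off (T : eqType) (f : T -> seq nat) x l e e' v :
  off f l (env_upd e (nm (f x)) v) e' -> off f (x :: l) e e'.
Proof.
move=> h n hn; rewrite h => [|y yl]; last by apply: hn; rewrite in_cons yl orbT.
by rewrite /env_upd; case: eqP => // nx; case: (hn x (mem_head _ _)).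
Qed.

Lemma sat_ex_block (T : eqType) (f : T -> seq nat) (l : seq T) φ e :
  fo_sat e (ex_block f l φ) <-> exists2 e', off f l e e' & fo_sat e' φ.
Proof.
elim: l e => [|x l IH] e /=.
  split=> [h|[e' h]]; first by exists e.
  by rewrite (_ : e' = e)//; apply/funext => n; exact: h.
split=> [[v /IH[e' h1 h2]]|[e' h1 h2]].
  by exists e' => //; exact: cons_off h1.
by exists (e' (nm (f x))); apply/IH; exists e' => //; exact: off_cons.
Qed.

Lemma sat_all_block (T : eqType) (f : T -> seq nat) (l : seq T) φ e :
  fo_sat e (all_block f l φ) <-> forall e', off f l e e' -> fo_sat e' φ.
Proof.
elim: l e => [|x l IH] e /=.
  split=> [h e' h'|h]; last exact: h.
  by rewrite (_ : e' = e)//; apply/funext => n; exact: h'.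
split=> [h e' h'|h v].
  by move/IH: (h (e' (nm (f x)))); apply; exact: off_cons.
by apply/IH => e' h'; apply: h; exact: cons_off h'.
Qed.

(** Stores a function on [T] in a block of variables: the index is recovered from the variable by
    choice. This instantiates a block quantifier with an arbitrary candidate. *)
Definition upd_block (T : eqType) (f : T -> seq nat) (v : T -> R) e n : R :=
  if pselect (exists x, nm (f x) = n) is left h then v (projT1 (cid h)) else e n.

Lemma upd_block_in (T : eqType) (f : T -> seq nat) v e x : injective f ->
  upd_block f v e (nm (f x)) = v x.
Proof.
move=> fi; rewrite /upd_block; case: pselect => [h|[]]; last by exists x.
by case: cid => y /= /nm_inj/fi->.
Qed.

Lemma upd_block_out (T : eqType) (f : T -> seq nat) v e l : (forall x, f x <> l) ->
  upd_block f v e (nm l) = e (nm l).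
Proof.
move=> h; rewrite /upd_block; case: pselect => // hx; exfalso.
by case: hx => x /nm_inj; exact: h.
Qed.

Lemma upd_block_off (T : eqType) (f : T -> seq nat) v e (l : seq T) :
  (forall x, x \in l) -> off f l e (upd_block f v e).
Proof.
move=> hl n hn; rewrite /upd_block; case: pselect => // hx; exfalso.
by case: hx => x xn; case: (hn x (hl x)).
Qed.

Lemma sat_big_and (T : eqType) (l : seq T) f e : fo_sat e (big_and l f) <->
  forall x, x \in l -> fo_sat e (f x).
Proof.
elim: l => [|x l IH] /=; first by split.
split=> [[h1 /IH h2] y|h].
  by rewrite in_cons => /orP[/eqP->|/h2].
split; first exact/h/mem_head.
by apply/IH => y yl; apply: h; rewrite in_cons yl orbT.
Qed.

Lemma eval_sum (T : Type) (l : seq T) f e : e (nm [:: 0%N]) = 0 ->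
  fo_eval e (sum_term l f) = \sum_(x <- l) fo_eval e (f x).
Proof.
move=> e0; elim: l => [|x l IH] /=; first by rewrite big_nil.
by rewrite big_cons IH.
Qed.

End Blocks.

Section Builder.
Variables (Q Γ A : finType) (𝒜 : observer Q Γ A).
Variables (rl : seq (rule Q Γ)) (pf : rule Q Γ -> fo) (p : Q) (X : Γ).
Local Notation S := (Q * A)%type.
Implicit Types (s t : S) (q : Q) (Y : Γ) (a b : A) (α β γ : seq Γ) (r : rule Q Γ).

Definition states : seq S := [seq (q, a) | q <- enum Q, a <- enum A].
Definition heads : seq (Q * Γ) := [seq (q, Y) | q <- enum Q, Y <- enum Γ].
Definition state_tops : seq (S * Γ) := [seq (s, Y) | s <- states, Y <- enum Γ].
Definition triples : seq (S * Γ * S) := [seq (sY, t) | sY <- state_tops, t <- states].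

(** The first entry of a name is a tag: 0 and 1 for the constants, 2 and 3 for scratch variables, 4
    for rule probabilities, 5 for the indicator of C, 6 for popping probabilities, 7 for competing
    solutions, 8 for g and 9 for h. *)
Definition pop_name (tag : nat) (k : S * Γ * S) : seq nat :=
  [:: tag; rk k.1.1.1; rk k.1.1.2; rk k.1.2; rk k.2.1; rk k.2.2].
Definition head_name (tag : nat) (h : Q * Γ) : seq nat := [:: tag; rk h.1; rk h.2].
Definition obs_name a : seq nat := [:: 5; rk a].
Definition rule_name r : seq nat :=
  4%N :: rk r.1.1 :: rk r.1.2 :: rk r.2.1 :: [seq rk Y | Y <- r.2.2].

Fixpoint popped_term (tag : nat) (base : S -> Γ -> fo_term) (term : S -> fo_term)
    (α : seq Γ) s : fo_term :=
  if α is Y :: β then TAdd (base s Y) (sum_term states (fun t =>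
    TMul (V (pop_name tag (s, Y, t))) (popped_term tag base term β t)))
  else term s.

Definition rules_term (h : Q * Γ) (F : rule Q Γ -> fo_term) : fo_term :=
  foldr (fun r acc => if r.1 == h then TAdd (TMul (V (rule_name r)) (F r)) acc else acc)
    Zero rl.

Definition pop_rhs (tag : nat) (k : S * Γ * S) : fo_term :=
  rules_term (k.1.1.1, k.1.2) (fun r =>
    popped_term tag (fun _ _ => Zero) (fun s => if s == k.2 then One else Zero)
      r.2.2 (r.2.1, obs_next 𝒜 k.1.1 k.1.2)).

(** Inequalities suffice: their least nonnegative solution is [pop_prob], which satisfies the
    equations. *)
Definition pop_solution (tag : nat) : fo :=
  big_and triples (fun k => FAnd (FLe Zero (V (pop_name tag k)))
                              (FLe (pop_rhs tag k) (V (pop_name tag k)))).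

Definition next_min_term (tag : nat) (c : bool) (h : Q * Γ) : fo_term :=
  rules_term h (fun r => popped_term 6
    (fun s Y => TMul (V (head_name tag (s.1, Y)))
                     (if c then V (obs_name (obs_next 𝒜 s Y)) else One))
    (fun=> Zero) r.2.2 (r.2.1, obs_init 𝒜)).

(** Terms have no subtraction, so g <= [never_pop] is written with the popping probabilities added
    on the left. *)
Definition stay_cond : fo :=
  big_and heads (fun h => FAnd
    (FLe (TAdd (V (head_name 8 h))
       (sum_term states (fun t => V (pop_name 6 (h.1, obs_init 𝒜, h.2, t))))) One)
    (FLe (V (head_name 8 h)) (next_min_term 8 true h))).

Definition bound_cond : fo :=
  FAnd (all_block (head_name 8) heads (FImp stay_cond
         (big_and heads (fun h => FLe (V (head_name 8 h)) (V (head_name 9 h))))))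
       (big_and heads (fun h => FLe (next_min_term 9 false h) (V (head_name 9 h)))).

(** [Ans] is the minimum of h(pX) over all bounds h. One bound is least at every head, so the
    minimum is the value of [eventually_stay] at pX. *)
Definition eventually_fo : fo :=
  FAnd (ex_block (head_name 9) heads
         (FAnd bound_cond (FEq (V (head_name 9 (p, X))) Ans)))
       (all_block (head_name 9) heads
         (FImp bound_cond (FLe Ans (V (head_name 9 (p, X)))))).

(** Substitution by rebinding: every subformula speaks of its value as [Ans], which is here made
    equal to the scratch variable. *)
Definition at_tmp1 (φ : fo) : fo := FEx (nm [::]) (FAnd (FEq Ans Tmp1) φ).
Definition at_tmp2 (φ : fo) : fo := FEx (nm [::]) (FAnd (FEq Ans Tmp2) φ).
Definition ex_tmp (φ : fo) : fo := FEx (nm [:: 2%N]) (FEx (nm [:: 3%N]) φ).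

(** C is never written down: it is the set of a whose variable [obs_name a] has value 1, and each
    level sets one of these variables to 1 or 0. *)
Definition inf_fo (L : seq A) : fo :=
  foldr (fun b acc => ex_tmp (FAnd
      (FEx (nm (obs_name b)) (FAnd (FEq (V (obs_name b)) One) (at_tmp1 acc)))
      (FAnd (FEx (nm (obs_name b)) (FAnd (FEq (V (obs_name b)) Zero) (at_tmp2 acc)))
            (FEq (TAdd Ans Tmp2) Tmp1)))) eventually_fo L.

Definition acc_fo (Bs : seq (seq A)) : fo :=
  foldr (fun B acc => ex_tmp (FAnd (at_tmp1 (inf_fo B)) (FAnd (at_tmp2 acc)
      (FEq Ans (TAdd Tmp1 Tmp2))))) (FEq Ans Zero) Bs.

(** 0 is the only real with x + x = x, and 1 the only nonzero real with x * x = x. *)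
Definition const_cond : fo :=
  FAnd (FEq (TAdd Zero Zero) Zero) (FAnd (FEq (TMul One One) One) (FNot (FEq One Zero))).

Definition rule_cond : fo :=
  big_and rl (fun r => FEx (nm [::]) (FAnd (pf r) (FEq Ans (V (rule_name r))))).

Definition pop_least : fo :=
  all_block (pop_name 7) triples (FImp (pop_solution 7)
    (big_and triples (fun k => FLe (V (pop_name 6 k)) (V (pop_name 7 k))))).

Definition body : fo :=
  FAnd const_cond (FAnd rule_cond (FAnd (pop_solution 6) (FAnd pop_least
   (FAnd (big_and (enum A) (fun a => FEq (V (obs_name a)) Zero))
     (acc_fo [seq enum B | B : {set A} <- enum (obs_acc 𝒜)]))))).

(** Includes the names that [body] binds itself. Every variable other than 0 is then bound by the
    outer block, and closedness can be checked without following scopes. *)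
Definition all_names : seq (seq nat) :=
  [:: [:: 0%N]; [:: 1%N]; [:: 2%N]; [:: 3%N]] ++
  [seq rule_name r | r <- rl] ++ [seq obs_name a | a <- enum A] ++
  [seq pop_name 6 k | k <- triples] ++ [seq pop_name 7 k | k <- triples] ++
  [seq head_name 8 h | h <- heads] ++ [seq head_name 9 h | h <- heads].

Definition main_fo : fo := ex_block id all_names body.

Lemma mem_states s : s \in states.
Proof. by case: s => q a; apply: allpairs_f; rewrite mem_enum. Qed.

Lemma mem_heads h : h \in heads.
Proof. by case: h => q Y; apply: allpairs_f; rewrite mem_enum. Qed.

Lemma mem_triples k : k \in triples.
Proof.
case: k => [[s Y] t]; apply: allpairs_f; last exact: mem_states.
by apply: allpairs_f; rewrite ?mem_states ?mem_enum.
Qed.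

Lemma pop_name_inj tag : injective (pop_name tag).
Proof.
move=> [[[q a] Y] [r b]] [[[q' a'] Y'] [r' b']] [] /=.
by move=> /rk_inj-> /rk_inj-> /rk_inj-> /rk_inj-> /rk_inj->.
Qed.

Lemma head_name_inj tag : injective (head_name tag).
Proof. by move=> [q Y] [q' Y'] [] /rk_inj-> /rk_inj->. Qed.

Lemma obs_name_inj : injective obs_name.
Proof. by move=> a b [] /rk_inj. Qed.

Lemma rule_name_inj : injective rule_name.
Proof.
move=> [[q Y] [t α]] [[q' Y'] [t' α']] [] /= /rk_inj-> /rk_inj-> /rk_inj->.
by move=> /(inj_map (@rk_inj _))->.
Qed.

Lemma sum_states (R : realType) (F : S -> R) : \sum_(t <- states) F t = \sum_t F t.
Proof.
rewrite /states big_allpairs_dep big_enum /=.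
under eq_bigr do rewrite big_enum /=.
by rewrite pair_big /=; apply: eq_bigr => -[].
Qed.

End Builder.

(** * Truth of the formula in the reals *)

Section Semantics.
Variables (R : realType) (Q Γ A : finType) (Δ : ppda R Q Γ) (𝒜 : observer Q Γ A).
Variables (pf : rule Q Γ -> fo) (p : Q) (X : Γ).
Hypothesis hpf : presents Δ pf.
Local Notation S := (Q * A)%type.
Local Notation rl := (enum_fset (rules Δ)).
Implicit Types (e : nat -> R) (s t : S) (q : Q) (Y : Γ) (a b : A) (α : seq Γ).
Implicit Types (T : seq nat) (C : {set A}) (x : S -> Γ -> S -> R).

Local Notation zero_base := (@zero_base R Q Γ A).
Local Notation zero_term := (@zero_term R Q A).
Local Notation delta := (@delta R Q A).
Local Notation ind C := (fun a => (a \in C)%:R : R).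

(* The answer variable [::] gets the spare tag 100. *)
Definition name_tag (l : seq nat) : nat := head 100 l.

(** A block quantifier changes variables of one tag only, so what survives under it is decided by
    comparing tags. *)
Definition agree T e e' : Prop :=
  forall l, name_tag l \notin T -> e' (nm l) = e (nm l).

Lemma agree_trans T e e' e'' : agree T e e' -> agree T e' e'' -> agree T e e''.
Proof. by move=> h h' l hl; rewrite h' ?h. Qed.

Lemma agree_sub T T' e e' : {subset T <= T'} -> agree T e e' -> agree T' e e'.
Proof. by move=> TT h l hl; apply: h; apply: contra hl; exact: TT. Qed.

Lemma env_upd_agree e l v : agree [:: name_tag l] e (env_upd e (nm l) v).
Proof.
move=> l' hl; rewrite /env_upd; case: eqP => // /nm_inj e'.
by move: hl; rewrite e' mem_head.
Qed.

Lemma env_updE e l v : env_upd e (nm l) v (nm l) = v.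
Proof. by rewrite /env_upd eqxx. Qed.

Lemma off_agree (I : eqType) (f : I -> seq nat) (l : seq I) k e e' :
  (forall i, name_tag (f i) = k) -> off f l e e' -> agree [:: k] e e'.
Proof.
move=> fk h l' hl; apply: h => i _ /nm_inj e1.
by move: hl; rewrite e1 fk mem_head.
Qed.

Lemma upd_block_agree (I : eqType) (f : I -> seq nat) k v e :
  (forall i, name_tag (f i) = k) -> agree [:: k] e (upd_block f v e).
Proof.
move=> fk l hl; apply: upd_block_out => i e1.
by move: hl; rewrite -e1 fk mem_head.
Qed.

Definition pop_val (k : nat) e s Y t : R := e (nm (pop_name k (s, Y, t))).
Definition head_val (k : nat) e q Y : R := e (nm (head_name k (q, Y))).
Definition obs_val e a : R := e (nm (obs_name a)).

Definition ctx e : Prop :=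
  [/\ e (nm [:: 0%N]) = 0, e (nm [:: 1%N]) = 1 &
      forall r, r \in rl -> e (nm (rule_name r)) = prob Δ r].

Lemma ctx_agree T e e' : agree T e e' -> all (fun k => k \notin T) [:: 0%N; 1%N; 4%N] ->
  ctx e -> ctx e'.
Proof.
move=> h /= /and4P[h0 h1 h4 _] [e0 e1 e4]; split; rewrite ?h//.
by move=> r /e4 <-; exact: h.
Qed.

Lemma eval_popped k base term α s e : e (nm [:: 0%N]) = 0 ->
  fo_eval e (popped_term k base term α s) =
  popped (pop_val k e) (fun s Y => fo_eval e (base s Y)) (fun s => fo_eval e (term s)) α s.
Proof.
move=> e0; elim: α s => [|Y α IH] s //=; rewrite eval_sum// sum_states.
by congr (_ + _); apply: eq_bigr => t _ /=; rewrite IH.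
Qed.

Lemma eval_rules h F e : ctx e -> fo_eval e (rules_term rl h F) =
  \sum_(r <- rl | r.1 == h) prob Δ r * fo_eval e (F r).
Proof.
move=> [e0 _ e4]; suff H (l : seq (rule Q Γ)) : {subset l <= rl} -> fo_eval e (rules_term l h F) =
    \sum_(r <- l | r.1 == h) prob Δ r * fo_eval e (F r) by exact: H.
elim: l => [|r l IH] hl; first by rewrite big_nil.
rewrite /rules_term /= -/(rules_term l h F) big_cons.
have {}IH := IH (fun r' hr' => hl r' (mem_behead (s := r :: l) hr')).
by case: ifP => //= _; rewrite IH e4// hl ?mem_head.
Qed.

Definition pop_solves x : Prop := forall s Y t, 0 <= x s Y t /\
  rule_sum Δ 𝒜 s Y (fun s' γ => popped x zero_base (delta t) γ s') <= x s Y t.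

Lemma sat_pop_solution k e : ctx e ->
  fo_sat e (pop_solution 𝒜 rl k) <-> pop_solves (pop_val k e).
Proof.
move=> ce; have [e0 e1 _] := ce.
have rhs s Y t : fo_eval e (pop_rhs 𝒜 rl k (s, Y, t)) =
    rule_sum Δ 𝒜 s Y (fun s' γ => popped (pop_val k e) zero_base (delta t) γ s').
  rewrite /pop_rhs eval_rules// /rule_sum; apply: eq_bigr => r _.
  rewrite eval_popped//; congr (_ * popped _ _ _ _ _); apply/funext => u.
    by apply/funext => Z; exact: e0.
  by rewrite /delta /=; case: eqP.
rewrite /pop_solution sat_big_and; split=> [h s Y t|h [[s Y] t] _].
  have [h1 h2] := h _ (mem_triples (s, Y, t)).
  by split; [rewrite -e0; exact: h1 | rewrite -rhs; exact: h2].
have [h1 h2] := h s Y t; split; first by rewrite /= e0; exact: h1.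
by rewrite -rhs in h2; exact: h2.
Qed.

Lemma pop_prob_solves : pop_solves (pop_prob Δ 𝒜).
Proof. by move=> s Y t; rewrite pop_prob_ge0 -pop_prob_fix. Qed.

Lemma sat_pop_least e : ctx e -> fo_sat e (pop_least 𝒜 rl) <->
  forall x, pop_solves x -> forall s Y t, pop_val 6 e s Y t <= x s Y t.
Proof.
move=> ce; rewrite /pop_least sat_all_block; split=> [h x hx s Y t|h e' h'].
  pose f := @pop_name Q Γ A 7; pose e' := upd_block f (fun k => x k.1.1 k.1.2 k.2) e.
  have ag : agree [:: 7%N] e e' by apply: upd_block_agree.
  have ke : pop_val 7 e' = x.
    apply/funext => s'; apply/funext => Y'; apply/funext => t'.
    by rewrite /pop_val /e' upd_block_in//; exact: pop_name_inj.
  have ce' : ctx e' by apply: ctx_agree ce; first exact: ag.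
  have := h e' (upd_block_off _ _ (@mem_triples _ _ _)) => /= {}h.
  have /h : fo_sat e' (pop_solution 𝒜 rl 7) by apply/sat_pop_solution; rewrite ?ke.
  move=> /sat_big_and/(_ _ (mem_triples (s, Y, t))) /=.
  by rewrite ag// -[e' _]/(pop_val 7 e' s Y t) ke.
have ag : agree [:: 7%N] e e' by apply: off_agree h'.
have ce' : ctx e' by apply: ctx_agree ce; first exact: ag.
move=> /= /(sat_pop_solution _ ce')/h {}h; apply/sat_big_and => -[[s Y] t] _ /=.
by rewrite ag//; exact: h.
Qed.

Definition pop_ctx e : Prop := ctx e /\ pop_val 6 e = pop_prob Δ 𝒜.

Lemma sat_pop_prob e : ctx e ->
  fo_sat e (pop_solution 𝒜 rl 6) /\ fo_sat e (pop_least 𝒜 rl) <->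
  pop_val 6 e = pop_prob Δ 𝒜.
Proof.
move=> ce; rewrite sat_pop_solution// sat_pop_least//; split=> [[h1 h2]|->].
  apply/funext => s; apply/funext => Y; apply/funext => t; apply/eqP.
  rewrite eq_le (h2 _ pop_prob_solves) /=.
  by apply: pop_prob_least => s' Y' t'; have [] := h1 s' Y' t'.
split; first exact: pop_prob_solves.
by move=> x hx s Y t; apply: pop_prob_least => s' Y' t'; have [] := hx s' Y' t'.
Qed.

Lemma pop_ctx_agree T e e' : agree T e e' ->
  all (fun k => k \notin T) [:: 0%N; 1%N; 4%N; 6%N] -> pop_ctx e -> pop_ctx e'.
Proof.
move=> h /= /and5P[h0 h1 h4 h6 _] [ce ke]; split.
  by apply: ctx_agree ce; [exact: h | rewrite /= h0 h1 h4].
by rewrite -ke; apply/funext => s; apply/funext => Y; apply/funext => t; exact: h.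
Qed.

Lemma eval_next_min k (c : bool) q Y e : pop_ctx e ->
  fo_eval e (next_min_term 𝒜 rl k c (q, Y)) =
  next_min Δ 𝒜 (head_val k e) (if c then obs_val e else fun=> 1) q Y.
Proof.
move=> [ce ke]; have [e0 e1 _] := ce.
rewrite /next_min_term eval_rules// /next_min; apply: eq_bigr => r _.
rewrite eval_popped// ke; congr (_ * popped _ _ _ _ _); apply/funext => u; last exact: e0.
by apply/funext => Z; rewrite /min_base; case: c => //=; rewrite e1.
Qed.

Lemma sat_stay_cond e : pop_ctx e -> fo_sat e (stay_cond 𝒜 rl) <->
  (forall q Y, head_val 8 e q Y <= never_pop Δ 𝒜 q Y) /\
  (forall q Y, head_val 8 e q Y <= next_min Δ 𝒜 (head_val 8 e) (obs_val e) q Y).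
Proof.
move=> pe; have [[e0 e1 _] ke] := pe.
have npE q Y : (fo_eval e (TAdd (V (head_name 8 (q, Y)))
    (sum_term (states Q A) (fun t => V (pop_name 6 ((q, obs_init 𝒜), Y, t))))) <= 1) =
    (head_val 8 e q Y <= never_pop Δ 𝒜 q Y).
  by rewrite /= eval_sum// sum_states /never_pop -ke lerBrDr.
rewrite /stay_cond sat_big_and; split=> [h|[h1 h2] [q Y] _].
  split=> q Y; have [] := h _ (mem_heads (q, Y)).
    by rewrite -npE -e1.
  by move=> _ h2; rewrite -(eval_next_min 8 true q Y pe).
split; first by have := h1 q Y; rewrite -npE -e1.
by have := h2 q Y; rewrite -(eval_next_min 8 true q Y pe).
Qed.

Lemma sat_bound_cond e : pop_ctx e -> fo_sat e (bound_cond 𝒜 rl) <->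
  eventually_bound Δ 𝒜 (obs_val e) (head_val 9 e).
Proof.
move=> pe; rewrite /bound_cond /eventually_bound.
have and_iff (B1 B2 C1 C2 : Prop) : (B1 <-> C1) -> (B2 <-> C2) -> (B1 /\ B2 <-> C1 /\ C2).
  by tauto.
apply: (and_iff (fo_sat e (all_block _ _ _)) (fo_sat e (big_and _ _))).
- rewrite sat_all_block; split=> [h g h1 h2 q Y|h e' off'].
    pose e' := upd_block (@head_name Q Γ 8) (fun h => g h.1 h.2) e.
    have ag : agree [:: 8%N] e e' by apply: upd_block_agree.
    have ge : head_val 8 e' = g.
      apply/funext => q'; apply/funext => Y'.
      by rewrite /head_val /e' upd_block_in//; exact: head_name_inj.
    have oe : obs_val e' = obs_val e by apply/funext => a; exact: ag.
    have pe' : pop_ctx e' by apply: pop_ctx_agree pe; first exact: ag.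
    have := h e' (upd_block_off _ _ (@mem_heads _ _)) => /= {}h.
    have /h : fo_sat e' (stay_cond 𝒜 rl) by apply/sat_stay_cond; rewrite ?ge ?oe.
    move=> /sat_big_and/(_ _ (mem_heads (q, Y))) /=.
    by rewrite (ag (head_name 9 (q, Y)))// -[e' _]/(head_val 8 e' q Y) ge.
  have ag : agree [:: 8%N] e e' by apply: off_agree off'.
  have pe' : pop_ctx e' by apply: pop_ctx_agree pe; first exact: ag.
  have oe : obs_val e' = obs_val e by apply/funext => a; exact: ag.
  move=> /= /(sat_stay_cond pe')[]; rewrite oe => h1 h2; apply/sat_big_and => -[q Y] _ /=.
  by rewrite (ag (head_name 9 (q, Y)))//; exact: (h (head_val 8 e') h1 h2 q Y).
- rewrite sat_big_and; split=> [h q Y|h [q Y] _].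
    by have := h _ (mem_heads (q, Y)); rewrite -(eval_next_min 9 false q Y pe).
  by have := h q Y; rewrite -(eval_next_min 9 false q Y pe).
Qed.

Lemma ind_ge0 C a : 0 <= ind C a. Proof. exact: ler0n. Qed.
Lemma ind_le1 C a : ind C a <= 1. Proof. by rewrite lern1 leq_b1. Qed.

Lemma sat_eventually e C : pop_ctx e -> obs_val e = ind C ->
  fo_sat e (eventually_fo 𝒜 rl p X) <->
  e (nm [::]) = eventually_stay Δ 𝒜 (ind C) p X.
Proof.
move=> pe oe; pose f := @head_name Q Γ 9.
have key e' : agree [:: 9%N] e e' -> pop_ctx e' /\
    (fo_sat e' (bound_cond 𝒜 rl) <-> eventually_bound Δ 𝒜 (ind C) (head_val 9 e')).
  move=> ag; have pe' : pop_ctx e' by apply: pop_ctx_agree pe; first exact: ag.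
  split => //; rewrite sat_bound_cond// (_ : obs_val e' = ind C)// -oe.
  by apply/funext => a; exact: ag.
pose e1 := upd_block f (fun h => eventually_stay Δ 𝒜 (ind C) h.1 h.2) e.
have ag1 : agree [:: 9%N] e e1 by apply: upd_block_agree.
have off1 : off f (heads Q Γ) e e1 by apply: upd_block_off; exact: mem_heads.
have he1 : head_val 9 e1 = eventually_stay Δ 𝒜 (ind C).
  apply/funext => q'; apply/funext => Y'.
  by rewrite /head_val /e1 upd_block_in//; exact: head_name_inj.
have b1 : fo_sat e1 (bound_cond 𝒜 rl).
  apply/(key _ ag1).2; rewrite he1.
  by apply: eventually_stay_bound; [exact: ind_ge0 | exact: ind_le1].
have least e' : agree [:: 9%N] e e' -> fo_sat e' (bound_cond 𝒜 rl) ->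
    eventually_stay Δ 𝒜 (ind C) p X <= head_val 9 e' p X.
  move=> ag /(key _ ag).2; move/eventually_bound_least.
  by apply; [exact: ind_ge0 | exact: ind_le1].
rewrite /eventually_fo; split.
  move=> [/sat_ex_block[e2 off2 [b2 eq2]] /sat_all_block h].
  have ag2 : agree [:: 9%N] e e2 by apply: off_agree off2.
  apply/eqP; rewrite eq_le; apply/andP; split.
    have := h e1 off1 b1; rewrite /= (ag1 [::])// -[e1 (nm (head_name _ _))]/(head_val 9 e1 p X).
    by rewrite he1.
  by rewrite -(ag2 [::])//; have := least _ ag2 b2; rewrite -[e2 (nm [::])]eq2.
move=> h; split.
  apply/sat_ex_block; exists e1 => //; split => //.
  by rewrite /= (ag1 [::])// h -[e1 _]/(head_val 9 e1 p X) he1.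
apply/sat_all_block => e2 off2 b2.
have ag2 : agree [:: 9%N] e e2 by apply: off_agree off2.
by rewrite /= (ag2 [::])// h; exact: least.
Qed.

Lemma sat_ex_tmp e φ : fo_sat e (ex_tmp φ) <-> exists v1 v2,
  fo_sat (env_upd (env_upd e (nm [:: 2%N]) v1) (nm [:: 3%N]) v2) φ.
Proof. by []. Qed.

Lemma sat_at_tmp1 e φ : fo_sat e (at_tmp1 φ) <->
  fo_sat (env_upd e (nm [::]) (e (nm [:: 2%N]))) φ.
Proof.
have ne v : env_upd e (nm [::]) v (nm [:: 2%N]) = e (nm [:: 2%N]) by exact: env_upd_agree.
split=> [[v [h1 h2]]|h].
  by move: h1; rewrite /= env_updE ne => <-.
by exists (e (nm [:: 2%N])); split => //=; rewrite env_updE ne.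
Qed.

Lemma sat_at_tmp2 e φ : fo_sat e (at_tmp2 φ) <->
  fo_sat (env_upd e (nm [::]) (e (nm [:: 3%N]))) φ.
Proof.
have ne v : env_upd e (nm [::]) v (nm [:: 3%N]) = e (nm [:: 3%N]) by exact: env_upd_agree.
split=> [[v [h1 h2]]|h].
  by move: h1; rewrite /= env_updE ne => <-.
by exists (e (nm [:: 3%N])); split => //=; rewrite env_updE ne.
Qed.

Definition obs_ctx C e : Prop := pop_ctx e /\ obs_val e = ind C.

Lemma obs_ctx_agree T C e e' : agree T e e' ->
  all (fun k => k \notin T) [:: 0%N; 1%N; 4%N; 5%N; 6%N] -> obs_ctx C e -> obs_ctx C e'.
Proof.
move=> h /= /and5P[h0 h1 h4 h5 /andP[h6 _]] [pe oe]; split.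
  by apply: pop_ctx_agree pe; [exact: h | rewrite /= h0 h1 h4 h6].
by rewrite -oe; apply/funext => a; exact: h.
Qed.

Lemma obs_ctx_upd C b (d : bool) e : obs_ctx C e ->
  obs_ctx (if d then b |: C else C :\ b) (env_upd e (nm (obs_name b)) d%:R).
Proof.
move=> [pe oe]; split; first by apply: pop_ctx_agree pe; first exact: env_upd_agree.
apply/funext => a; rewrite /obs_val; have [->|ab] := eqVneq a b.
  by rewrite env_updE; case: d; rewrite !inE eqxx.
rewrite /env_upd; case: eqP => [/nm_inj/obs_name_inj/eqP|_]; first by rewrite (negbTE ab).
rewrite -[e _]/(obs_val e a) oe.
by case: d; rewrite !inE (negbTE ab).
Qed.

Lemma sat_inf_fo L C e : uniq L -> {in L, forall a, a \notin C} -> obs_ctx C e ->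
  fo_sat e (inf_fo 𝒜 rl p X L) <-> e (nm [::]) = inf_prob Δ 𝒜 p X L C.
Proof.
elim: L C e => [|b L IH] C e.
  by move=> _ _ [pe oe]; exact: sat_eventually.
rewrite cons_uniq => /andP[bL uL] hL ce.
have bC : b \notin C by apply: hL; exact: mem_head.
have hL1 : {in L, forall a, a \notin b |: C}.
  move=> a aL; rewrite !inE negb_or hL ?in_cons ?aL ?orbT// andbT.
  by apply: contraNneq bL => <-.
have hL2 : {in L, forall a, a \notin C} by move=> a aL; apply: hL; rewrite in_cons aL orbT.
(* Setting the indicator of b to 0 thus leaves C unchanged, which is the second branch of
   [inf_prob]. *)
have CbC : C :\ b = C.
  apply/setP => a; rewrite !inE; case: eqVneq => //= ->; exact/esym/negbTE.
set φ := inf_fo 𝒜 rl p X L.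
rewrite [inf_prob _ _ _ _ _ _]/=.
pose e2 v1 v2 := env_upd (env_upd e (nm [:: 2%N]) v1) (nm [:: 3%N]) v2.
have ag2 v1 v2 : agree [:: 2; 3]%N e (e2 v1 v2).
  apply: (@agree_trans _ _ (env_upd e (nm [:: 2%N]) v1)).
    by apply: agree_sub (@env_upd_agree _ _ _) => k; rewrite !inE => ->.
  by apply: agree_sub (@env_upd_agree _ _ _) => k; rewrite !inE => ->; rewrite orbT.
have c2 v1 v2 : obs_ctx C (e2 v1 v2) by apply: obs_ctx_agree ce; first exact: ag2.
have t1 v1 v2 : e2 v1 v2 (nm [:: 2%N]) = v1.
  by rewrite /e2 (@env_upd_agree _ [:: 3%N])// env_updE.
have t2 v1 v2 : e2 v1 v2 (nm [:: 3%N]) = v2 by rewrite /e2 env_updE.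
(* One statement for both copies of the subformula: [d] is the new indicator of b, and [k] the tag
   of the scratch variable that holds the value. *)
have sub v1 v2 (d : bool) k v : (k == 2%N) || (k == 3%N) -> v = e2 v1 v2 (nm [:: k]) ->
  (fo_sat (env_upd (env_upd (e2 v1 v2) (nm (obs_name b)) d%:R) (nm [::])
     (env_upd (e2 v1 v2) (nm (obs_name b)) d%:R (nm [:: k]))) φ <->
   v = inf_prob Δ 𝒜 p X L (if d then b |: C else C)).
  move=> hk ->; rewrite (@env_upd_agree _ (obs_name b)); last by case/orP: hk => /eqP->.
  set e3 := env_upd (env_upd _ _ _) _ _.
  have ce3 : obs_ctx (if d then b |: C else C) e3.
    apply: obs_ctx_agree; [exact: env_upd_agree | by [] |].
    by have := obs_ctx_upd b d (c2 v1 v2); case: d {e3} => //; rewrite CbC.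
  apply: iff_trans (IH _ _ uL _ ce3) _; first by case: d {e3 ce3}.
  by rewrite /e3 env_updE.
have oz v1 v2 v : v = e2 v1 v2 (nm [:: 0%N]) -> v = 0.
  by case: (c2 v1 v2) => -[[-> _ _] _] _.
have oo v1 v2 v : v = e2 v1 v2 (nm [:: 1%N]) -> v = 1.
  by case: (c2 v1 v2) => -[[_ -> _] _] _.
apply: iff_trans (sat_ex_tmp _ _) _; split.
  move=> [v1 [v2 [[d1 [E1 /sat_at_tmp1 h1]] [[d2 [E2 /sat_at_tmp2 h2]] h3]]]].
  rewrite -/(e2 v1 v2) in E1 E2 h1 h2 h3.
  move: E1 E2; rewrite /= !env_updE !(@env_upd_agree _ (obs_name b))// => /oo d1E /oz d2E.
  rewrite {}d1E in h1; rewrite {}d2E in h2.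
  have /(sub _ _ true 2%N v1 isT (esym (t1 _ _))) e1 := h1.
  have /(sub _ _ false 3%N v2 isT (esym (t2 _ _))) e2' := h2.
  move: h3; rewrite /= t1 t2 (ag2 _ _ [::])// => h3.
  by rewrite -e1 -e2' -h3 addrK.
move=> h; exists (inf_prob Δ 𝒜 p X L (b |: C)), (inf_prob Δ 𝒜 p X L C).
rewrite -/(e2 _ _); set w1 := inf_prob _ _ _ _ _ (_ |: _); set w2 := inf_prob _ _ _ _ _ _.
have [[[z0 z1 _] _] _] := c2 w1 w2.
split.
  exists 1; split; first by rewrite /= env_updE (@env_upd_agree _ (obs_name b))// z1.
  by apply/sat_at_tmp1; apply/(sub w1 w2 true 2%N w1 isT (esym (t1 _ _))).
split.
  exists 0; split; first by rewrite /= env_updE (@env_upd_agree _ (obs_name b))// z0.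
  by apply/sat_at_tmp2; apply/(sub w1 w2 false 3%N w2 isT (esym (t2 _ _))).
by rewrite /= t1 t2 (ag2 _ _ [::])// h subrK.
Qed.

End Semantics.

(** * Free variables of the formula *)

Section FreeVariables.
Variables (Q Γ A : finType) (𝒜 : observer Q Γ A).
Variables (rl : seq (rule Q Γ)) (pf : rule Q Γ -> fo) (p : Q) (X : Γ).
Hypothesis hpf : forall r, r \in rl -> all (pred1 0%N) (fo_fv (pf r)).
Local Notation S := (Q * A)%type.
Local Notation names := (all_names A rl).
Implicit Types (t : fo_term) (φ : fo).

Definition known (n : nat) : bool := (n == 0%N) || (n \in [seq nm l | l <- names]).
Definition closed_term t : bool := all known (fo_term_fv t).
Definition closed_fo φ : bool := all known (fo_fv φ).

Lemma known_name l : l \in names -> known (nm l).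
Proof. by move=> h; rewrite /known map_f ?orbT. Qed.

Lemma closed_V l : l \in names -> closed_term (V l).
Proof. by move=> h; rewrite /closed_term /= known_name. Qed.

(** [nm [::]] computes to 0, the only free variable that [expresses] permits. *)
Lemma closed_Ans : closed_term Ans. Proof. by []. Qed.
Lemma closed_Zero : closed_term Zero.
Proof. by apply: closed_V; rewrite mem_cat !inE. Qed.
Lemma closed_One : closed_term One.
Proof. by apply: closed_V; rewrite mem_cat !inE. Qed.
Lemma closed_Tmp1 : closed_term Tmp1.
Proof. by apply: closed_V; rewrite mem_cat !inE. Qed.
Lemma closed_Tmp2 : closed_term Tmp2.
Proof. by apply: closed_V; rewrite mem_cat !inE. Qed.
Lemma closed_rule r : r \in rl -> closed_term (V (rule_name r)).
Proof. by move=> h; apply: closed_V; rewrite !mem_cat map_f ?orbT. Qed.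
Lemma closed_obs (a : A) : closed_term (V (@obs_name A a)).
Proof. by apply: closed_V; rewrite !mem_cat (map_f (@obs_name A)) ?mem_enum ?orbT. Qed.
Lemma closed_pop6 (k : S * Γ * S) : closed_term (V (pop_name 6 k)).
Proof. by apply: closed_V; rewrite !mem_cat (map_f (@pop_name Q Γ A 6)) ?mem_triples ?orbT. Qed.
Lemma closed_pop7 (k : S * Γ * S) : closed_term (V (pop_name 7 k)).
Proof. by apply: closed_V; rewrite !mem_cat (map_f (@pop_name Q Γ A 7)) ?mem_triples ?orbT. Qed.
Lemma closed_head8 (h : Q * Γ) : closed_term (V (head_name 8 h)).
Proof. by apply: closed_V; rewrite !mem_cat (map_f (@head_name Q Γ 8)) ?mem_heads ?orbT. Qed.
Lemma closed_head9 (h : Q * Γ) : closed_term (V (head_name 9 h)).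
Proof. by apply: closed_V; rewrite !mem_cat (map_f (@head_name Q Γ 9)) ?mem_heads ?orbT. Qed.

Lemma closed_add t1 t2 : closed_term t1 -> closed_term t2 -> closed_term (TAdd t1 t2).
Proof. by move=> h1 h2; rewrite /closed_term /= all_cat; exact/andP. Qed.
Lemma closed_mul t1 t2 : closed_term t1 -> closed_term t2 -> closed_term (TMul t1 t2).
Proof. by move=> h1 h2; rewrite /closed_term /= all_cat; exact/andP. Qed.
Lemma closed_le t1 t2 : closed_term t1 -> closed_term t2 -> closed_fo (FLe t1 t2).
Proof. by move=> h1 h2; rewrite /closed_fo /= all_cat; exact/andP. Qed.
Lemma closed_eq t1 t2 : closed_term t1 -> closed_term t2 -> closed_fo (FEq t1 t2).
Proof. by move=> h1 h2; rewrite /closed_fo /= all_cat; exact/andP. Qed.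
Lemma closed_not φ : closed_fo φ -> closed_fo (FNot φ).
Proof. by []. Qed.
Lemma closed_and φ1 φ2 : closed_fo φ1 -> closed_fo φ2 -> closed_fo (FAnd φ1 φ2).
Proof. by move=> h1 h2; rewrite /closed_fo /= all_cat; exact/andP. Qed.
Lemma closed_imp φ1 φ2 : closed_fo φ1 -> closed_fo φ2 -> closed_fo (FImp φ1 φ2).
Proof. by move=> h1 h2; rewrite /closed_fo /= all_cat; exact/andP. Qed.
Lemma closed_ex i φ : closed_fo φ -> closed_fo (FEx i φ).
Proof.
move=> h; rewrite /closed_fo /= all_filter.
by apply: sub_all h => n /= ->; exact: implybT.
Qed.
Lemma closed_all i φ : closed_fo φ -> closed_fo (FAll i φ).
Proof.
move=> h; rewrite /closed_fo /= all_filter.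
by apply: sub_all h => n /= ->; exact: implybT.
Qed.

Lemma closed_sum (T : Type) (l : seq T) f : (forall x, closed_term (f x)) ->
  closed_term (sum_term l f).
Proof.
by move=> h; elim: l => [|x l IH]; [exact: closed_Zero | exact: closed_add].
Qed.

Lemma closed_big_and (T : eqType) (l : seq T) f : (forall x, x \in l -> closed_fo (f x)) ->
  closed_fo (big_and l f).
Proof.
elim: l => [|x l IH] h; first by apply: closed_eq; exact: closed_Zero.
apply: closed_and; first exact/h/mem_head.
by apply: IH => y yl; apply: h; rewrite in_cons yl orbT.
Qed.

Lemma closed_ex_block (T : Type) (f : T -> seq nat) l φ : closed_fo φ ->
  closed_fo (ex_block f l φ).
Proof. by move=> h; elim: l => //= x l; exact: closed_ex. Qed.

Lemma closed_all_block (T : Type) (f : T -> seq nat) l φ : closed_fo φ ->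
  closed_fo (all_block f l φ).
Proof. by move=> h; elim: l => //= x l; exact: closed_all. Qed.

Lemma closed_popped k base term (α : seq Γ) (s : S) :
  (forall x, closed_term (V (@pop_name Q Γ A k x))) ->
  (forall s Y, closed_term (base s Y)) -> (forall s, closed_term (term s)) ->
  closed_term (popped_term k base term α s).
Proof.
move=> hk hb ht; elim: α s => [|Y α IH] s //=; apply: closed_add => //.
by apply: closed_sum => t; apply: closed_mul.
Qed.

Lemma closed_rules h (F : rule Q Γ -> fo_term) : (forall r, closed_term (F r)) ->
  closed_term (rules_term rl h F).
Proof.
move=> hF; suff H l : {subset l <= rl} -> closed_term (rules_term l h F) by exact: H.
rewrite /rules_term; elim: l => [|r l IH] hl /=; first exact: closed_Zero.
have {}IH := IH (fun r' hr' => hl r' (mem_behead (s := r :: l) hr')).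
case: ifP => // _; apply: closed_add => //; apply: closed_mul => //.
by apply: closed_rule; apply: hl; exact: mem_head.
Qed.

Lemma closed_pop_solution k :
  (forall x, closed_term (V (@pop_name Q Γ A k x))) ->
  closed_fo (pop_solution 𝒜 rl k).
Proof.
move=> hk; have h0 := closed_Zero.
apply: closed_big_and => x _; apply: closed_and; apply: closed_le => //.
apply: closed_rules => r; apply: closed_popped => // *.
by case: ifP => _; [exact: closed_One | exact: closed_Zero].
Qed.

Lemma closed_next_min k (c : bool) h :
  (forall x, closed_term (V (@head_name Q Γ k x))) ->
  closed_term (next_min_term 𝒜 rl k c h).
Proof.
move=> hk; apply: closed_rules => r; apply: closed_popped => *.
- exact: closed_pop6.
- apply: closed_mul => //; case: c; [exact: closed_obs | exact: closed_One].
- exact: closed_Zero.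
Qed.

Lemma closed_stay_cond : closed_fo (stay_cond 𝒜 rl).
Proof.
apply: closed_big_and => h _; apply: closed_and; apply: closed_le.
- apply: closed_add; first exact: closed_head8.
  by apply: closed_sum => t; exact: closed_pop6.
- exact: closed_One.
- exact: closed_head8.
- by apply: closed_next_min; exact: closed_head8.
Qed.

Lemma closed_bound_cond : closed_fo (bound_cond 𝒜 rl).
Proof.
apply: closed_and.
  apply: closed_all_block; apply: closed_imp; first exact: closed_stay_cond.
  by apply: closed_big_and => h _; apply: closed_le; [exact: closed_head8 | exact: closed_head9].
apply: closed_big_and => h _; apply: closed_le; last exact: closed_head9.
by apply: closed_next_min; exact: closed_head9.
Qed.

Lemma closed_eventually : closed_fo (eventually_fo 𝒜 rl p X).
Proof.
have hb := closed_bound_cond; have h9 := @closed_head9; have hA := closed_Ans.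
apply: closed_and; first by apply: closed_ex_block; apply: closed_and => //; exact: closed_eq.
by apply: closed_all_block; apply: closed_imp => //; exact: closed_le.
Qed.

Lemma closed_at_tmp1 φ : closed_fo φ -> closed_fo (at_tmp1 φ).
Proof.
by move=> h; apply: closed_ex; apply: closed_and => //; apply: closed_eq.
Qed.

Lemma closed_at_tmp2 φ : closed_fo φ -> closed_fo (at_tmp2 φ).
Proof.
by move=> h; apply: closed_ex; apply: closed_and => //; apply: closed_eq.
Qed.

Lemma closed_inf_fo L : closed_fo (inf_fo 𝒜 rl p X L).
Proof.
elim: L => [|b L IH]; first exact: closed_eventually.
apply: closed_ex; apply: closed_ex; apply: closed_and; last apply: closed_and.
- apply: closed_ex; apply: closed_and; last exact: closed_at_tmp1.
  by apply: closed_eq; [exact: closed_obs | exact: closed_One].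
- apply: closed_ex; apply: closed_and; last exact: closed_at_tmp2.
  by apply: closed_eq; [exact: closed_obs | exact: closed_Zero].
- apply: closed_eq; last exact: closed_Tmp1.
  by apply: closed_add; [exact: closed_Ans | exact: closed_Tmp2].
Qed.

Lemma closed_acc_fo Bs : closed_fo (acc_fo 𝒜 rl p X Bs).
Proof.
elim: Bs => [|B Bs IH]; first by apply: closed_eq; [exact: closed_Ans | exact: closed_Zero].
apply: closed_ex; apply: closed_ex; apply: closed_and; last apply: closed_and.
- by apply: closed_at_tmp1; exact: closed_inf_fo.
- exact: closed_at_tmp2.
- apply: closed_eq; first exact: closed_Ans.
  by apply: closed_add; [exact: closed_Tmp1 | exact: closed_Tmp2].
Qed.

Lemma closed_body : closed_fo (body 𝒜 rl pf p X).
Proof.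
have h0 := closed_Zero; have h1 := closed_One.
apply: closed_and; last apply: closed_and; last apply: closed_and;
  last apply: closed_and; last apply: closed_and.
- apply: closed_and; first by apply: closed_eq => //; exact: closed_add.
  apply: closed_and; first by apply: closed_eq => //; exact: closed_mul.
  by apply: closed_not; exact: closed_eq.
- apply: closed_big_and => r hr; apply: closed_ex; apply: closed_and.
    by apply: sub_all (hpf hr) => n /= /eqP->.
  by apply: closed_eq; [exact: closed_Ans | exact: closed_rule].
- by apply: closed_pop_solution; exact: closed_pop6.
- apply: closed_all_block; apply: closed_imp.
    by apply: closed_pop_solution; exact: closed_pop7.
  by apply: closed_big_and => k _; apply: closed_le; [exact: closed_pop6 | exact: closed_pop7].
- by apply: closed_big_and => a _; apply: closed_eq => //; exact: closed_obs.
- exact: closed_acc_fo.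
Qed.

Lemma fv_ex_block (T : eqType) (f : T -> seq nat) (l : seq T) φ n :
  n \in fo_fv (ex_block f l φ) -> n \in fo_fv φ /\ n \notin [seq nm (f x) | x <- l].
Proof.
elim: l => //= x l IH; rewrite mem_filter in_cons => /andP[nx /IH[-> h]].
by rewrite negb_or nx h.
Qed.

Lemma main_fo_fv : all (pred1 0%N) (fo_fv (main_fo 𝒜 rl pf p X)).
Proof.
apply/allP => n /fv_ex_block[/(allP closed_body)].
by rewrite /known => /orP[//|h1 /negP].
Qed.

End FreeVariables.

(** * The whole formula expresses the acceptance probability *)

Section MainSemantics.
Variables (R : realType) (Q Γ A : finType) (Δ : ppda R Q Γ) (𝒜 : observer Q Γ A).
Variables (pf : rule Q Γ -> fo) (p : Q) (X : Γ).
Hypothesis hpf : presents Δ pf.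
Local Notation rl := (enum_fset (rules Δ)).
Implicit Types (e : nat -> R).

Lemma sat_acc_fo Bs e : all uniq Bs -> obs_ctx Δ 𝒜 finset.set0 e ->
  fo_sat e (acc_fo 𝒜 rl p X Bs) <->
  e (nm [::]) = \sum_(B <- Bs) inf_prob Δ 𝒜 p X B finset.set0.
Proof.
elim: Bs e => [|B Bs IH] e; first by move=> _ [[[e0 _ _] _] _]; rewrite big_nil /= e0.
move=> /andP[uB uBs] ce; rewrite big_cons.
pose e2 v1 v2 := env_upd (env_upd e (nm [:: 2%N]) v1) (nm [:: 3%N]) v2.
have ag2 v1 v2 : agree [:: 2; 3]%N e (e2 v1 v2).
  apply: (@agree_trans _ _ _ (env_upd e (nm [:: 2%N]) v1)).
    by apply: agree_sub (@env_upd_agree _ _ _ _) => k; rewrite !inE => ->.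
  by apply: agree_sub (@env_upd_agree _ _ _ _) => k; rewrite !inE => ->; rewrite orbT.
have c2 v1 v2 : obs_ctx Δ 𝒜 finset.set0 (e2 v1 v2).
  by apply: obs_ctx_agree ce; first exact: ag2.
have t1 v1 v2 : e2 v1 v2 (nm [:: 2%N]) = v1.
  by rewrite /e2 (@env_upd_agree _ _ [:: 3%N])// env_updE.
have t2 v1 v2 : e2 v1 v2 (nm [:: 3%N]) = v2 by rewrite /e2 env_updE.
have c3 v1 v2 v : obs_ctx Δ 𝒜 finset.set0 (env_upd (e2 v1 v2) (nm [::]) v).
  by apply: obs_ctx_agree (c2 v1 v2); first exact: env_upd_agree.
have inB v1 v2 v : fo_sat (env_upd (e2 v1 v2) (nm [::]) v) (inf_fo 𝒜 rl p X B) <->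
    v = inf_prob Δ 𝒜 p X B finset.set0.
  have hB : {in B, forall a, a \notin (finset.set0 : {set A})} by move=> a _; rewrite inE.
  have h := sat_inf_fo p X uB hB (c3 v1 v2 v).
  by rewrite h env_updE.
have inBs v1 v2 v : fo_sat (env_upd (e2 v1 v2) (nm [::]) v) (acc_fo 𝒜 rl p X Bs) <->
    v = \sum_(B <- Bs) inf_prob Δ 𝒜 p X B finset.set0.
  by apply: iff_trans (IH _ uBs (c3 _ _ _)) _; rewrite env_updE.
apply: iff_trans (sat_ex_tmp _ _) _; split.
  move=> [v1 [v2 [/sat_at_tmp1 h1 [/sat_at_tmp2 h2 h3]]]].
  rewrite -/(e2 v1 v2) in h1 h2 h3.
  move/inB: h1; move/inBs: h2; rewrite t1 t2 => <- <-.
  by move: h3; rewrite /= t1 t2 (ag2 _ _ [::]).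
set w1 := inf_prob _ _ _ _ _ _; set w2 := \sum_(_ <- _) _ => h.
exists w1, w2; rewrite -/(e2 _ _); split; first by apply/sat_at_tmp1/inB; rewrite t1.
split; first by apply/sat_at_tmp2/inBs; rewrite t2.
by rewrite /= t1 t2 (ag2 _ _ [::]).
Qed.

Lemma sat_const_cond e : fo_sat e const_cond <->
  e (nm [:: 0%N]) = 0 /\ e (nm [:: 1%N]) = 1.
Proof.
split=> [[/= h0 [h1 ne]]|[h0 h1]]; last first.
  by rewrite /= h0 h1 mulr1 addr0; split=> //; split => //; apply/eqP; rewrite oner_eq0.
have e0 : e (nm [:: 0%N]) = 0 by apply: (addrI (e (nm [:: 0%N]))); rewrite addr0.
split => //; rewrite e0 in ne.
by apply: (mulfI (x := e (nm [:: 1%N]))); [exact/eqP | rewrite mulr1].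
Qed.

Lemma sat_rule_cond e : fo_sat e (rule_cond rl pf) <->
  forall r, r \in rl -> e (nm (rule_name r)) = prob Δ r.
Proof.
rewrite /rule_cond sat_big_and; split=> h r hr; have := h r hr; have [_ hr'] := hpf hr.
  move=> [v [/hr' hv h2]]; rewrite -hv -[RHS](env_updE e [::] v).
  by move: h2; rewrite /= (@env_upd_agree _ _ [::] v (rule_name r)).
move=> er; exists (prob Δ r); split; first by apply/hr'; rewrite env_updE.
by rewrite /= env_updE (@env_upd_agree _ _ [::] _ (rule_name r)).
Qed.

Definition accept_value : R :=
  \sum_(B <- enum (obs_acc 𝒜)) inf_prob Δ 𝒜 p X (enum B) finset.set0.

Lemma sat_body e : fo_sat e (body 𝒜 rl pf p X) <->
  obs_ctx Δ 𝒜 finset.set0 e /\ e (nm [::]) = accept_value.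
Proof.
have acc (ce : obs_ctx Δ 𝒜 finset.set0 e) :
    fo_sat e (acc_fo 𝒜 rl p X [seq enum B | B : {set A} <- enum (obs_acc 𝒜)]) <->
    e (nm [::]) = accept_value.
  rewrite sat_acc_fo//; first by rewrite /accept_value big_map.
  by apply/allP => _ /mapP[B _ ->]; exact: enum_uniq.
split.
  move=> [/sat_const_cond[e0 e1] [/sat_rule_cond er [h1 [h2 [/sat_big_and h3 h4]]]]].
  have ce : ctx Δ e by [].
  have ke := (sat_pop_prob 𝒜 ce).1 (conj h1 h2).
  have oe : obs_ctx Δ 𝒜 finset.set0 e.
    split => //; apply/funext => a; rewrite inE -[RHS]e0.
    by apply: h3; rewrite mem_enum.
  by split => //; exact/(acc oe).
move=> [ce h]; have [[[e0 e1 er] ke] oe] := ce.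
split; first exact/sat_const_cond.
split; first exact/sat_rule_cond.
have cce : ctx Δ e by [].
have [h1 h2] := (sat_pop_prob 𝒜 cce).2 ke.
do 2!split => //; split; last exact/acc.
apply/sat_big_and => a _; rewrite /= e0.
by have := congr1 (fun f => f a) oe; rewrite inE.
Qed.

Lemma sat_main_fo e : fo_sat e (main_fo 𝒜 rl pf p X) <-> e 0%N = accept_value.
Proof.
rewrite /main_fo sat_ex_block; set N := all_names A rl.
have nN l : l \in N -> l <> [::].
  by rewrite /N /all_names !mem_cat !inE => /or4P[/or4P[]/eqP->|/mapP[r _ ->]
    |/mapP[a _ ->]|/or4P[] /mapP[k _ ->]].
have ans e' : off id N e e' -> e' (nm [::]) = e 0%N.
  by apply=> l /nN h /nm_inj e1; exact: h.
split=> [[e' h' /sat_body[_]]|h]; first by rewrite ans.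
pose k (x : Q * A * Γ * (Q * A)) := pop_prob Δ 𝒜 x.1.1 x.1.2 x.2.
(* The default 0 serves both [Zero] and the indicator of the empty set. *)
pose eF := upd_block (@rule_name Q Γ) (prob Δ) (upd_block (@pop_name Q Γ A 6) k
  (env_upd (fun=> 0) (nm [:: 1%N]) 1)).
(* Only quantified names take their value from [eF]; in particular the answer variable keeps its
   own. *)
pose e' n := if n \in [seq nm l | l <- N] then eF n else e n.
have e'N l : l \in N -> e' (nm l) = eF (nm l) by move=> hl; rewrite /e' map_f.
have off' : off id N e e'.
  move=> n hn; rewrite /e'; case: ifP => // /mapP[l lN nl].
  by case: (hn l lN).
exists e' => //; apply/sat_body; split; last by rewrite ans.
have eFr l : name_tag l != 4%N -> eF (nm l) = upd_block (@pop_name Q Γ A 6) k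
    (env_upd (fun=> 0) (nm [:: 1%N]) 1) (nm l).
  by move=> hl; apply: upd_block_out => r e1; move: hl; rewrite -e1.
have eFp l : name_tag l != 4%N -> name_tag l != 6%N -> eF (nm l) =
    env_upd (fun=> 0) (nm [:: 1%N]) 1 (nm l).
  by move=> h1 h2; rewrite eFr//; apply: upd_block_out => r e1; move: h2; rewrite -e1.
split; [split; [split|]|].
- by rewrite e'N ?eFp// /N mem_cat !inE.
- by rewrite e'N ?eFp ?env_updE// /N mem_cat !inE.
- move=> r hr; rewrite e'N; first by rewrite /eF upd_block_in//; exact: rule_name_inj.
  by rewrite /N !mem_cat (map_f (@rule_name Q Γ)) ?orbT.
- apply/funext => s; apply/funext => Y; apply/funext => t.
  rewrite /pop_val e'N; last first.
    by rewrite /N !mem_cat (map_f (@pop_name Q Γ A 6)) ?mem_triples ?orbT.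
  by rewrite eFr// upd_block_in//; exact: pop_name_inj.
- apply/funext => a; rewrite inE /obs_val e'N.
    by rewrite eFp// (@env_upd_agree _ _ [:: 1%N]).
  by rewrite /N !mem_cat (map_f (@obs_name A)) ?mem_enum ?orbT.
Qed.

Lemma main_fo_expresses : expresses (main_fo 𝒜 rl pf p X) accept_value.
Proof.
split; last by move=> e; exact: sat_main_fo.
by apply: main_fo_fv => r hr; have [] := hpf hr.
Qed.

End MainSemantics.

Local Close Scope classical_set_scope.
Local Close Scope ring_scope.

(** * Computing the formula *)

(** Redefined after each group of closure lemmas, so that a builder already treated is closed by its
    own lemma and not unfolded again. *)
Ltac cpt_hook := fail.
Ltac cpt_step := cbv beta; first
  [ exact cpt_id
  | match goal with H : computable ?F |- computable _ => exact H end
  | simple apply cpt_const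
  | match goal with H : computable ?F |- computable (fun x => ?F (@?a x)) =>
      refine (@cpt_comp a F H _) end
  | cpt_hook
  | simple apply cpt_node | simple apply cpt_fst | simple apply cpt_snd | simple apply cpt_if
  | match goal with |- computable (fun x => tfoldr (@?F x) (@?z x) (@?l x)) =>
      refine (@cpt_foldr F z l _ _ _) end ].
Ltac cpt := repeat cpt_step.

Definition tmap f l := tfoldr (fun x acc => Node (f x) acc) Leaf l.
Definition tcat l l' := tfoldr Node l' l.
Definition tpairs l l' :=
  tfoldr (fun x acc => tfoldr (fun y acc' => Node (Node x y) acc') acc l') Leaf l.
(** [CodeSeq.code] prepends n to a list with code m as 2^n * (2m + 1). In unary, doubling is
    concatenation of a number with itself. *)
Definition tcode l := tfoldr (fun n m =>
  tfoldr (fun _ acc => tcat acc acc) (Node Leaf (tcat m m)) n) Leaf l.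
(** The subtraction is truncated because [tsnd] maps a leaf to a leaf. *)
Definition tsub m n := tfoldr (fun _ acc => tsnd acc) m n.
Definition teqn m n :=
  tif (tsub m n) Leaf (tif (tsub n m) Leaf (Node Leaf Leaf)).
Definition teqp x y := tif (teqn (tfst x) (tfst y)) (teqn (tsnd x) (tsnd y)) Leaf.
(** Elements are encoded by their rank, so a finite type can be listed from its cardinality alone:
    each round increments the list and prepends 0. *)
Definition tenum n := tfoldr (fun _ acc => Node Leaf (tmap (Node Leaf) acc)) Leaf n.

Section Encodings.
Variables (T T' : Type).
Variables (enc : T -> tree) (enc' : T' -> tree).

Lemma tfoldr_enc (U : Type) (encU : U -> tree) F z (f : T -> U -> U) u l :
  z = encU u -> (forall x v, F (enc x) (encU v) = encU (f x v)) ->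
  tfoldr F z (enc_seq enc l) = encU (foldr f u l).
Proof. by move=> -> h; elim: l => //= x l ->. Qed.

Lemma tmap_enc F (f : T -> T') l : (forall x, F (enc x) = enc' (f x)) ->
  tmap F (enc_seq enc l) = enc_seq enc' (map f l).
Proof. by move=> h; elim: l => //= x l <-; rewrite -h. Qed.

Lemma tcat_enc l l' : tcat (enc_seq enc l) (enc_seq enc l') = enc_seq enc (l ++ l').
Proof. by elim: l => //= x l <-. Qed.

End Encodings.

Lemma tpairs_enc (T T' : Type) (enc : T -> tree) (enc' : T' -> tree) l l' :
  tpairs (enc_seq enc l) (enc_seq enc' l') =
  enc_seq (fun p => Node (enc p.1) (enc' p.2)) [seq (x, y) | x <- l, y <- l'].
Proof.
elim: l => //= x l; rewrite /tpairs /= => ->; rewrite -tcat_enc.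
by elim: l' (enc_seq _ _) => //= y l' IH a; rewrite IH.
Qed.

Lemma enc_natS n : enc_nat n.+1 = Node Leaf (enc_nat n). Proof. by []. Qed.

Lemma tfoldr_nat F z n : tfoldr F z (enc_nat n) = iter n (F Leaf) z.
Proof. by elim: n => //= n ->. Qed.

Lemma tcat_nat m n : tcat (enc_nat m) (enc_nat n) = enc_nat (m + n).
Proof. by rewrite /tcat tfoldr_nat /enc_nat iterD. Qed.

Lemma tcode_enc l : tcode (enc_seq enc_nat l) = enc_nat (nm l).
Proof.
rewrite /nm /CodeSeq.code; apply: tfoldr_enc => // n m.
rewrite tcat_nat -enc_natS tfoldr_nat addnn.
elim: n => [|n IH]; first by rewrite expn0 mul1n.
by rewrite iterS IH tcat_nat addnn expnS -mulnA mul2n.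
Qed.

Lemma tsub_nat m n : tsub (enc_nat m) (enc_nat n) = enc_nat (m - n).
Proof.
rewrite /tsub tfoldr_nat; elim: n => [|n IH]; first by rewrite subn0.
by rewrite iterS IH subnS; case: (m - n)%N.
Qed.

Definition enc_bool (b : bool) : tree := if b then Node Leaf Leaf else Leaf.

Lemma tif_bool b x y : tif (enc_bool b) x y = if b then x else y.
Proof. by case: b. Qed.

Lemma tif_nat n x y : tif (enc_nat n) x y = if n == 0%N then y else x.
Proof. by case: n. Qed.

Lemma teqn_nat m n : teqn (enc_nat m) (enc_nat n) = enc_bool (m == n).
Proof.
rewrite /teqn !tsub_nat !tif_nat [in RHS]eqn_leq -!subn_eq0.
by case: (m - n == 0)%N; case: (n - m == 0)%N.
Qed.

Lemma teqn_fin (T : finType) (x y : T) : teqn (enc_fin x) (enc_fin y) = enc_bool (x == y).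
Proof.
rewrite teqn_nat; congr enc_bool; apply/eqP/eqP => [/val_inj/enum_rank_inj//|->//].
Qed.

Lemma teqp_fin (T T' : finType) (x y : T * T') :
  teqp (Node (enc_fin x.1) (enc_fin x.2)) (Node (enc_fin y.1) (enc_fin y.2)) =
  enc_bool (x == y).
Proof.
rewrite /teqp /= !teqn_fin tif_bool; case: x y => x1 x2 [y1 y2] /=.
by rewrite xpair_eqE; case: eqP.
Qed.

Lemma tenum_enc (T : finType) : tenum (enc_nat #|T|) = enc_seq (@enc_fin T) (enum T).
Proof.
have -> : enc_seq (@enc_fin T) (enum T) = enc_seq enc_nat [seq rk x | x <- enum T].
  by elim: (enum T) => //= x l ->.
have -> : [seq rk x | x <- enum T] = iota 0 #|T|.
  apply: (@eq_from_nth _ 0%N); first by rewrite size_map size_iota cardE.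
  move=> i; rewrite size_map => hi; have hT : (i < #|T|)%N by rewrite cardE.
  have [x0 _] : {x0 | x0 \in enum T} by exists (enum_val (Ordinal hT)); rewrite mem_enum.
  rewrite (nth_map x0)// nth_iota// -(enum_val_nth x0 (Ordinal hT)).
  by rewrite /rk enum_valK.
rewrite /tenum tfoldr_nat; elim: #|T| => // n IH.
rewrite iterS IH /= -[Leaf in LHS]/(enc_nat 0) -add1n iotaDl; congr Node.
exact: tmap_enc.
Qed.

Lemma cpt_tcat f g : computable f -> computable g -> computable (fun x => tcat (f x) (g x)).
Proof. by move=> hf hg; rewrite /tcat; cpt. Qed.

Lemma cpt_tcode f : computable f -> computable (fun x => tcode (f x)).
Proof. move=> hf; rewrite /tcode /tcat; cpt. Qed.

Lemma cpt_teqn f g : computable f -> computable g -> computable (fun x => teqn (f x) (g x)).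
Proof. by move=> hf hg; rewrite /teqn /tsub; cpt. Qed.

Lemma cpt_teqp f g : computable f -> computable g -> computable (fun x => teqp (f x) (g x)).
Proof. by move=> hf hg; rewrite /teqp /teqn /tsub; cpt. Qed.

Lemma cpt_tenum f : computable f -> computable (fun x => tenum (f x)).
Proof. by move=> hf; rewrite /tenum /tmap; cpt. Qed.

Lemma cpt_tpairs f g : computable f -> computable g -> computable (fun x => tpairs (f x) (g x)).
Proof. by move=> hf hg; rewrite /tpairs; cpt. Qed.

Ltac cpt_hook ::= first [simple apply cpt_tcat | simple apply cpt_tcode | simple apply cpt_teqn
  | simple apply cpt_teqp | simple apply cpt_tenum | simple apply cpt_tpairs].

(** * The builders of the formula as functions on trees *)

Definition tVar l := Node (enc_nat 0) (tcode l).
Definition tAdd a b := Node (enc_nat 1) (Node a b).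
Definition tMul a b := Node (enc_nat 2) (Node a b).
Definition tLe a b := Node (enc_nat 0) (Node a b).
Definition tEq a b := Node (enc_nat 1) (Node a b).
Definition tAnd a b := Node (enc_nat 3) (Node a b).
Definition tImp a b := Node (enc_nat 5) (Node a b).
Definition tAll l a := Node (enc_nat 6) (Node (tcode l) a).
Definition tEx l a := Node (enc_nat 7) (Node (tcode l) a).

Definition tName (l : seq nat) := enc_seq enc_nat l.
Definition tZero := enc_term Zero.
Definition tOne := enc_term One.
Definition tAns := enc_term Ans.
Definition tTmp1 := enc_term Tmp1.
Definition tTmp2 := enc_term Tmp2.

Definition tsum f l := tfoldr (fun x acc => tAdd (f x) acc) tZero l.
Definition tbig_and f l := tfoldr (fun x acc => tAnd (f x) acc) (tEq tZero tZero) l.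
Definition tex_block f l a := tfoldr (fun x acc => tEx (f x) acc) a l.
Definition tall_block f l a := tfoldr (fun x acc => tAll (f x) acc) a l.

Definition tQ t := tenum (tfst (tfst t)).
Definition tG t := tenum (tfst (tsnd (tfst t))).
Definition tRules t := tsnd (tsnd (tfst t)).
Definition tA t := tenum (tfst (tfst (tsnd t))).
Definition tTable t := tfst (tsnd (tfst (tsnd t))).
Definition tInit t := tfst (tsnd (tsnd (tfst (tsnd t)))).
Definition tAcc t := tsnd (tsnd (tsnd (tfst (tsnd t)))).
Definition tHead t := tsnd (tsnd t).

Definition tStates t := tpairs (tQ t) (tA t).
Definition tHeads t := tpairs (tQ t) (tG t).
Definition tTriples t := tpairs (tpairs (tStates t) (tG t)) (tStates t).

Definition tpop_name (tag : nat) k :=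
  Node (enc_nat tag) (Node (tfst (tfst (tfst k))) (Node (tsnd (tfst (tfst k)))
    (Node (tsnd (tfst k)) (Node (tfst (tsnd k)) (Node (tsnd (tsnd k)) Leaf))))).
Definition thead_name (tag : nat) h :=
  Node (enc_nat tag) (Node (tfst h) (Node (tsnd h) Leaf)).
Definition tobs_name a := Node (enc_nat 5) (Node a Leaf).
Definition trule_name r := Node (enc_nat 4) (Node (tfst (tfst r)) (Node (tsnd (tfst r))
  (Node (tfst (tsnd r)) (tsnd (tsnd r))))).

(** On an encoded input the table is total, so the default [Leaf] is never the result. *)
Definition tnext t s Y := tfoldr (fun en acc =>
  tif (teqn (tfst (tfst en)) (tsnd s))
    (tif (teqp (tsnd (tfst en)) (Node (tfst s) Y)) (tsnd en) acc) acc) Leaf (tTable t).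

(* The terms for all states are computed at once, in an association list. *)
Definition tpopped t (tag : nat) base term α s :=
  tfoldr (fun en acc => tif (teqp s (tfst en)) (tsnd en) acc) Leaf
    (tfoldr (fun Y tbl => tmap (fun s' => Node s' (tAdd (base s' Y)
         (tfoldr (fun en acc => tAdd (tMul (tVar (tpop_name tag (Node (Node s' Y) (tfst en))))
            (tsnd en)) acc) tZero tbl))) (tStates t))
       (tmap (fun s' => Node s' (term s')) (tStates t)) α).

Definition trules_term t h F := tfoldr (fun rp acc =>
  tif (teqp (tfst (tfst rp)) h)
    (tAdd (tMul (tVar (trule_name (tfst rp))) (F (tfst rp))) acc) acc) tZero (tRules t).

Definition tpop_rhs t tag k :=
  trules_term t (Node (tfst (tfst (tfst k))) (tsnd (tfst k))) (fun r =>
    tpopped t tag (fun _ _ => tZero) (fun s => tif (teqp s (tsnd k)) tOne tZero)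
      (tsnd (tsnd r)) (Node (tfst (tsnd r)) (tnext t (tfst (tfst k)) (tsnd (tfst k))))).

Definition tpop_solution t tag := tbig_and (fun k =>
  tAnd (tLe tZero (tVar (tpop_name tag k)))
       (tLe (tpop_rhs t tag k) (tVar (tpop_name tag k)))) (tTriples t).

Definition tnext_min t tag (c : bool) h := trules_term t h (fun r =>
  tpopped t 6 (fun s Y => tMul (tVar (thead_name tag (Node (tfst s) Y)))
       (if c then tVar (tobs_name (tnext t s Y)) else tOne))
     (fun _ => tZero) (tsnd (tsnd r)) (Node (tfst (tsnd r)) (tInit t))).

Definition tstay_cond t := tbig_and (fun h =>
  tAnd (tLe (tAdd (tVar (thead_name 8 h))
      (tsum (fun u => tVar (tpop_name 6 (Node (Node (Node (tfst h) (tInit t)) (tsnd h)) u)))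
        (tStates t))) tOne)
    (tLe (tVar (thead_name 8 h)) (tnext_min t 8 true h))) (tHeads t).

Definition tbound_cond t :=
  tAnd (tall_block (thead_name 8) (tHeads t) (tImp (tstay_cond t)
         (tbig_and (fun h => tLe (tVar (thead_name 8 h)) (tVar (thead_name 9 h))) (tHeads t))))
       (tbig_and (fun h => tLe (tnext_min t 9 false h) (tVar (thead_name 9 h))) (tHeads t)).

Definition teventually t :=
  tAnd (tex_block (thead_name 9) (tHeads t)
         (tAnd (tbound_cond t) (tEq (tVar (thead_name 9 (tHead t))) tAns)))
       (tall_block (thead_name 9) (tHeads t)
         (tImp (tbound_cond t) (tLe tAns (tVar (thead_name 9 (tHead t)))))).

Definition tat_tmp1 a := tEx (tName [::]) (tAnd (tEq tAns tTmp1) a).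
Definition tat_tmp2 a := tEx (tName [::]) (tAnd (tEq tAns tTmp2) a).
Definition tex_tmp a := tEx (tName [:: 2]) (tEx (tName [:: 3]) a).

Definition tinf t L := tfoldr (fun b acc => tex_tmp (tAnd
    (tEx (tobs_name b) (tAnd (tEq (tVar (tobs_name b)) tOne) (tat_tmp1 acc)))
    (tAnd (tEx (tobs_name b) (tAnd (tEq (tVar (tobs_name b)) tZero) (tat_tmp2 acc)))
      (tEq (tAdd tAns tTmp2) tTmp1)))) (teventually t) L.

Definition tacc t := tfoldr (fun B acc => tex_tmp (tAnd (tat_tmp1 (tinf t B))
  (tAnd (tat_tmp2 acc) (tEq tAns (tAdd tTmp1 tTmp2))))) (tEq tAns tZero) (tAcc t).

Definition trule_cond t := tbig_and (fun rp =>
  tEx (tName [::]) (tAnd (tsnd rp) (tEq tAns (tVar (trule_name (tfst rp)))))) (tRules t).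

Definition tpop_least t := tall_block (tpop_name 7) (tTriples t) (tImp (tpop_solution t 7)
  (tbig_and (fun k => tLe (tVar (tpop_name 6 k)) (tVar (tpop_name 7 k))) (tTriples t))).

Definition tbody t :=
  tAnd (enc_fo const_cond) (tAnd (trule_cond t) (tAnd (tpop_solution t 6) (tAnd (tpop_least t)
   (tAnd (tbig_and (fun a => tEq (tVar (tobs_name a)) tZero) (tA t)) (tacc t))))).

Definition tall_names t :=
  tcat (enc_seq tName [:: [:: 0]; [:: 1]; [:: 2]; [:: 3]])
  (tcat (tmap (fun rp => trule_name (tfst rp)) (tRules t))
  (tcat (tmap tobs_name (tA t))
  (tcat (tmap (tpop_name 6) (tTriples t))
  (tcat (tmap (tpop_name 7) (tTriples t))
  (tcat (tmap (thead_name 8) (tHeads t)) (tmap (thead_name 9) (tHeads t))))))).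

Definition tmain t := tex_block id (tall_names t) (tbody t).
Lemma cpt_tA f : computable f -> computable (fun x => tA (f x)).
Proof. by move=> hf; rewrite /tA; cpt. Qed.
Lemma cpt_tStates f : computable f -> computable (fun x => tStates (f x)).
Proof. by move=> hf; rewrite /tStates /tQ /tA; cpt. Qed.
Lemma cpt_tHeads f : computable f -> computable (fun x => tHeads (f x)).
Proof. by move=> hf; rewrite /tHeads /tQ /tG; cpt. Qed.
Lemma cpt_tTriples f : computable f -> computable (fun x => tTriples (f x)).
Proof. by move=> hf; rewrite /tTriples /tStates /tQ /tG /tA; cpt. Qed.

Lemma cpt_tVar f : computable f -> computable (fun x => tVar (f x)).
Proof. by move=> hf; rewrite /tVar; cpt. Qed.

Lemma cpt_tnext f g h : computable f -> computable g -> computable h ->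
  computable (fun x => tnext (f x) (g x) (h x)).
Proof. by move=> hf hg hh; rewrite /tnext /tTable; cpt. Qed.

Ltac cpt_hook ::= first [simple apply cpt_tcat | simple apply cpt_tcode | simple apply cpt_teqn
  | simple apply cpt_teqp | simple apply cpt_tenum | simple apply cpt_tpairs
  | simple apply cpt_tA | simple apply cpt_tStates | simple apply cpt_tHeads
  | simple apply cpt_tTriples | simple apply cpt_tVar | simple apply cpt_tnext].

Lemma cpt_tpop_rhs tag f g : computable f -> computable g ->
  computable (fun x => tpop_rhs (f x) tag (g x)).
Proof.
move=> hf hg; rewrite /tpop_rhs /trules_term /tpopped /tmap /tAdd /tMul /tRules
  /tpop_name /trule_name; cpt.
Qed.

Lemma cpt_tnext_min tag c f g : computable f -> computable g ->
  computable (fun x => tnext_min (f x) tag c (g x)).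
Proof.
move=> hf hg; rewrite /tnext_min /trules_term /tpopped /tmap /tAdd /tMul /tRules
  /tpop_name /trule_name /thead_name /tobs_name /tInit; case: c; cpt.
Qed.

Ltac cpt_builder := first [simple apply cpt_tcat | simple apply cpt_tcode
  | simple apply cpt_teqn | simple apply cpt_teqp | simple apply cpt_tenum
  | simple apply cpt_tpairs | simple apply cpt_tA | simple apply cpt_tStates
  | simple apply cpt_tHeads | simple apply cpt_tTriples | simple apply cpt_tVar
  | simple apply cpt_tnext | simple apply cpt_tpop_rhs | simple apply cpt_tnext_min].
Ltac cpt_hook ::= cpt_builder.

Lemma cpt_tpop_solution tag f : computable f ->
  computable (fun x => tpop_solution (f x) tag).
Proof.
by move=> hf; rewrite /tpop_solution /tbig_and /tAnd /tLe /tEq /tpop_name; cpt.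
Qed.

Lemma cpt_tbound_cond f : computable f -> computable (fun x => tbound_cond (f x)).
Proof.
move=> hf; rewrite /tbound_cond /tall_block /tstay_cond /tsum /tbig_and /tAnd /tLe /tEq
  /tImp /tAll /tAdd /tpop_name /thead_name /tInit; cpt.
Qed.

Ltac cpt_hook ::= first [cpt_builder | simple apply cpt_tpop_solution
  | simple apply cpt_tbound_cond].

Lemma cpt_teventually f : computable f -> computable (fun x => teventually (f x)).
Proof.
move=> hf; rewrite /teventually /tall_block /tex_block /tAnd /tLe /tEq
  /tImp /tAll /tEx /thead_name /tHead; cpt.
Qed.

Lemma cpt_tpop_least f : computable f -> computable (fun x => tpop_least (f x)).
Proof.
move=> hf; rewrite /tpop_least /tall_block /tbig_and /tAnd /tLe /tEq /tImp /tAll /tpop_name; cpt.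
Qed.

Ltac cpt_hook ::= first [cpt_builder | simple apply cpt_tpop_solution | simple apply cpt_teventually
  | simple apply cpt_tpop_least].

Lemma cpt_tinf f g : computable f -> computable g -> computable (fun x => tinf (f x) (g x)).
Proof.
move=> hf hg; rewrite /tinf /tex_tmp /tat_tmp1 /tat_tmp2 /tEx /tAnd /tEq /tAdd /tobs_name; cpt.
Qed.

Ltac cpt_hook ::= first [cpt_builder | simple apply cpt_tpop_solution | simple apply cpt_tinf
  | simple apply cpt_tpop_least].

Lemma cpt_tacc f : computable f -> computable (fun x => tacc (f x)).
Proof.
move=> hf; rewrite /tacc /tex_tmp /tat_tmp1 /tat_tmp2 /tEx /tAnd /tEq /tAdd /tAcc; cpt.
Qed.

Ltac cpt_hook ::= first [cpt_builder | simple apply cpt_tpop_solution | simple apply cpt_tacc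
  | simple apply cpt_tpop_least].

Lemma cpt_tbody f : computable f -> computable (fun x => tbody (f x)).
Proof.
move=> hf; rewrite /tbody /trule_cond /tbig_and /tEx /tAnd /tEq /tRules /tobs_name
  /trule_name; cpt.
Qed.

Lemma cpt_tall_names f : computable f -> computable (fun x => tall_names (f x)).
Proof.
move=> hf; rewrite /tall_names /tmap /tRules /trule_name /tobs_name /tpop_name /thead_name; cpt.
Qed.

Ltac cpt_hook ::= first [simple apply cpt_tcode | simple apply cpt_tbody
  | simple apply cpt_tall_names].

Lemma cpt_tmain f : computable f -> computable (fun x => tmain (f x)).
Proof. by move=> hf; rewrite /tmain /tex_block /tEx; cpt. Qed.

(** * The tree builders produce the encoded formula *)

Section Correctness.
Variables (Q Γ A : finType) (𝒜 : observer Q Γ A).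
Variables (rl : seq (rule Q Γ)) (pf : rule Q Γ -> fo) (p : Q) (X : Γ).
Variable t : tree.
Local Notation S := (Q * A)%type.

Hypothesis tQE : tQ t = enc_seq (@enc_fin Q) (enum Q).
Hypothesis tGE : tG t = enc_seq (@enc_fin Γ) (enum Γ).
Hypothesis tAE : tA t = enc_seq (@enc_fin A) (enum A).
Hypothesis tRulesE : tRules t = enc_seq (fun r => Node (enc_rule r) (enc_fo (pf r))) rl.
Hypothesis tTableE : tTable t = enc_seq (fun ah : A * (Q * Γ) =>
  Node (Node (enc_fin ah.1) (enc_head ah.2)) (enc_fin (obs_step 𝒜 ah.1 ah.2)))
  (enum {: A * (Q * Γ)}).
Hypothesis tInitE : tInit t = enc_fin (obs_init 𝒜).
Hypothesis tAccE : tAcc t = enc_seq (enc_seq (@enc_fin A))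
  [seq enum B | B : {set A} <- enum (obs_acc 𝒜)].
Hypothesis tHeadE : tHead t = enc_head (p, X).

Definition enc_state (s : S) : tree := Node (enc_fin s.1) (enc_fin s.2).
Definition enc_triple (k : S * Γ * S) : tree :=
  Node (Node (enc_state k.1.1) (enc_fin k.1.2)) (enc_state k.2).

Lemma tAndE a b : tAnd (enc_fo a) (enc_fo b) = enc_fo (FAnd a b). Proof. by []. Qed.
Lemma tImpE a b : tImp (enc_fo a) (enc_fo b) = enc_fo (FImp a b). Proof. by []. Qed.
Lemma tEqE a b : tEq (enc_term a) (enc_term b) = enc_fo (FEq a b). Proof. by []. Qed.
Lemma tLeE a b : tLe (enc_term a) (enc_term b) = enc_fo (FLe a b). Proof. by []. Qed.
Lemma tAddE a b : tAdd (enc_term a) (enc_term b) = enc_term (TAdd a b). Proof. by []. Qed.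
Let tE := (tAndE, tImpE, tEqE, tLeE, tAddE).

Lemma tStatesE : tStates t = enc_seq enc_state (states Q A).
Proof. by rewrite /tStates tQE tAE tpairs_enc. Qed.

Lemma tHeadsE : tHeads t = enc_seq (@enc_head Q Γ) (heads Q Γ).
Proof. by rewrite /tHeads tQE tGE tpairs_enc. Qed.

Lemma tTriplesE : tTriples t = enc_seq enc_triple (triples Q Γ A).
Proof. by rewrite /tTriples tStatesE tGE !tpairs_enc. Qed.

Lemma tVarE l : tVar (enc_seq enc_nat l) = enc_term (V l).
Proof. by rewrite /tVar tcode_enc. Qed.

Lemma tpop_nameE tag k : tpop_name tag (enc_triple k) = enc_seq enc_nat (pop_name tag k).
Proof. by []. Qed.

Lemma thead_nameE tag (h : Q * Γ) :
  thead_name tag (enc_head h) = enc_seq enc_nat (head_name tag h).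
Proof. by []. Qed.

Lemma tobs_nameE (a : A) : tobs_name (enc_fin a) = enc_seq enc_nat (obs_name a).
Proof. by []. Qed.

Lemma trule_nameE (r : rule Q Γ) : trule_name (enc_rule r) = enc_seq enc_nat (rule_name r).
Proof.
rewrite /trule_name /rule_name /=; do 4 congr Node.
by elim: (r.2.2) => //= Y α ->.
Qed.

Lemma tnextE s Y : tnext t (enc_state s) (enc_fin Y) = enc_fin (obs_next 𝒜 s Y).
Proof.
rewrite /tnext tTableE.
have : (s.2, (s.1, Y)) \in enum {: A * (Q * Γ)} by rewrite mem_enum.
elim: (enum _) => //= -[a h] l IH; rewrite in_cons /= => hl.
rewrite teqn_fin (@teqp_fin _ _ h (s.1, Y)) !tif_bool.
have [[-> ->]|ne] := eqVneq (a, h) (s.2, (s.1, Y)); first by rewrite !eqxx.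
move: hl; rewrite eq_sym (negbTE ne) => /IH ->.
by move: ne; rewrite xpair_eqE; do 2?case: (_ == _).
Qed.

Lemma tsumE (T : Type) (enc : T -> tree) F (f : T -> fo_term) l :
  (forall x, F (enc x) = enc_term (f x)) ->
  tsum F (enc_seq enc l) = enc_term (sum_term l f).
Proof. by move=> h; apply: tfoldr_enc => // x v; rewrite h. Qed.

Lemma tbig_andE (T : Type) (enc : T -> tree) F (f : T -> fo) l :
  (forall x, F (enc x) = enc_fo (f x)) ->
  tbig_and F (enc_seq enc l) = enc_fo (big_and l f).
Proof. by move=> h; apply: tfoldr_enc => // x v; rewrite h. Qed.

Lemma tex_blockE (T : Type) (enc : T -> tree) F (f : T -> seq nat) l φ :
  (forall x, F (enc x) = enc_seq enc_nat (f x)) ->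
  tex_block F (enc_seq enc l) (enc_fo φ) = enc_fo (ex_block f l φ).
Proof. by move=> h; apply: tfoldr_enc => // x v; rewrite h /tEx tcode_enc. Qed.

Lemma tall_blockE (T : Type) (enc : T -> tree) F (f : T -> seq nat) l φ :
  (forall x, F (enc x) = enc_seq enc_nat (f x)) ->
  tall_block F (enc_seq enc l) (enc_fo φ) = enc_fo (all_block f l φ).
Proof. by move=> h; apply: tfoldr_enc => // x v; rewrite h /tAll tcode_enc. Qed.

Lemma lookup_enc (f : S -> fo_term) (l : seq S) s : s \in l ->
  tfoldr (fun en acc => tif (teqp (enc_state s) (tfst en)) (tsnd en) acc) Leaf
    (enc_seq (fun s' => Node (enc_state s') (enc_term (f s'))) l) = enc_term (f s).
Proof.
elim: l => //= s' l IH; rewrite in_cons (@teqp_fin _ _ s s') tif_bool.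
by case: eqP => [->|].
Qed.

Lemma tpoppedE tag tbase tterm base term α s :
  (forall s Y, tbase (enc_state s) (enc_fin Y) = enc_term (base s Y)) ->
  (forall s, tterm (enc_state s) = enc_term (term s)) ->
  tpopped t tag tbase tterm (enc_seq (@enc_fin Γ) α) (enc_state s) =
  enc_term (popped_term tag base term α s).
Proof.
(* The right side is turned into a lookup as well, so that the two association lists can be compared
   by induction on [α]. *)
move=> hb ht; rewrite /tpopped tStatesE -(@lookup_enc _ (states Q A)) ?mem_states//.
congr tfoldr; elim: α => [|Y α IH] /=.
  rewrite (@tmap_enc _ _ enc_state (fun s' => Node (enc_state s') (enc_term (term s'))) _ id).
    by rewrite map_id.
  by move=> u; rewrite ht.
rewrite IH.
rewrite (@tmap_enc _ _ enc_state (fun s' => Node (enc_state s')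
  (enc_term (popped_term tag base term (Y :: α) s'))) _ id) ?map_id// => u.
rewrite hb /=; congr (Node _ (tAdd _ _)).
by apply: tfoldr_enc => // v w; rewrite (tpop_nameE tag (u, Y, v)) tVarE.
Qed.

Lemma trules_termE (h : Q * Γ) F (f : rule Q Γ -> fo_term) :
  (forall r, F (enc_rule r) = enc_term (f r)) ->
  trules_term t (enc_head h) F = enc_term (rules_term rl h f).
Proof.
move=> hF; rewrite /trules_term tRulesE; apply: tfoldr_enc => // r v /=.
rewrite (@teqp_fin _ _ r.1 h) tif_bool -/(enc_rule r) trule_nameE tVarE hF.
by case: ifP.
Qed.

Lemma tpop_rhsE tag k : tpop_rhs t tag (enc_triple k) = enc_term (pop_rhs 𝒜 rl tag k).
Proof.
apply: (@trules_termE (k.1.1.1, k.1.2)) => r.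
have -> : Node (tfst (tsnd (enc_rule r))) (tnext t (tfst (tfst (enc_triple k)))
    (tsnd (tfst (enc_triple k)))) = enc_state (r.2.1, obs_next 𝒜 k.1.1 k.1.2).
  by rewrite /= tnextE.
apply: tpoppedE => // s; rewrite (@teqp_fin _ _ s k.2) tif_bool.
by case: ifP.
Qed.

Lemma tpop_solutionE tag : tpop_solution t tag = enc_fo (pop_solution 𝒜 rl tag).
Proof.
rewrite /tpop_solution tTriplesE; apply: tbig_andE => k.
by rewrite tpop_rhsE tpop_nameE tVarE.
Qed.

Lemma tnext_minE tag c (h : Q * Γ) :
  tnext_min t tag c (enc_head h) = enc_term (next_min_term 𝒜 rl tag c h).
Proof.
apply: trules_termE => r; rewrite tInitE.
apply: (@tpoppedE _ _ _ _ _ _ (r.2.1, obs_init 𝒜)) => // s Y.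
rewrite (thead_nameE tag (s.1, Y)) tVarE.
by case: c => //; rewrite tnextE tobs_nameE tVarE.
Qed.

Lemma tstay_condE : tstay_cond t = enc_fo (stay_cond 𝒜 rl).
Proof.
rewrite /tstay_cond tHeadsE; apply: tbig_andE => h.
rewrite tnext_minE thead_nameE tVarE tStatesE tInitE.
rewrite (@tsumE _ _ _ (fun u => V (pop_name 6 (h.1, obs_init 𝒜, h.2, u))))// => u.
by rewrite -tVarE.
Qed.

Lemma tbound_condE : tbound_cond t = enc_fo (bound_cond 𝒜 rl).
Proof.
rewrite /tbound_cond tHeadsE tstay_condE.
rewrite (@tbig_andE _ _ _ (fun h => FLe (V (head_name 8 h)) (V (head_name 9 h)))); last first.
  by move=> h; rewrite !thead_nameE !tVarE.
rewrite (@tbig_andE _ _ _ (fun h => FLe (next_min_term 𝒜 rl 9 false h) (V (head_name 9 h)))).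
  by rewrite !tE (@tall_blockE _ _ _ (@head_name Q Γ 8)).
by move=> h; rewrite tnext_minE thead_nameE tVarE.
Qed.

Lemma teventuallyE : teventually t = enc_fo (eventually_fo 𝒜 rl p X).
Proof.
rewrite /teventually tHeadsE tbound_condE tHeadE thead_nameE tVarE.
rewrite /tAns !tE.
by rewrite (@tall_blockE _ _ _ (@head_name Q Γ 9))// (@tex_blockE _ _ _ (@head_name Q Γ 9)).
Qed.

Lemma tEx_enc l φ : tEx (enc_seq enc_nat l) (enc_fo φ) = enc_fo (FEx (nm l) φ).
Proof. by rewrite /tEx tcode_enc. Qed.

Lemma tat_tmp1E φ : tat_tmp1 (enc_fo φ) = enc_fo (at_tmp1 φ).
Proof. exact: (tEx_enc [::] (FAnd (FEq Ans Tmp1) φ)). Qed.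

Lemma tat_tmp2E φ : tat_tmp2 (enc_fo φ) = enc_fo (at_tmp2 φ).
Proof. exact: (tEx_enc [::] (FAnd (FEq Ans Tmp2) φ)). Qed.

Lemma tex_tmpE φ : tex_tmp (enc_fo φ) = enc_fo (ex_tmp φ).
Proof. by rewrite /tex_tmp /tName !tEx_enc. Qed.

Lemma tinfE L : tinf t (enc_seq (@enc_fin A) L) = enc_fo (inf_fo 𝒜 rl p X L).
Proof.
apply: tfoldr_enc; first exact: teventuallyE.
move=> b φ; rewrite tobs_nameE tVarE tat_tmp1E tat_tmp2E.
by rewrite /tOne /tZero /tAns /tTmp1 /tTmp2 !tE !tEx_enc !tE tex_tmpE.
Qed.

Lemma taccE : tacc t =
  enc_fo (acc_fo 𝒜 rl p X [seq enum B | B : {set A} <- enum (obs_acc 𝒜)]).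
Proof.
rewrite /tacc tAccE; apply: tfoldr_enc => // B φ.
by rewrite tinfE tat_tmp1E tat_tmp2E /tAns /tTmp1 /tTmp2 !tE tex_tmpE.
Qed.

Lemma trule_condE : trule_cond t = enc_fo (rule_cond rl pf).
Proof.
rewrite /trule_cond tRulesE; apply: tbig_andE => r.
rewrite [tfst _]/= [tsnd _]/= trule_nameE tVarE.
by rewrite /tAns !tE /tName tEx_enc.
Qed.

Lemma tpop_leastE : tpop_least t = enc_fo (pop_least 𝒜 rl).
Proof.
rewrite /tpop_least tpop_solutionE tTriplesE.
rewrite (@tbig_andE _ _ _ (fun k => FLe (V (pop_name 6 k)) (V (pop_name 7 k)))); last first.
  by move=> k; rewrite !tpop_nameE !tVarE.
by rewrite tE (@tall_blockE _ _ _ (@pop_name Q Γ A 7)).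
Qed.

Lemma tbodyE : tbody t = enc_fo (body 𝒜 rl pf p X).
Proof.
rewrite /tbody trule_condE tpop_solutionE tpop_leastE taccE tAE.
rewrite (@tbig_andE _ _ _ (fun a => FEq (V (obs_name a)) Zero))// => a.
by rewrite tobs_nameE tVarE.
Qed.

Lemma tall_namesE : tall_names t = enc_seq (enc_seq enc_nat) (all_names A rl).
Proof.
rewrite /tall_names tRulesE tAE tTriplesE tHeadsE /all_names.
rewrite (@tmap_enc _ _ _ (enc_seq enc_nat) _ (@rule_name Q Γ)); last first.
  by move=> r; rewrite /= -/(enc_rule r) trule_nameE.
rewrite (@tmap_enc _ _ _ (enc_seq enc_nat) _ (@obs_name A))//.
rewrite (@tmap_enc _ _ _ (enc_seq enc_nat) _ (@pop_name Q Γ A 6))//.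
rewrite (@tmap_enc _ _ _ (enc_seq enc_nat) _ (@pop_name Q Γ A 7))//.
rewrite (@tmap_enc _ _ _ (enc_seq enc_nat) _ (@head_name Q Γ 8))//.
rewrite (@tmap_enc _ _ _ (enc_seq enc_nat) _ (@head_name Q Γ 9))//.
by rewrite /tName !tcat_enc.
Qed.

Lemma tmainE : tmain t = enc_fo (main_fo 𝒜 rl pf p X).
Proof. by rewrite /tmain tall_namesE tbodyE; exact: tex_blockE. Qed.

End Correctness.

Local Open Scope ring_scope.

Ltac cpt_hook ::= first [simple apply cpt_tmain | simple apply cpt_tcode].

Section Input.
Variables (R : realType) (Q Γ A : finType) (Δ : ppda R Q Γ) (𝒜 : observer Q Γ A).
Variables (pf : rule Q Γ -> fo) (p : Q) (X : Γ).

Lemma tmain_input : tmain (enc_input Δ pf 𝒜 (p, X)) =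
  enc_fo (main_fo 𝒜 (enum_fset (rules Δ)) pf p X).
Proof.
apply: tmainE; rewrite /tQ /tG /tA ?tenum_enc//.
rewrite /tAcc /=; elim: (enum (obs_acc 𝒜)) => //= B l ->; congr Node.
Qed.

End Input.

(** * Comparison with a rational number *)

Definition nat_term (n : nat) : fo_term := iter n (TAdd One) Zero.

Definition cmp_fo (c : comparison_sym) (t u : fo_term) : fo :=
  match c with
  | CLe => FLe t u
  | CLt => FNot (FLe u t)
  | CGe => FLe u t
  | CGt => FNot (FLe t u)
  | CEq => FEq t u
  end.

(** The comparison is multiplied by the denominator, and a negative numerator moves to the left
    side, since only natural numbers can be written as terms. *)
Definition rat_lhs (y : rat) : fo_term :=
  let t := TMul Ans (nat_term `|denq y|) in
  if numq y is Negz n then TAdd t (nat_term n.+1) else t.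

Definition rat_rhs (y : rat) : fo_term :=
  if numq y is Posz n then nat_term n else Zero.

(** [Ans] is bound together with the constants, which closes the formula; [φ] fixes its value. *)
Definition compare_fo (c : comparison_sym) (y : rat) (φ : fo) : fo :=
  ex_block id [:: [:: 0%N]; [:: 1%N]; [::]]
    (FAnd const_cond (FAnd (cmp_fo c (rat_lhs y) (rat_rhs y)) φ)).

Definition tnat_term n := tfoldr (fun _ acc => tAdd tOne acc) tZero n.
Definition tNot a := Node (enc_nat 2) a.
Definition tcmp c t u :=
  tif c (tif (tsnd c) (tif (tsnd (tsnd c)) (tif (tsnd (tsnd (tsnd c)))
    (tEq t u) (tNot (tLe t u))) (tLe u t)) (tNot (tLe u t))) (tLe t u).
(** The sign of an integer is its left subtree. [Negz n] stands for -(n + 1), whence the additional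
    leaf in the second summand. *)
Definition trat_lhs y :=
  tif (tfst (tfst y))
    (tAdd (tMul tAns (tnat_term (tsnd (tsnd y)))) (tnat_term (Node Leaf (tsnd (tfst y)))))
    (tMul tAns (tnat_term (tsnd (tsnd y)))).
Definition trat_rhs y := tif (tfst (tfst y)) tZero (tnat_term (tsnd (tfst y))).
Definition tcompare t :=
  tEx (tName [:: 0%N]) (tEx (tName [:: 1%N]) (tEx (tName [::]) (tAnd (enc_fo const_cond)
    (tAnd (tcmp (tfst (tsnd t)) (trat_lhs (tsnd (tsnd t))) (trat_rhs (tsnd (tsnd t))))
      (tmain (tfst t)))))).

Lemma cpt_tcompare : computable tcompare.
Proof.
rewrite /tcompare /tcmp /trat_lhs /trat_rhs /tnat_term /tNot /tEx /tAnd /tLe /tEq /tAdd /tMul.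
by cpt.
Qed.

Lemma tnat_termE n : tnat_term (enc_nat n) = enc_term (nat_term n).
Proof. by rewrite /tnat_term tfoldr_nat; elim: n => //= n ->. Qed.

Lemma tcmpE c t u : tcmp (enc_cmp c) (enc_term t) (enc_term u) = enc_fo (cmp_fo c t u).
Proof. by case: c. Qed.

Lemma tcompareE t c y φ : tmain t = enc_fo φ ->
  tcompare (Node t (Node (enc_cmp c) (enc_rat y))) = enc_fo (compare_fo c y φ).
Proof.
move=> h; rewrite /tcompare -[tmain _]/(tmain t) h.
rewrite -[tcmp _ _ _]/(tcmp (enc_cmp c) (trat_lhs (enc_rat y)) (trat_rhs (enc_rat y))).
have -> : trat_lhs (enc_rat y) = enc_term (rat_lhs y).
  rewrite /trat_lhs /rat_lhs /=; have := denq_gt0 y; case: (denq y) => // d _.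
  by case: (numq y) => n /=; rewrite ?(tnat_termE d) ?(tnat_termE n.+1).
have -> : trat_rhs (enc_rat y) = enc_term (rat_rhs y).
  by rewrite /trat_rhs /rat_rhs /=; case: (numq y) => n //=; rewrite tnat_termE.
by rewrite tcmpE !tAndE /tName !tEx_enc.
Qed.

Section Compare.
Variable R : realType.
Implicit Type e : nat -> R.

Lemma eval_nat_term n e : e (nm [:: 0%N]) = 0 -> e (nm [:: 1%N]) = 1 ->
  fo_eval e (nat_term n) = n%:R.
Proof. by move=> e0 e1; elim: n => //= n ->; rewrite e1 -natr1 addrC. Qed.

Lemma sat_cmp_fo c t u e : fo_sat e (cmp_fo c t u) <-> cmp_rel c (fo_eval e t) (fo_eval e u).
Proof.
by case: c => //=; rewrite ltNge; split=> /negP.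
Qed.

Lemma cmp_rel_pmul2r c (x y d : R) : 0 < d -> cmp_rel c (x * d) (y * d) <-> cmp_rel c x y.
Proof.
move=> d0; case: c => /=; rewrite ?ler_pM2r ?ltr_pM2r//.
by split=> [/mulIf|->//]; apply; rewrite gt_eqF.
Qed.

Lemma cmp_rel_add2r c (x y z : R) : cmp_rel c (x + z) (y + z) <-> cmp_rel c x y.
Proof. by case: c => /=; rewrite ?lerD2r ?ltrD2r//; split=> [/addIr|->]. Qed.

Lemma sat_rat_cmp c y e : e (nm [:: 0%N]) = 0 -> e (nm [:: 1%N]) = 1 ->
  fo_sat e (cmp_fo c (rat_lhs y) (rat_rhs y)) <-> cmp_rel c (e (nm [::])) (ratr y).
Proof.
move=> e0 e1; rewrite sat_cmp_fo.
have d0 : 0 < (denq y)%:~R :> R by rewrite ltr0z denq_gt0.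
rewrite -(cmp_rel_pmul2r c (e (nm [::])) (ratr y) d0) /ratr divfK ?gt_eqF//.
have dE : fo_eval e (nat_term `|denq y|) = (denq y)%:~R.
  by rewrite eval_nat_term// natr_absz gtr0_norm ?denq_gt0.
have lE : fo_eval e (TMul Ans (nat_term `|denq y|)) = e (nm [::]) * (denq y)%:~R.
  by rewrite -dE.
rewrite /rat_lhs /rat_rhs; case: (numq y) => n; first by rewrite eval_nat_term// lE.
have -> t u : fo_eval e (TAdd t u) = fo_eval e t + fo_eval e u by [].
rewrite lE eval_nat_term//.
rewrite -(cmp_rel_add2r c _ ((Negz n)%:~R) n.+1%:R) NegzE mulrNz addNr.
by rewrite -[fo_eval e Zero]/(e _) e0.
Qed.

Lemma compare_fo_closed c y φ : all (pred1 0%N) (fo_fv φ) -> fo_closed (compare_fo c y φ).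
Proof.
move=> hφ; rewrite /fo_closed; case E : (fo_fv _) => [//|n l].
have : n \in fo_fv (compare_fo c y φ) by rewrite E mem_head.
move=> /fv_ex_block[+ h]; suff H : {subset fo_fv (FAnd const_cond
    (FAnd (cmp_fo c (rat_lhs y) (rat_rhs y)) φ)) <= [:: nm [:: 0%N]; nm [:: 1%N]; nm [::]]}.
  by move/H; rewrite (negbTE h).
clear E h.
pose B := [:: nm [:: 0%N]; nm [:: 1%N]; nm [::]].
have hn k : {subset fo_term_fv (nat_term k) <= B}.
  elim: k => [|k IH] j; first by rewrite [fo_term_fv _]/= /B !inE => ->.
  by rewrite /= in_cons => /orP[/eqP->|/IH//]; rewrite /B !inE eqxx orbT.
have hl : {subset fo_term_fv (rat_lhs y) <= B}.
  rewrite /rat_lhs => j; case: (numq y) => k; last rewrite [fo_term_fv _]/= in_cons mem_cat.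
    by rewrite [fo_term_fv _]/= in_cons => /orP[/eqP->|/hn//]; rewrite /B !inE eqxx !orbT.
  by move=> /or3P[/eqP->|/hn//|/(hn k.+1)//]; rewrite /B !inE eqxx !orbT.
have hr : {subset fo_term_fv (rat_rhs y) <= B}.
  rewrite /rat_rhs => j; case: (numq y) => k; first exact: hn.
  by rewrite [fo_term_fv _]/= /B !inE => ->.
have hc : {subset fo_fv (cmp_fo c (rat_lhs y) (rat_rhs y)) <= B}.
  by move=> j; case: c => /=; rewrite mem_cat => /orP[]; first [exact: hl | exact: hr].
have -> t u w : fo_fv (FAnd t (FAnd u w)) = fo_fv t ++ (fo_fv u ++ fo_fv w) by [].
move=> j; rewrite !mem_cat => /orP[|/orP[/hc//|/(allP hφ)/eqP->]].
  rewrite !inE; do ?case: (j == _) => //=.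
by rewrite !inE eqxx !orbT.
Qed.

Lemma compare_fo_holds c y φ (v : R) : expresses φ v ->
  fo_holds R (compare_fo c y φ) <-> cmp_rel c v (ratr y).
Proof.
move=> [_ hφ]; split=> [/(_ (fun=> 0))|h e].
  move=> /sat_ex_block[e' _ [/sat_const_cond[e0 e1] [/(sat_rat_cmp _ _ e0 e1)]]].
  by move=> + /hφ; rewrite -[nm [::]]/0%N => + <-.
pose e' n := if n == nm [:: 0%N] then 0 else if n == nm [:: 1%N] then 1 : R else
  if n == nm [::] then v else e n.
apply/sat_ex_block; exists e'.
  move=> n hn; rewrite /e'; do 3?case: eqP => [nE|_].
  - by case: (hn [:: 0%N]).
  - by case: (hn [:: 1%N]).
  - by case: (hn [::]).
  - by [].
have e0 : e' (nm [:: 0%N]) = 0 by [].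
have e1 : e' (nm [:: 1%N]) = 1 by [].
split; first exact/sat_const_cond.
by split; [apply/sat_rat_cmp | apply/hφ].
Qed.

End Compare.

Theorem theorem5p22 (R : realType) :
  exists M Mcmp : prog,
  forall (Q Γ : finType) (Δ : ppda R Q Γ) (pf : rule Q Γ -> fo)
         (A : finType) (𝒜 : observer Q Γ A) (p : Q) (X : Γ)
         (P : {measure set (run_space Δ (p, [:: X])) -> \bar R}),
    presents Δ pf -> is_run_measure P ->
    (exists Φ : fo,
       computes M (enc_input Δ pf 𝒜 (p, X)) (enc_fo Φ) /\
       expresses Φ (fine (P (accepting Δ 𝒜 (p, [:: X]))))) /\
    (forall (c : comparison_sym) (y : rat), exists Ψ : fo,
       [/\ computes Mcmp
             (Node (enc_input Δ pf 𝒜 (p, X)) (Node (enc_cmp c) (enc_rat y)))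
             (enc_fo Ψ),
           fo_closed Ψ &
           fo_holds R Ψ <-> cmp_rel c (fine (P (accepting Δ 𝒜 (p, [:: X])))) (ratr y)]).
Proof.
(* The tree functions mention no particular automaton, so both programs are fixed before the input
   is given. *)
have [M hM] := cpt_tmain cpt_id; have [Mcmp hMcmp] := cpt_tcompare.
exists M, Mcmp => Q Γ Δ pf A 𝒜 p X P hpf hP.
rewrite (prob_accepting 𝒜 hP) -[fine _]/(accept_value Δ 𝒜 p X).
have hΦ := main_fo_expresses 𝒜 p X hpf.
have hin := tmain_input Δ 𝒜 pf p X.
split; first by eexists; split; last exact: hΦ; rewrite -hin; exact: hM.
move=> c y; exists (compare_fo c y (main_fo 𝒜 (enum_fset (rules Δ)) pf p X)); split.
- by rewrite -(tcompareE c y hin); exact: hMcmp.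
- by apply: compare_fo_closed; case: hΦ.
- exact: compare_fo_holds.
Qed.
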